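(* There is an algorithm which, given a matrix $B$ representing a basis of $M_{s,\ell}$ with $BW_\ell$ in weak Popov form, computes a matrix $B'$ representing a basis of $M_{s,\ell+1}$ with $B'W_{\ell+1}$ in weak Popov form, using $O(\ell^3 s n\log^2 n\log\log n)$ operations in $\mathbb F_q$.
   Context: Let $\mathbb F_q$ be a finite field, $1\le k<n<q$, $\alpha_0,\dots,\alpha_{n-1}$ distinct nonzero elements of $\mathbb F_q$, $w_0,\dots,w_{n-1}$ nonzero elements of $\mathbb F_q$, $r\in\mathbb F_q^n$, $r_i'=r_i/w_i$. For positive integers $s\le\ell$ (standing assumption: $s,\ell\in O(n^2)$), $M_{s,\ell}$ is the $\mathbb F_q[X]$-module of all $Q\in\mathbb F_q[X,Y]$ of $Y$-degree at most $\ell$ such that for each $i$, $Q(X+\alpha_i,Y+r_i')$ has no monomials of total degree less than $s$. A polynomial $\sum_t Q_t(X)Y^t$ has coefficient vector $(Q_0,Q_1,\dots)$; a matrix represents a basis if its rows are the coefficient vectors of the basis elements. $W_\ell=\mathrm{diag}(1,X^{k-1},\dots,X^{\ell(k-1)})$. For $v\in\mathbb F_q[X]^m$, $\deg v=\max_i\deg v_i$ and $\mathrm{LP}(v)=\max\{i:\deg v_i=\deg v\}$; a matrix is in weak Popov form if its rows have pairwise different leading positions. *)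

(* Defs.v *)
From HB Require Import structures.
From mathcomp Require Import all_boot all_order all_algebra.
Set Implicit Arguments. Unset Strict Implicit. Unset Printing Implicit Defensive.
Import GRing.Theory.
Local Open Scope ring_scope.

(* The bivariate polynomial sum_t Q_t(X) Y^t with coefficient vector Q,
   shifted: Q(X + a, Y + b), as an element of {poly {poly F}}
   (outer variable = Y, inner variable = X). *)
Definition shiftedXY (F : fieldType) (N : nat) (a b : F)
    (Q : 'rV[{poly F}]_N) : {poly {poly F}} :=
  \sum_(t < N) ((Q ord0 t) \Po ('X + a%:P))%:P * ('X + (b%:P)%:P) ^+ t.

Definition vanishes_to (F : fieldType) (N : nat) (s : nat) (a b : F)
    (Q : 'rV[{poly F}]_N) : Prop :=
  forall u v : nat, (u + v < s)%N -> ((shiftedXY a b Q)`_v)`_u = 0.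

Definition inM (F : fieldType) (n : nat) (alpha r' : 'I_n -> F) (s l : nat)
    (Q : 'rV[{poly F}]_l.+1) : Prop :=
  forall i : 'I_n, vanishes_to s (alpha i) (r' i) Q.

Definition is_basis (F : fieldType) (m N : nat)
    (P : 'rV[{poly F}]_N -> Prop) (B : 'M[{poly F}]_(m, N)) : Prop :=
  [/\ forall i : 'I_m, P (row i B),
      forall v, P v -> exists c : 'rV[{poly F}]_m, v = c *m B
    & forall c : 'rV[{poly F}]_m, c *m B = 0 -> c = 0].

(* rdeg v = 1 + deg v (0 for the zero vector), using size p = 1 + deg p. *)
Definition rdeg (F : fieldType) (N : nat) (v : 'rV[{poly F}]_N) : nat :=
  \max_(j < N) size (v ord0 j).

Definition LP (F : fieldType) (N : nat) (v : 'rV[{poly F}]_N) : nat :=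
  \max_(j < N | size (v ord0 j) == rdeg v) (j : nat).

Definition weak_popov (F : fieldType) (m N : nat) (B : 'M[{poly F}]_(m, N)) : Prop :=
  forall i i' : 'I_m, i != i' -> LP (row i B) != LP (row i' B).

Definition Wmat (F : fieldType) (k l : nat) : 'M[{poly F}]_l.+1 :=
  diag_mx (\row_(t < l.+1) 'X^(t * (k - 1))).

(* Programs are polymorphic in an abstract carrier V of field elements, so
   field elements can only be produced/inspected via the counted primitive
   operations below; all other (control, index) computation is free. *)
Inductive fop := FAdd | FSub | FMul | FDiv.

Inductive prog (V A : Type) : Type :=
| Ret : A -> prog V A
| Zero : (V -> prog V A) -> prog V A
| One : (V -> prog V A) -> prog V A
| Op : fop -> V -> V -> (V -> prog V A) -> prog V A
| IsZero : V -> (bool -> prog V A) -> prog V A.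

Arguments Ret {V A}.
Arguments Zero {V A}.
Arguments One {V A}.
Arguments Op {V A}.
Arguments IsZero {V A}.

Definition eval_op (F : fieldType) (o : fop) (x y : F) : F :=
  match o with
  | FAdd => x + y | FSub => x - y | FMul => x * y | FDiv => x / y
  end.

Fixpoint run (F : fieldType) (A : Type) (p : prog F A) : A * nat :=
  match p with
  | Ret a => (a, 0%N)
  | Zero k => let r := run (k 0) in (r.1, r.2.+1)
  | One k => let r := run (k 1) in (r.1, r.2.+1)
  | Op o x y k => let r := run (k (eval_op o x y)) in (r.1, r.2.+1)
  | IsZero x k => let r := run (k (x == 0)) in (r.1, r.2.+1)
  end.

(* An algorithm: inputs n, k, s, l, alpha, w, r (as lists) and the matrix B
   (list of rows, each a list of coefficient lists); output a matrix in the
   same encoding. *)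
Definition algo : Type :=
  forall V : Type, nat -> nat -> nat -> nat -> seq V -> seq V -> seq V ->
    seq (seq (seq V)) -> prog V (seq (seq (seq V))).

Definition enc_vec (F : fieldType) (n : nat) (f : 'I_n -> F) : seq F :=
  [seq f i | i <- enum 'I_n].

Definition enc_mx (F : fieldType) (m N : nat) (B : 'M[{poly F}]_(m, N))
  : seq (seq (seq F)) :=
  [seq [seq polyseq (B i j) | j <- enum 'I_N] | i <- enum 'I_m].

Definition dec_mx (F : fieldType) (N : nat) (out : seq (seq (seq F)))
  : 'M[{poly F}]_(size out, N) :=
  \matrix_(i < size out, j < N) Poly (nth [::] (nth [::] out i) j).

Definition good_output (F : fieldType) (n k s l : nat) (alpha r' : 'I_n -> F)
    (out : seq (seq (seq F))) : Prop :=
  [/\ all (fun row => size row == l.+2) out,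
      is_basis (@inM F n alpha r' s l.+1) (dec_mx l.+2 out)
    & weak_popov (dec_mx l.+2 out *m Wmat F k l.+1)].

Definition cost_bound (n s l : nat) : nat :=
  l ^ 3 * s * n * (up_log 2 n) ^ 2 * up_log 2 (up_log 2 n).

(* Main.v *)
(* The module M_{s,l} is generated by its elements [G^(s-v) (Y-R)^v] and
   [Y^j (Y-R)^s], where [G] vanishes at the points and [R] interpolates [r'].
   Hence every bivariate polynomial is congruent modulo M_{s,l} to one of
   weighted degree less than [s*n], which bounds the weighted degrees of a basis
   in weak Popov form: the row with leading position [j] has degree at most
   [max (s*n) (j*(k-1))].  If the row [b] with leading position [l] has a constant
   last coefficient, then appending [Y*b] to the given basis solves the problem
   without any field operation.  Otherwise all weighted degrees are at most [s*n].

   In that case the last coefficients of the given basis have gcd 1, because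
   M_{s,l} contains an element that is monic in [Y].  A reduction of the rows of
   [Y*B] driven by the last column alone therefore produces a vector [u] of
   M_{s,l+1} with constant last coefficient, and [u] together with [B] is a basis
   of M_{s,l+1}.  A second reduction brings it to weak Popov form.  Written for
   the reversed rows, a reduction step eliminates the constant terms by an
   invertible matrix that only adds rows of smaller label to rows of larger
   label, and divides the vanishing rows by [X].  The valuation at 0 of the
   determinant drops at every step until the matrix of constant terms is
   invertible, so O(s*n) steps are enough.  The steps are organised as a minimal
   approximant basis computation by divide and conquer, which costs O(l^3) products
   of polynomials of degree O(s*n) at each of O(log(s*n)) levels.

   The products are computed by the method of Schoenhage and Strassen in the rings
   [F[y]/(1 + y^M + .. + y^((p-1)M))] with [M] a power of [p], where [p] is 2, or 3
   in characteristic 2. *)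

Require Import Defs.
From HB Require Import structures.
From mathcomp Require Import all_boot all_order all_algebra.
From mathcomp Require Import zify ring.
From mathcomp Require Import qpoly.
Set Implicit Arguments. Unset Strict Implicit. Unset Printing Implicit Defensive.
Import GRing.Theory.
Local Open Scope ring_scope.

(** * Counted programs *)

(** The field may contain no roots of unity of useful order; they are adjoined as powers of [X]
    modulo [Phi F p M]. Interpolation at them divides by [p] only, whence the change of [p] in
    characteristic 2. Working modulo [Phi] instead of [X^N - 1] drops one of [p] factors, and this
    keeps the factor in the recurrence [tau_rec] at 2; a larger factor would cost a power of the
    logarithm. Degrees are the second obstacle. A weighted degree in the given basis exceeds [s * n]
    only if [l * (k - 1)] does. A row with leading position [l] and nonconstant last coefficient has
    degree above [l * (k - 1)], so the bound for that row forces [l * (k - 1) < s * n]: a single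
    test on list lengths separates the two cases. A recursive call of the approximant algorithm sees
    its matrix only modulo a power of [X]. Its correctness is therefore expressed by a relation
    [chain] that holds for every matrix agreeing with the input to that precision; degrees,
    determinants and unimodularity are read off the relation, away from the program. *)

Fixpoint bind V A B (p : prog V A) (f : A -> prog V B) : prog V B :=
  match p with
  | Ret a => f a
  | Zero k => Zero (fun x => bind (k x) f)
  | One k => One (fun x => bind (k x) f)
  | Op o x y k => Op o x y (fun v => bind (k v) f)
  | IsZero x k => IsZero x (fun b => bind (k b) f)
  end.

Notation "'let*' x := p 'in' q" := (bind p (fun x => q))
  (at level 200, x name, p at level 200, q at level 200).

(** Result and cost are asserted together because the cost of a continuation depends on list sizes
    that only the postcondition of the preceding program supplies. *)
Definition spec (F : fieldType) A (p : prog F A) (Q : A -> Prop) (c : nat) :=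
  Q (run p).1 /\ ((run p).2 <= c)%N.

Lemma run_bind (F : fieldType) A B (p : prog F A) (f : A -> prog F B) :
  run (bind p f) =
  ((run (f (run p).1)).1, ((run p).2 + (run (f (run p).1)).2)%N).
Proof.
elim: p => [a|k IH|k IH|o x y k IH|x k IH] //=; rewrite ?IH //.
by case: (run (f a)).
Qed.

Lemma spec_ret (F : fieldType) A (a : A) (Q : A -> Prop) c :
  Q a -> spec (@Ret F A a) Q c.
Proof. by []. Qed.

Lemma spec_bind (F : fieldType) A B c1 c2 c (Q : A -> Prop) (R : B -> Prop)
    (p : prog F A) (f : A -> prog F B) :
  spec p Q c1 -> (forall a, Q a -> spec (f a) R c2) -> (c1 + c2 <= c)%N ->
  spec (bind p f) R c.
Proof.
move=> [Qa c1P] fP c12; rewrite /spec run_bind /=.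
have [Ra c2P] := fP _ Qa; split=> //.
by apply: leq_trans c12; apply: leq_add.
Qed.

Lemma spec_weaken (F : fieldType) A c c' (Q Q' : A -> Prop) (p : prog F A) :
  spec p Q c -> (forall a, Q a -> Q' a) -> (c <= c')%N -> spec p Q' c'.
Proof. by move=> [Qa cP] QQ' cc'; split; [apply: QQ'|apply: leq_trans cc']. Qed.

Lemma spec_op (F : fieldType) A (o : fop) (x y : F) k (R : A -> Prop) c :
  spec (k (eval_op o x y)) R c -> spec (Op o x y k) R c.+1.
Proof. by case. Qed.

Lemma spec_iszero (F : fieldType) A (x : F) k (R : A -> Prop) c :
  spec (k (x == 0)) R c -> spec (IsZero x k) R c.+1.
Proof. by case. Qed.

Fixpoint tabM V A (f : nat -> prog V A) (i n : nat) : prog V (seq A) :=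
  if n is n'.+1 then
    let* x := f i in let* r := tabM f i.+1 n' in Ret (x :: r)
  else Ret [::].

Fixpoint loopM V A (f : nat -> A -> prog V A) (i n : nat) (a : A) : prog V A :=
  if n is n'.+1 then let* b := f i a in loopM f i.+1 n' b else Ret a.

Fixpoint mapM V A B (f : A -> prog V B) (s : seq A) : prog V (seq B) :=
  if s is x :: s' then
    let* y := f x in let* r := mapM f s' in Ret (y :: r)
  else Ret [::].

(** The cost varies with the index because [node] skips one factor for free, a saving that a uniform
    bound would lose. *)
Lemma spec_tabM_gen (F : fieldType) A (d : A) (f : nat -> prog F A) i n
    (Q : nat -> A -> Prop) (c : nat -> nat) :
  (forall j, (i <= j < i + n)%N -> spec (f j) (Q j) (c j)) ->
  spec (tabM f i n)
    (fun r => size r = n /\ forall j, (j < n)%N -> Q (i + j)%N (nth d r j))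
    (\sum_(i <= j < i + n) c j).
Proof.
elim: n i => [|n IH] i H; first by apply: spec_ret.
have H0 : spec (f i) (Q i) (c i) by apply: H; lia.
have {}IH := IH i.+1 (fun j hj => H j ltac:(lia)).
apply: (spec_bind (c1 := c i) (c2 := \sum_(i.+1 <= j < i.+1 + n) c j) H0) => [x Qx|].
  apply: (spec_bind (c2 := 0) IH) => [r [sr rQ]|]; last by rewrite addn0.
  apply: spec_ret; split=> [/=|[|j] hj /=]; rewrite ?sr ?addn0 //.
  by rewrite addnS -addSn; apply: rQ.
by rewrite [leqRHS]big_ltn ?addSn ?addnS //; lia.
Qed.

Lemma spec_tabM (F : fieldType) A (d : A) (f : nat -> prog F A) n
    (Q : nat -> A -> Prop) (c : nat) :
  (forall j, (j < n)%N -> spec (f j) (Q j) c) ->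
  spec (tabM f 0 n)
    (fun r => size r = n /\ forall j, (j < n)%N -> Q j (nth d r j)) (n * c).
Proof.
move=> H; have H' j : (0 <= j < 0 + n)%N -> spec (f j) (Q j) c.
  by rewrite add0n => /andP[_ /H].
apply: (spec_weaken (spec_tabM_gen d H')) => //.
by rewrite add0n sum_nat_const_nat subn0.
Qed.

Lemma spec_loopM_gen (F : fieldType) A (f : nat -> A -> prog F A) i n a
    (I : nat -> A -> Prop) (c : nat) :
  I i a -> (forall j b, (i <= j < i + n)%N -> I j b -> spec (f j b) (I j.+1) c) ->
  spec (loopM f i n a) (I (i + n)%N) (n * c).
Proof.
elim: n i a => [|n IH] i a Ia H; first by apply: spec_ret; rewrite addn0.
have H0 : spec (f i a) (I i.+1) c by apply: H => //; lia.
apply: (spec_bind (c2 := n * c) H0) => [b Ib|]; last by rewrite mulSn.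
rewrite addnS -addSn; apply: IH => // j b' hj; apply: H; lia.
Qed.

Lemma spec_loopM (F : fieldType) A (f : nat -> A -> prog F A) n a
    (I : nat -> A -> Prop) (c : nat) :
  I 0%N a -> (forall j b, (j < n)%N -> I j b -> spec (f j b) (I j.+1) c) ->
  spec (loopM f 0 n a) (I n) (n * c).
Proof. by move=> Ia H; apply: spec_loopM_gen => // j b /andP[_]; apply: H. Qed.

(** * Coefficient lists *)

Fixpoint addl V (a b : seq V) : prog V (seq V) :=
  match a, b with
  | [::], _ => Ret b
  | _, [::] => Ret a
  | x :: a', y :: b' =>
      Op FAdd x y (fun v => let* r := addl a' b' in Ret (v :: r))
  end.

Fixpoint subl V (z : V) (a b : seq V) : prog V (seq V) :=
  match b with
  | [::] => Ret a
  | y :: b' =>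
      Op FSub (head z a) y
        (fun v => let* r := subl z (behead a) b' in Ret (v :: r))
  end.

Definition scalel V (c : V) : seq V -> prog V (seq V) :=
  mapM (fun x => Op FMul c x Ret).

Fixpoint mul_school V (z : V) (a b : seq V) : prog V (seq V) :=
  if a is x :: a' then
    let* s := scalel x b in let* r := mul_school z a' b in addl s (z :: r)
  else Ret [::].

Definition wrapl V (Q : nat) (s : seq V) : prog V (seq V) :=
  addl (take Q s) (drop Q s).

Definition mulXn V (z : V) (Q e : nat) (s : seq V) : prog V (seq V) :=
  wrapl Q (nseq e z ++ s).

Section ListSpecs.
Variable F : fieldType.
Implicit Types (a b s : seq F) (c : F).

Lemma Poly_cons c s : Poly (c :: s) = Poly s * 'X + c%:P.
Proof. by rewrite /= cons_poly_def. Qed.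

Lemma Poly_cat a b : Poly (a ++ b) = Poly a + Poly b * 'X^(size a).
Proof.
elim: a => [|x a IH]; first by rewrite expr0 mulr1 add0r.
by rewrite cat_cons !Poly_cons IH exprSr; ring.
Qed.

Lemma Poly_nseq0 n : Poly (nseq n (0 : F)) = 0.
Proof. by apply/polyP => i; rewrite coef_Poly nth_nseq coef0 if_same. Qed.

Lemma Poly_shift e s : Poly (nseq e 0 ++ s) = 'X^e * Poly s.
Proof. by rewrite Poly_cat Poly_nseq0 add0r size_nseq mulrC. Qed.

Lemma Poly_take_drop n s : Poly (take n s) + Poly (drop n s) * 'X^n = Poly s.
Proof.
case: (leqP n (size s)) => h.
  by rewrite -{3}(cat_take_drop n s) Poly_cat size_takel.
by rewrite take_oversize ?drop_oversize ?mul0r ?addr0 // ltnW.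
Qed.

Lemma Poly_take n s : Poly (take n s) = take_poly n (Poly s).
Proof.
apply/polyP => i; rewrite coef_Poly coef_take_poly coef_Poly.
case: (ltnP i n) => h; first by rewrite nth_take.
by rewrite nth_default // size_take; case: ltnP; lia.
Qed.

Lemma Poly_drop n s : Poly (drop n s) = drop_poly n (Poly s).
Proof.
by apply/polyP => i; rewrite coef_Poly coef_drop_poly coef_Poly nth_drop addnC.
Qed.

Lemma spec_addl a b : spec (addl a b)
  (fun r => Poly r = Poly a + Poly b /\ size r = maxn (size a) (size b))
  (minn (size a) (size b)).
Proof.
elim: a b => [|x a IH] [|y b] /=.
- by apply: spec_ret; rewrite addr0.
- by apply: spec_ret; rewrite add0r max0n.
- by apply: spec_ret; rewrite addr0 maxn0.
rewrite minnSS; apply: spec_op.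
apply: (spec_bind (c2 := 0) (IH b)) => [r [Pr sr]|]; last by rewrite addn0.
apply: spec_ret; split; last by rewrite /= sr maxnSS.
by rewrite /= !cons_poly_def Pr polyCD; ring.
Qed.

Lemma spec_subl a b : spec (subl 0 a b)
  (fun r => Poly r = Poly a - Poly b /\ size r = maxn (size a) (size b))
  (size b).
Proof.
elim: b a => [|y b IH] a /=.
  by apply: spec_ret; rewrite subr0 maxn0.
apply: spec_op.
apply: (spec_bind (c2 := 0) (IH (behead a))) => [r [Pr sr]|]; last by rewrite addn0.
apply: spec_ret; split; last by case: a sr {Pr} => [|x a] /= ->; rewrite ?max0n ?maxnSS.
rewrite !Poly_cons Pr; case: a {Pr sr} => [|x a] /=; rewrite ?cons_poly_def polyCB; ring.
Qed.

Lemma spec_scalel c s : spec (scalel c s)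
  (fun r => Poly r = c%:P * Poly s /\ size r = size s) (size s).
Proof.
elim: s => [|x s IH] /=; first by apply: spec_ret; rewrite mulr0.
apply: spec_op => /=.
apply: (spec_bind (c2 := 0) IH) => [r [Pr sr]|]; last by rewrite addn0.
apply: spec_ret; split; last by rewrite /= sr.
by rewrite /= !cons_poly_def Pr polyCM; ring.
Qed.

Lemma spec_mul_school a b : spec (mul_school 0 a b)
  (fun r => Poly r = Poly a * Poly b /\ (size r <= size a + size b)%N)
  (size a * (2 * size b)).
Proof.
elim: a => [|x a IH] /=; first by apply: spec_ret; rewrite mul0r.
apply: (spec_bind (c2 := size a * (2 * size b) + size b) (spec_scalel x b)); last by lia.
move=> s [Ps ss]; apply: (spec_bind (c2 := size b) IH) => // r [Pr sr].
apply: (spec_weaken (spec_addl s (0 :: r))) => [t [Pt st]|]; last by rewrite ss geq_minl.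
split; first by rewrite Pt Ps !Poly_cons Pr cons_poly_def polyC0; ring.
by rewrite st /= ss geq_max addSn ltnS sr -addSn leq_addl.
Qed.

(** Folding once reduces modulo [X^Q - 1]. The congruence carries an explicit cofactor, so that it
    passes through any ring morphism that kills the modulus. *)
Lemma spec_wrapl Q s : (size s <= 2 * Q)%N -> spec (wrapl Q s)
  (fun r => (size r <= Q)%N /\ exists t, Poly r = Poly s - ('X^Q - 1) * t) Q.
Proof.
move=> hs; apply: (spec_weaken (spec_addl _ _)) => [r [Pr sr]|].
  split; first by rewrite sr geq_max size_drop size_take; case: ltnP; lia.
  by exists (Poly (drop Q s)); rewrite Pr -(Poly_take_drop Q s); ring.
by apply: leq_trans (geq_minl _ _) _; rewrite size_take; case: ltnP; lia.
Qed.

Lemma spec_mulXn Q e s : (size s <= Q)%N -> (e <= Q)%N -> spec (mulXn 0 Q e s)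
  (fun r => (size r <= Q)%N /\ exists t, Poly r = 'X^e * Poly s - ('X^Q - 1) * t) Q.
Proof.
move=> hs he; have hs2 : (size (nseq e (0%R : F) ++ s) <= 2 * Q)%N.
  by rewrite size_cat size_nseq; lia.
apply: (spec_weaken (spec_wrapl hs2)) => // r [sr [t Pr]]; split => //.
by exists t; rewrite Pr Poly_shift.
Qed.

End ListSpecs.

(** * Fast multiplication of polynomials *)

Fixpoint vadd V (f g : seq (seq V)) : prog V (seq (seq V)) :=
  match f, g with
  | [::], _ => Ret g
  | _, [::] => Ret f
  | s :: f', t :: g' =>
      let* u := addl s t in let* r := vadd f' g' in Ret (u :: r)
  end.

Section Programs.
Variables (V : Type) (p eps : nat) (z pinv : V).
Local Open Scope nat_scope.

(** Remainder modulo [Z^q - Y^w]: block [d] is multiplied by [Y^(d w)], which is a cyclic shift of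
    the coefficient lists since [Y^Q = 1]. *)
Definition child (Q q w : nat) (f : seq (seq V)) : prog V (seq (seq V)) :=
  loopM (fun d acc =>
    let* t := mapM (mulXn z Q ((d * w) %% Q)) (take q (drop (d * q) f)) in
    vadd acc t) 0 p (nseq q [::]).

(* Product modulo [Z^(p*q) - Y^e] from the products modulo the [p] factors
   [Z^q - Y^(w c)], glued by Lagrange interpolation; [skip] drops the factor
   of index 0, which replaces the modulus [Z^(p*q) - 1] by
   [1 + Z^q + .. + Z^((p-1)*q)]. *)
Definition node (Q q : nat) (w : nat -> nat) (skip : bool)
    (rec : nat -> seq (seq V) -> seq (seq V) -> prog V (seq (seq V)))
    (f g : seq (seq V)) : prog V (seq (seq V)) :=
  let* hs := tabM (fun c =>
    if skip && (c == 0%N) then Ret (nseq q [::]) else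
    let* fc := child Q q (w c) f in
    let* gc := child Q q (w c) g in
    rec (w c) fc gc) 0 p in
  let* bs := tabM (fun d =>
    let* acc := loopM (fun c acc =>
      let* t := mapM (mulXn z Q (Q - (d * w c) %% Q)) (nth [::] hs c) in
      vadd acc t) 0 p (nseq q [::]) in
    mapM (scalel pinv) acc) 0 p in
  Ret (flatten bs).

(** Product modulo [Z^(p^a) - Y^e]. Since [Y^M] acts as a primitive [p]-th root of unity, the [p]-th
    roots of [Y^e] are the [Y^(e/p + c M)], and each level halves or thirds the length in [Z] until
    only constants in [Z] remain. *)
Fixpoint conv (mul : seq V -> seq V -> prog V (seq V)) (M a e : nat)
    (f g : seq (seq V)) : prog V (seq (seq V)) :=
  if a is a'.+1 then
    node (p * M) (p ^ a') (fun c => e %/ p + c * M)%N false (conv mul M a') f g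
  else let* h := mul (nth [::] f 0) (nth [::] g 0) in Ret [:: h].

Definition padl (n : nat) (s : seq V) : seq V := s ++ nseq (n - size s) z.

(** Modulo [Phi] the power [X^((p-1) M)] is minus the sum of the lower terms, so the top block is
    subtracted from each block below it; the padding aligns the copies. *)
Definition redPhi (M : nat) (s : seq V) : prog V (seq V) :=
  subl z (take (p.-1 * M) s)
    (flatten (nseq p.-1 (padl M (drop (p.-1 * M) s)))).

(** Substitutes [Z = X^m]. Coefficients have up to [2 * m] terms, so neighbouring blocks overlap and
    must be added. *)
Fixpoint recomb (m : nat) (h : seq (seq V)) : prog V (seq V) :=
  if h is s :: h' then let* r := recomb m h' in addl s (nseq m z ++ r)
  else Ret [::].

Definition mulPhi_school (k : nat) (s1 s2 : seq V) : prog V (seq V) :=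
  let* r := mul_school z s1 s2 in wrapl (p * p ^ k) r.

(** Half of the logarithmic size goes into the coefficients and half into the number of blocks. In
    both cases [(p-1) p^eps = 2], so a product of two blocks of length [m] has at most [(p-1) p^k']
    coefficients and survives reduction modulo [Phi]. The successor in [k'] ensures [a <= k'], so
    that [conv] can extract [p]-th roots [a] times. *)
Fixpoint mulPhi (fuel k : nat) (s1 s2 : seq V) : prog V (seq V) :=
  if fuel is fuel'.+1 then
    if (k <= 2)%N then mulPhi_school k s1 s2 else
    let k' := k./2.+1 in
    let m := (p ^ (k' - eps))%N in
    let a := (k - k' + eps)%N in
    let blocks s := mkseq (fun i => take m (drop (i * m) s)) (p * p ^ a) in
    let* h := node (p * p ^ k') (p ^ a) (fun c => c * p ^ k')%N true
                (conv (mulPhi fuel' k') (p ^ k') a) (blocks s1) (blocks s2) in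
    let* hc := mapM (redPhi (p ^ k')) h in
    let* r := recomb m hc in
    wrapl (p * p ^ k) r
  else mulPhi_school k s1 s2.

Definition mulp (K : nat) (s1 s2 : seq V) : prog V (seq V) :=
  let k := up_log p (2 ^ K.+1) in
  let* r := mulPhi k k s1 s2 in
  let* r' := redPhi (p ^ k) r in Ret (take (size s1 + size s2) r').

End Programs.

Definition Phi (F : fieldType) (p M : nat) : {poly F} := \sum_(j < p) 'X^(j * M).

(** * Splitting at roots of unity and Lagrange gluing *)

Section Eval.
Variables (F : fieldType) (S : comNzRingType) (psi : {rmorphism {poly F} -> S}).
Variable t : S.

(* Value at [Z = t] of the polynomial in [Z] whose coefficient lists form [f]. *)
Definition evl (f : seq (seq F)) : S :=
  foldr (fun s acc => psi (Poly s) + t * acc) 0 f.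

Definition wfv (q Q : nat) (f : seq (seq F)) : Prop :=
  size f = q /\ all (fun s => size s <= Q)%N f.

Lemma evl_cons s f : evl (s :: f) = psi (Poly s) + t * evl f.
Proof. by []. Qed.

Lemma evl_cat f g : evl (f ++ g) = evl f + t ^+ size f * evl g.
Proof.
elim: f => [|s f IH] /=; first by rewrite expr0 mul1r add0r.
by rewrite IH exprS; ring.
Qed.

Lemma evl_nseq q : evl (nseq q [::]) = 0.
Proof. by elim: q => //= q ->; rewrite rmorph0 mulr0 addr0. Qed.

Lemma wfv_nseq q Q : wfv q Q (nseq q [::]).
Proof. by split; rewrite ?size_nseq // all_nseq orbT. Qed.

Lemma evl_flatten q bs : all (fun b => size b == q) bs ->
  evl (flatten bs) = \sum_(d < size bs) t ^+ (q * d) * evl (nth [::] bs d).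
Proof.
elim: bs => [|b bs IH] /=; first by rewrite big_ord0.
case/andP => /eqP sb /IH {}IH.
rewrite evl_cat IH big_ord_recl muln0 expr0 mul1r sb mulr_sumr; congr (_ + _).
by apply: eq_bigr => i _; rewrite /= /bump /= mulnDr muln1 exprD mulrA.
Qed.

Lemma size_flatten_const T q (bs : seq (seq T)) :
  all (fun b => size b == q) bs -> size (flatten bs) = (size bs * q)%N.
Proof.
by elim: bs => //= b bs IH /andP[/eqP sb /IH h]; rewrite size_cat sb h mulSn.
Qed.

Lemma spec_vadd q Q f g : wfv q Q f -> wfv q Q g ->
  spec (vadd f g) (fun r => wfv q Q r /\ evl r = evl f + evl g) (q * Q).
Proof.
elim: f g q => [|s f IH] [|u g] q [] //= <- wf [] //=.
  by move=> _ _; apply: spec_ret; split; rewrite ?addr0.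
case/andP: wf => ss wf [sg] /andP[su wg].
have su' : (minn (size s) (size u) <= Q)%N by rewrite geq_min ss.
apply: (spec_bind (c1 := Q) (c2 := size f * Q)
          (spec_weaken (spec_addl s u) (fun _ h => h) su')) => // r [Pr sr].
apply: (spec_bind (c2 := 0) (IH g _ (conj erefl wf) (conj sg wg))) => [h|]; last by rewrite addn0.
move=> [[sh wh] eh]; apply: spec_ret; split.
  by split; rewrite /= ?sh // wh sr geq_max ss su.
by rewrite /= eh Pr rmorphD; ring.
Qed.

Lemma spec_mapM_lin q Q a c (op : seq F -> prog F (seq F)) f :
  (forall s, (size s <= Q)%N -> spec (op s)
     (fun r => (size r <= Q)%N /\ psi (Poly r) = a * psi (Poly s)) c) ->
  wfv q Q f ->
  spec (mapM op f) (fun r => wfv q Q r /\ evl r = a * evl f) (q * c).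
Proof.
move=> opP [<- {q}]; elim: f => [|s f IH] /=.
  by move=> _; apply: spec_ret; split; rewrite ?mulr0.
case/andP => ss wf; apply: (spec_bind (c2 := size f * c) (opP s ss)) => // r [sr Pr].
apply: (spec_bind (c2 := 0) (IH wf)) => [h|]; last by rewrite addn0.
move=> [[sh wh] eh]; apply: spec_ret; split.
  by split; rewrite /= ?sh // wh sr.
by rewrite /= eh Pr; ring.
Qed.

Lemma wfv_take q q' Q f : wfv q Q f -> (q' <= q)%N -> wfv q' Q (take q' f).
Proof.
move=> [sf wf] qq; split; first by rewrite size_takel ?sf.
by apply/allP => s /mem_take; apply: (allP wf).
Qed.

Lemma wfv_drop q q' Q f : wfv q Q f -> wfv (q - q') Q (drop q' f).
Proof.
move=> [sf wf]; split; first by rewrite size_drop sf.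
by apply/allP => s /mem_drop; apply: (allP wf).
Qed.

Section Root.
Variables (p M : nat) (pinv : F).
Hypothesis p23 : (p == 2) || (p == 3).
Hypothesis pinvP : pinv * p%:R = 1.
Hypothesis M_gt0 : (0 < M)%N.
Hypothesis psiPhi : psi (Phi F p M) = 0.
Let Q := (p * M)%N.
Let y := psi 'X.

Lemma radix_gt0 : (0 < p)%N. Proof. by move: p23; case: p. Qed.

Lemma yQ1 : y ^+ Q = 1.
Proof.
apply/eqP; rewrite -subr_eq0 /Q mulnC exprM subrX1; apply/eqP.
suff -> : \sum_(i < p) (y ^+ M) ^+ i = psi (Phi F p M) by rewrite psiPhi mulr0.
rewrite /Phi rmorph_sum; apply: eq_bigr => i _.
by rewrite rmorphXn -exprM mulnC.
Qed.

(** As [p] is prime, [d] permutes the residues modulo [p], so the sum is the one for [d = 1], which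
    is the image of [Phi]. *)
Lemma sum_root d : (0 < d < p)%N -> \sum_(c < p) y ^+ (c * M * d) = 0.
Proof.
have := psiPhi; rewrite /Phi rmorph_sum /=; have y1 := yQ1.
move: p23 y1; rewrite /Q => /orP[/eqP -> y1|/eqP -> y1] ph hd.
  have -> : d = 1%N by lia.
  by rewrite -[RHS]ph; apply: eq_bigr => i _; rewrite rmorphXn muln1.
rewrite -[RHS]ph !big_ord_recl !big_ord0 /= !rmorphXn /=.
rewrite /bump /= !mul0n !mul1n !expr0.
have [->|->] : d = 1%N \/ d = 2%N by lia.
  by rewrite !muln1.
have -> : ((1 + 1) * M * 2 = 3 * M + M)%N by lia.
rewrite exprD y1 mul1r !addr0 (mulnC M 2).
by rewrite [y ^+ (2 * M) + _]addrC.
Qed.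

Lemma y_inv x : y ^+ (Q - x %% Q) * y ^+ x = 1.
Proof.
have Q0 : (0 < Q)%N by rewrite muln_gt0 radix_gt0.
rewrite -exprD {2}(divn_eq x Q) addnC -addnA subnKC; last by rewrite ltnW // ltn_mod.
by rewrite exprD [(_ * Q)%N]mulnC exprM yQ1 expr1n mul1r.
Qed.

(** Lagrange coefficient of the factor [t^q = y^w]: the average over [d] of [(t^q / y^w)^d], with
    negative powers of [y] written through [y^Q = 1]. *)
Definition ell (q : nat) (w : nat) : S :=
  psi pinv%:P * \sum_(d < p) t ^+ (q * d) * y ^+ (Q - (d * w) %% Q).

(** A geometric sum that telescopes. Together with [sum_ell] it replaces the Chinese remainder
    theorem: an error modulo one factor is killed by its coefficient, so neither coprimality of the
    factors nor inverses of differences of roots are required. *)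
Lemma ell_root q w e : y ^+ (p * w) = y ^+ e ->
  exists u, ell q w * (t ^+ q - y ^+ w) = (t ^+ (p * q) - y ^+ e) * u.
Proof.
move=> hw; set yi := y ^+ (Q - w %% Q).
have yi1 : yi * y ^+ w = 1 by apply: y_inv.
have E d : y ^+ (Q - (d * w) %% Q) = yi ^+ d.
  have h1 := y_inv (d * w).
  have h2 : yi ^+ d * y ^+ (d * w) = 1 by rewrite (mulnC d) exprM -exprMn yi1 expr1n.
  by rewrite -[LHS]mulr1 -h2 mulrCA h1 mulr1.
exists (psi pinv%:P * y ^+ w * yi ^+ p).
have h3 : yi ^+ p * y ^+ e = 1 by rewrite -hw (mulnC p) exprM -exprMn yi1 expr1n.
have -> : ell q w = psi pinv%:P * \sum_(d < p) (t ^+ q * yi) ^+ d.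
  by congr (_ * _); apply: eq_bigr => d _; rewrite E exprMn exprM.
have -> : t ^+ q - y ^+ w = y ^+ w * (t ^+ q * yi - 1).
  by rewrite mulrBr mulr1 mulrCA [y ^+ w * yi]mulrC yi1 mulr1.
have hs := subrX1 (t ^+ q * yi) p; set A := \sum_(d < p) _ in hs *.
transitivity (psi pinv%:P * y ^+ w * ((t ^+ q * yi - 1) * A)); first by ring.
rewrite -hs exprMn -exprM (mulnC q).
have -> : t ^+ (p * q) * yi ^+ p - 1 = t ^+ (p * q) * yi ^+ p - yi ^+ p * y ^+ e.
  by rewrite h3.
by ring.
Qed.

(** After exchanging the sums, the coefficient of [t^(q d)] for [d > 0] is a power of [y] times a
    sum of inverse [d]-th powers of the roots of unity. Their inverses are the powers with exponent
    [p - d], so [sum_root] applies; [d = 0] leaves [pinv * p]. *)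
Lemma sum_ell q e : \sum_(c < p) ell q (e + c * M) = 1.
Proof.
rewrite /ell -mulr_sumr exchange_big /=.
have p0 := radix_gt0.
rewrite (bigD1 (Ordinal p0)) //= [X in _ + X]big1 => [|d /eqP hd]; last first.
  have d0 : (0 < d)%N by rewrite lt0n; apply/eqP => h; apply: hd; apply: val_inj.
  rewrite -mulr_sumr.
  have hs : (0 < p - d < p)%N by have := ltn_ord d; lia.
  have := sum_root hs => /(congr1 (fun x => y ^+ (Q - (d * e) %% Q) * x)) h.
  rewrite mulr0 mulr_sumr in h.
  rewrite -[RHS](mulr0 (t ^+ (q * d))) -[in RHS]h; congr (_ * _).
  apply: eq_bigr => c _.
  have h1 := y_inv (d * (e + c * M)).
  have h2 : y ^+ (Q - (d * e) %% Q) * y ^+ (c * M * (p - d)) * y ^+ (d * (e + c * M)) = 1.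
    rewrite mulnDr exprD mulrACA y_inv mul1r -exprD.
    have -> : (c * M * (p - d) + d * (c * M) = Q * c)%N.
      rewrite /Q; have := ltn_ord d => hd'.
      by rewrite [(d * _)%N]mulnC -mulnDr subnK ?(ltnW hd') //; lia.
    by rewrite exprM yQ1 expr1n.
  by rewrite -[LHS]mulr1 -h2 mulrCA h1 mulr1.
rewrite addr0 muln0 expr0.
have -> : \sum_(i < p) 1 * y ^+ (Q - (0 * (e + i * M)) %% Q) = p%:R :> S.
  rewrite (eq_bigr (fun=> 1)) ?sumr_const ?card_ord // => i _.
  by rewrite mul0n mod0n subn0 yQ1 mulr1.
rewrite -[p%:R](rmorph_nat psi) -rmorphM /= -polyC_natr -polyCM pinvP.
exact: rmorph1.
Qed.

Lemma spec_mulXn_psi e s : (size s <= Q)%N -> (e <= Q)%N -> spec (mulXn 0 Q e s)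
  (fun r => (size r <= Q)%N /\ psi (Poly r) = y ^+ e * psi (Poly s)) Q.
Proof.
move=> hs he; apply: (spec_weaken (spec_mulXn hs he)) => // r [sr [u ->]].
split => //; rewrite rmorphB !rmorphM rmorphB rmorph1 !rmorphXn -/y yQ1.
by rewrite subrr mul0r subr0.
Qed.

Lemma spec_child q w f : wfv (p * q) Q f ->
  spec (child p 0 Q q w f)
    (fun r => wfv q Q r /\ exists u, evl r = evl f + (t ^+ q - y ^+ w) * u)
    (p * (2 * (q * Q))).
Proof.
move=> wf; have Q0 : (0 < Q)%N by rewrite muln_gt0 radix_gt0.
pose I d acc := wfv q Q acc /\
  exists u, evl acc = evl (take (d * q) f) + (t ^+ q - y ^+ w) * u.
have I0 : I 0%N (nseq q [::]).
  by split; [apply: wfv_nseq|exists 0; rewrite evl_nseq take0 mulr0 addr0].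
apply: (spec_weaken (spec_loopM (c := 2 * (q * Q)) I0 _)) => //; last first.
  move=> r [wr [u hu]]; split=> //; exists u.
  by rewrite hu take_oversize // (wf.1).
move=> d acc hd [wacc [u hu]].
have wpart : wfv q Q (take q (drop (d * q) f)).
  apply: (wfv_take (q := p * q - d * q)); first exact: wfv_drop.
  by rewrite -mulnBl leq_pmull // subn_gt0.
apply: (spec_bind (c1 := q * Q) (c2 := q * Q)
  (spec_mapM_lin (a := y ^+ ((d * w) %% Q)) _ wpart)).
- by move=> s hs; apply: spec_mulXn_psi => //; rewrite ltnW // ltn_mod.
- move=> h [wh eh]; apply: (spec_weaken (spec_vadd wacc wh)) => // r [wr er].
  split=> //.
  (* The new block carries [(y^w)^d] in place of [(t^q)^d]; the sum is the quotient of the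
     difference by [t^q - y^w]. *)
  exists (u - (\sum_(i < d) (t ^+ q) ^+ (d.-1 - i) * (y ^+ w) ^+ i)
            * evl (take q (drop (d * q) f))).
  rewrite er hu eh mulSn addnC takeD evl_cat size_takel; last first.
    by rewrite (wf.1) leq_mul2r ltnW ?orbT.
  have -> : y ^+ ((d * w) %% Q) = (y ^+ w) ^+ d.
    by rewrite expr_mod ?yQ1 // mulnC exprM.
  rewrite (mulnC d q) exprM mulrBr [(t ^+ q - _) * (_ * _)]mulrA -subrXX.
  by ring.
- by lia.
Qed.

Lemma spec_node q w e (skip : bool) rec T f g :
  (forall c, y ^+ (p * (w c)) = y ^+ e) ->
  (forall c fc gc, (c < p)%N -> wfv q Q fc -> wfv q Q gc ->
    spec (rec (w c) fc gc) (fun h => wfv q Q h /\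
      exists u, evl h = evl fc * evl gc + (t ^+ q - y ^+ (w c)) * u) T) ->
  wfv (p * q) Q f -> wfv (p * q) Q g ->
  spec (node p 0 pinv Q q w skip rec f g)
    (fun h => wfv (p * q) Q h /\ exists u,
      evl h = \sum_(c < p) (if skip && (c == 0 :> nat) then 0
                            else ell q (w c) * (evl f * evl g))
              + (t ^+ (p * q) - y ^+ e) * u)
    ((p - skip) * T + 7 * (p * (p * (q * Q)))).
Proof.
move=> hw recP wf wg.
pose c1 c := if skip && (c == 0%N) then 0%N else (2 * (p * (2 * (q * Q))) + T)%N.
pose Qh c h := wfv q Q h /\
   if skip && (c == 0%N) then evl h = 0 else
   exists u, evl h = evl f * evl g + (t ^+ q - y ^+ (w c)) * u.
apply: (spec_bind (c1 := \sum_(0 <= j < 0 + p) c1 j)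
         (c2 := 3 * (p * (p * (q * Q))))
   (spec_tabM_gen [::] (Q := Qh) (c := c1) _)).
- move=> c; rewrite add0n => /andP[_ hc]; rewrite /c1 /Qh.
  case: (skip && (c == 0%N)).
    by apply: spec_ret; split; [apply: wfv_nseq|apply: evl_nseq].
  apply: (spec_bind (c2 := p * (2 * (q * Q)) + T) (spec_child (w c) wf)); last by lia.
  move=> fc [wfc [u hu]].
  apply: (spec_bind (c2 := T) (spec_child (w c) wg)); last by lia.
  move=> gc [wgc [v hv]].
  apply: (spec_weaken (recP c fc gc hc wfc wgc)) => // h [wh [x hx]].
  split=> //; rewrite hx hu hv.
  exists (evl f * v + u * evl g + u * v * (t ^+ q - y ^+ w c) + x); ring.
- move=> hs [shs hsP].
  have whs c : (c < p)%N -> wfv q Q (nth [::] hs c) by move=> /hsP [].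
  pose R d b := wfv q Q b /\ evl b = psi pinv%:P *
     \sum_(c < p) y ^+ (Q - (d * w c) %% Q) * evl (nth [::] hs c).
  apply: (spec_bind (c1 := p * (p * (2 * (q * Q)) + q * Q)) (c2 := 0)
     (spec_tabM [::] (Q := R) (c := p * (2 * (q * Q)) + q * Q) _)).
  + move=> d hd.
    pose I c acc := wfv q Q acc /\
      evl acc = \sum_(j < c) y ^+ (Q - (d * w j) %% Q) * evl (nth [::] hs j).
    apply: (spec_bind (c1 := p * (2 * (q * Q))) (c2 := q * Q)
              (spec_loopM (I := I) (c := 2 * (q * Q)) _ _)) => //.
    * by split; [apply: wfv_nseq|rewrite big_ord0 evl_nseq].
    * move=> c acc hc [wacc eacc].
      apply: (spec_bind (c1 := q * Q) (c2 := q * Q)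
        (spec_mapM_lin (a := y ^+ (Q - (d * w c) %% Q)) _ (whs c hc))).
      - by move=> s ss; apply: spec_mulXn_psi => //; rewrite leq_subr.
      - move=> h [wh eh]; apply: (spec_weaken (spec_vadd wacc wh)) => // r [wr er].
        by split=> //; rewrite er eh eacc big_ord_recr.
      - by lia.
    * move=> acc [wacc eacc].
      apply: (spec_weaken (spec_mapM_lin (a := psi pinv%:P) (c := Q) _ wacc)) => //.
        move=> s ss; apply: (spec_weaken (spec_scalel pinv s)) => // r [Pr sr].
        by rewrite sr Pr rmorphM.
      by move=> r [wr er]; split => //; rewrite er eacc.
  + move=> bs [sbs bsP]; apply: spec_ret.
    have wbs : all (fun b => size b == q) bs.
      apply/(all_nthP [::]) => d; rewrite sbs => /bsP [[sb _] _]; exact/eqP.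
    split.
      split.
        by rewrite (size_flatten_const wbs) sbs.
      apply/allP => s /flattenP[b /(nthP [::])[d]]; rewrite sbs => hd <-.
      by have [[_ /allP h] _] := bsP d hd; apply: h.
    have E : evl (flatten bs) = \sum_(c < p) ell q (w c) * evl (nth [::] hs c).
      rewrite (evl_flatten wbs) sbs.
      rewrite (eq_bigr (fun d : 'I_p => \sum_(c < p) psi pinv%:P *
         (t ^+ (q * d) * y ^+ (Q - (d * w c) %% Q)) * evl (nth [::] hs c))).
        rewrite exchange_big /=; apply: eq_bigr => c _.
        by rewrite /ell mulr_sumr mulr_suml.
      move=> d _; have [_ ->] := bsP d (ltn_ord d).
      rewrite mulr_sumr mulr_sumr; apply: eq_bigr => c _; ring.
    rewrite E.
    have H (c : 'I_p) : exists u, ell q (w c) * evl (nth [::] hs c) =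
       (if skip && (c == 0 :> nat) then 0 else ell q (w c) * (evl f * evl g))
       + (t ^+ (p * q) - y ^+ e) * u.
      have [_] := hsP c (ltn_ord c); rewrite add0n.
      case: ifP => _; first by move=> ->; exists 0; ring.
      move=> [u ->]; have [v hv] := ell_root q (hw c).
      by exists (v * u); rewrite [RHS]addrC mulrA -hv; ring.
    elim/big_rec2: _ => [|c x1 x2 _ [u hu]].
      by exists 0; rewrite mulr0 addr0.
    have [v hv] := H c; exists (u + v); rewrite hv hu; ring.
  + have : (p * (q * Q) <= p * (p * (q * Q)))%N by rewrite leq_mul // leq_pmull ?radix_gt0.
    by lia.
- have hc1 : (\sum_(0 <= j < 0 + p) c1 j <= (p - skip) * T + 4 * (p * (p * (q * Q))))%N.
    rewrite add0n /c1; case: (skip) => /=; last first.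
      by rewrite sum_nat_const_nat; lia.
    case: (p) radix_gt0 => // p' _; rewrite big_ltn //= add0n big_add1 /=.
    rewrite sum_nat_const_nat; nia.
  by lia.
Qed.

Lemma spec_conv mul a e T f g :
  (p ^ a %| e)%N -> (p ^ a %| M)%N ->
  (forall s1 s2, (size s1 <= Q)%N -> (size s2 <= Q)%N ->
    spec (mul s1 s2) (fun r => (size r <= Q)%N /\
      exists u, Poly r = Poly s1 * Poly s2 + Phi F p M * u) T) ->
  wfv (p ^ a) Q f -> wfv (p ^ a) Q g ->
  spec (conv p 0 pinv mul M a e f g) (fun h => wfv (p ^ a) Q h /\
      exists u, evl h = evl f * evl g + (t ^+ (p ^ a) - y ^+ e) * u)
    (p ^ a * T + 7 * (a * (p * (p ^ a * Q)))).
Proof.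
move=> + + mulP; have p0 := radix_gt0.
elim: a e f g => [|a IH] e f g he hM.
  move=> [sf wf] [sg wg] /=.
  case: f sf wf => [|s1 [|]] //= _ /andP[ss1 _].
  case: g sg wg => [|s2 [|]] //= _ /andP[ss2 _].
  apply: (spec_bind (c2 := 0) (mulP _ _ ss1 ss2)); last by rewrite expn0; lia.
  move=> r [sr [u Pr]]; apply: spec_ret; split; first by split; rewrite /= ?sr.
  by exists 0; rewrite /= Pr rmorphD !rmorphM psiPhi; ring.
rewrite !expnS => wf wg /=.
have he' : (p %| e)%N by apply: dvdn_trans he; rewrite expnS dvdn_mulr.
have hw c : y ^+ (p * (e %/ p + c * M)) = y ^+ e.
  by rewrite mulnDr mulnC divnK // exprD mulnCA mulnC -/Q exprM yQ1 expr1n mulr1.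
have hMa : (p ^ a %| M)%N by apply: dvdn_trans hM; rewrite expnS dvdn_mull.
apply: (spec_weaken (spec_node (T := p ^ a * T + 7 * (a * (p * (p ^ a * Q))))
    false hw _ wf wg)).
- move=> c fc gc hc wfc wgc; apply: IH => //; apply: dvdn_add.
    by rewrite dvdn_divRL // mulnC -expnS.
  exact: dvdn_mull.
- move=> h [wh [u hu]]; split=> //; exists u; rewrite hu; congr (_ + _).
  by rewrite -mulr_suml sum_ell mul1r.
- by rewrite subn0; lia.
Qed.

(** With [G] the sum of the powers of [t^q], the full modulus is [(t^q - 1) G] and the Lagrange
    coefficient of index 0 is [pinv * G]. The remaining coefficients add up to [1 - pinv * G], so
    modulo [G] skipping the factor 0 loses nothing. *)
Lemma spec_root mul a T f g : (p ^ a %| M)%N ->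
  (forall s1 s2, (size s1 <= Q)%N -> (size s2 <= Q)%N ->
    spec (mul s1 s2) (fun r => (size r <= Q)%N /\
      exists u, Poly r = Poly s1 * Poly s2 + Phi F p M * u) T) ->
  wfv (p * p ^ a) Q f -> wfv (p * p ^ a) Q g ->
  spec (node p 0 pinv Q (p ^ a) (fun c => c * M)%N true (conv p 0 pinv mul M a) f g)
    (fun h => wfv (p * p ^ a) Q h /\ exists v,
       evl h = evl f * evl g + (\sum_(d < p) t ^+ (p ^ a * d)) * v)
    ((p - 1) * (p ^ a * T + 7 * (a * (p * (p ^ a * Q))))
       + 7 * (p * (p * (p ^ a * Q)))).
Proof.
move=> hMa mulP wf wg; have p0 := radix_gt0.
have hw c : y ^+ (p * (c * M)) = y ^+ 0.
  by rewrite mulnCA mulnC exprM yQ1 expr1n expr0.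
apply: (spec_weaken (spec_node (w := fun c => (c * M)%N)
  (T := p ^ a * T + 7 * (a * (p * (p ^ a * Q)))) true hw _ wf wg)) => //.
  by move=> c fc gc hc wfc wgc; apply: spec_conv => //; apply: dvdn_mull.
move=> h [wh [u hu]]; split => //.
set G := \sum_(d < p) _.
have H1 := sum_ell (p ^ a) 0.
have H0 : ell (p ^ a) 0 = psi pinv%:P * G.
  by congr (_ * _); apply: eq_bigr => d _; rewrite muln0 mod0n subn0 yQ1 mulr1.
have H2 : t ^+ (p * p ^ a) - y ^+ 0 = (t ^+ (p ^ a) - 1) * G.
  rewrite expr0 mulnC exprM subrX1; congr (_ * _).
  by apply: eq_bigr => i _; rewrite exprM.
rewrite H2 in hu.
exists ((t ^+ (p ^ a) - 1) * u - psi pinv%:P * (evl f * evl g)).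
rewrite hu (_ : \sum_(c < p) _ = (1 - psi pinv%:P * G) * (evl f * evl g)).
  by ring.
rewrite -H1 -H0; case: (p) p0 => // n _.
rewrite !big_ord_recl /= add0r mul0n addn0 [X in (X - _) * _]addrC addrK mulr_suml.
by apply: eq_bigr => i _; rewrite add0n.
Qed.

End Root.
End Eval.

(** * Products modulo [Phi] and products of arbitrary polynomials *)

Section FastMul.
Variables (F : fieldType) (p eps : nat) (pinv : F).
Hypothesis peps : (p = 2 /\ eps = 1%N) \/ (p = 3 /\ eps = 0%N).
Hypothesis pinvP : pinv * p%:R = 1.

Let p23 : (p == 2) || (p == 3).
Proof. by case: peps => -[-> _]. Qed.

Let p0 : (0 < p)%N := radix_gt0 p23.

Lemma Phi_recr M : Phi F p M = 'X^(p.-1 * M) + \sum_(j < p.-1) 'X^(j * M).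
Proof.
rewrite /Phi; case: p p0 => // q _; rewrite big_ord_recr /= addrC.
by congr (_ + _); apply: eq_bigr.
Qed.

Lemma size_Phi_low M : (0 < M)%N ->
  (size ((\sum_(j < p.-1) 'X^(j * M))%R : {poly F}) < size ('X^(p.-1 * M) : {poly F}))%N.
Proof.
move=> M0; rewrite size_polyXn ltnS (leq_trans (size_sum _ _ _)) //.
apply/bigmax_leqP => j _; rewrite size_polyXn ltn_mul2r M0.
exact: ltn_ord.
Qed.

Lemma size_Phi M : (0 < M)%N -> size (Phi F p M) = (p.-1 * M).+1.
Proof.
by move=> M0; rewrite Phi_recr size_polyDl ?size_Phi_low // size_polyXn.
Qed.

Lemma monic_Phi M : (0 < M)%N -> Phi F p M \is monic.
Proof.
move=> M0; rewrite monicE Phi_recr lead_coefDl ?size_Phi_low //.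
by rewrite lead_coefXn.
Qed.

Lemma mk_monic_Phi M : (0 < M)%N -> mk_monic (Phi F p M) = Phi F p M.
Proof.
move=> M0; rewrite /mk_monic monic_Phi // size_Phi // ltnS muln_gt0 M0.
by case: peps => -[-> _].
Qed.

Lemma PhiXn M : 'X^(p * M) - 1 = Phi F p M * ('X^M - 1).
Proof.
rewrite mulnC exprM subrX1 mulrC; congr (_ * _).
by apply: eq_bigr => i _; rewrite -exprM mulnC.
Qed.

Lemma small_mod_Phi M (a b u : {poly F}) : (0 < M)%N ->
  (size a <= p.-1 * M)%N -> (size b <= p.-1 * M)%N ->
  a = b + Phi F p M * u -> a = b.
Proof.
move=> M0 sa sb h; have [u0|u0] := eqVneq u 0; first by rewrite h u0 mulr0 addr0.
have : (size (Phi F p M * u)%R <= p.-1 * M)%N.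
  have -> : Phi F p M * u = a - b by rewrite h addrC addKr.
  by rewrite (leq_trans (size_polyD _ _)) // geq_max sa size_polyN.
rewrite size_monicM ?monic_Phi // size_Phi // addSn /=.
have : (0 < size u)%N by rewrite size_poly_gt0.
by case: (size u) => // n _; rewrite addnS ltnNge leq_addr.
Qed.

Lemma spec_redPhi M s : (size s <= p * M)%N ->
  spec (redPhi p 0 M s) (fun r => (size r <= p.-1 * M)%N /\
    exists u, Poly r = Poly s + Phi F p M * u) (p.-1 * M).
Proof.
move=> hs; set t := drop (p.-1 * M) s.
have st : (size t <= M)%N.
  by rewrite size_drop; case: p p0 hs => //= q _; rewrite mulSn; lia.
have spad : size (padl 0 M t) = M by rewrite size_cat size_nseq subnKC.
have Ppad : Poly (padl 0 M t) = Poly t.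
  by rewrite Poly_cat Poly_nseq0 mul0r addr0.
have sfl n : size (flatten (nseq n (padl 0 M t))) = (n * M)%N.
  by elim: n => //= n IH; rewrite size_cat IH spad mulSn.
have Pfl n : Poly (flatten (nseq n (padl 0 M t))) = Poly t * \sum_(j < n) 'X^(j * M).
  elim: n => [|n IH]; first by rewrite big_ord0 mulr0.
  rewrite /= Poly_cat IH Ppad spad big_ord_recl mul0n expr0 mulrDr mulr1.
  congr (_ + _); rewrite -mulrA mulr_suml; congr (_ * _).
  by apply: eq_bigr => j _; rewrite /= /bump /= mulnDl mul1n exprD mulrC.
apply: (spec_weaken (spec_subl _ _)) => [r [Pr sr]|]; last by rewrite sfl.
split.
  by rewrite sr sfl geq_max leqnn andbT size_take; case: ltnP => // /ltnW.
exists (- Poly t); rewrite Pr Pfl -(Poly_take_drop (p.-1 * M) s) -/t Phi_recr.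
by ring.
Qed.

Section Step.
Variables (M m : nat).
Hypothesis M0 : (0 < M)%N.
Hypothesis hm : (m + m <= p.-1 * M)%N.
Let A := {poly %/ (Phi F p M)}.
Let psi : {rmorphism {poly F} -> {poly A}} := polyC \o in_qpoly (Phi F p M).
Let idp : {rmorphism {poly F} -> {poly F}} := idfun.

Lemma psi_Phi : psi (Phi F p M) = 0.
Proof.
rewrite /= (_ : in_qpoly _ _ = 0) ?polyC0 //; apply: val_inj.
by rewrite /= mk_monic_Phi // Pdiv.RingMonic.rmodpp // monic_Phi.
Qed.

(* Lifts the coefficients to their canonical representatives and substitutes
   [X^m] for the variable. *)
Definition theta (P : {poly A}) : {poly F} :=
  \sum_(i < size P) (polyn P`_i) * 'X^(m * i).

Lemma thetaE n (P : {poly A}) : (size P <= n)%N ->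
  theta P = \sum_(i < n) (polyn P`_i) * 'X^(m * i).
Proof.
move=> h; rewrite /theta (big_ord_widen n (fun i => polyn P`_i * 'X^(m * i)) h).
rewrite big_mkcond; apply: eq_bigr => i _; case: ltnP => // hi.
by rewrite nth_default //= mul0r.
Qed.

Lemma thetaD P P' : theta (P + P') = theta P + theta P'.
Proof.
set n := maxn (size P) (size P').
rewrite (@thetaE n) ?size_polyD // (@thetaE n P) ?leq_maxl //.
rewrite (@thetaE n P') ?leq_maxr // -big_split; apply: eq_bigr => i _.
by rewrite coefD /= mulrDl.
Qed.

Lemma theta0 : theta 0 = 0.
Proof. by rewrite /theta size_poly0 big_ord0. Qed.

Lemma thetaX P : theta ('X * P) = 'X^m * theta P.
Proof.
rewrite (@thetaE (size P).+1); last first.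
  by rewrite (leq_trans (size_polyMleq _ _)) // size_polyX.
rewrite big_ord_recl coefXM eqxx /= mul0r add0r /theta mulr_sumr.
apply: eq_bigr => i _; rewrite coefXM /= /bump /= add1n mulnS exprD /=; ring.
Qed.

Lemma thetaXn n P : theta ('X^n * P) = 'X^(m * n) * theta P.
Proof.
elim: n => [|n IH]; first by rewrite muln0 !expr0 !mul1r.
by rewrite exprS -mulrA thetaX IH mulnS exprD mulrA.
Qed.

Lemma theta_sum (I : Type) (r : seq I) (f : I -> {poly A}) :
  theta (\sum_(i <- r) f i) = \sum_(i <- r) theta (f i).
Proof. exact: (big_morph _ thetaD theta0). Qed.

Lemma theta_psi (a : {poly F}) : (size a <= p.-1 * M)%N -> theta (psi a) = a.
Proof.
move=> sa; rewrite (@thetaE 1) ?size_polyC ?leq_b1 // big_ord1 muln0 expr0 mulr1.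
transitivity (polyn (in_qpoly (Phi F p M) a)); first by rewrite /psi /= coefC.
by rewrite in_qpoly_small // mk_monic_Phi // size_Phi.
Qed.

Lemma theta_psi_mod (a b u : {poly F}) : (size b <= p.-1 * M)%N ->
  b = a + Phi F p M * u -> theta (psi a) = b.
Proof.
move=> sb h; rewrite -[RHS](theta_psi sb) h rmorphD rmorphM psi_Phi mul0r.
by rewrite addr0.
Qed.

(** [theta] is additive and turns the variable into [X^m], but it is not multiplicative in general.
    Here it is, because a product of two blocks has size at most [m + m] and is thus its own
    canonical representative modulo [Phi]. *)
Lemma theta_evlM f g : all (fun s => size s <= m)%N f -> all (fun s => size s <= m)%N g ->
  theta (evl psi 'X f * evl psi 'X g) = evl idp 'X^m f * evl idp 'X^m g.
Proof.
move=> hf hg.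
have H s : (size s <= m)%N -> theta (psi (Poly s) * evl psi 'X g) = Poly s * evl idp 'X^m g.
  move=> hs; elim: g hg => [|u g IH]; first by rewrite !mulr0 theta0.
  case/andP => hu /IH {}IH; rewrite !evl_cons mulrDr thetaD -rmorphM theta_psi.
    by rewrite [_ * ('X * _)]mulrCA thetaX IH [idp _]/=; ring.
  rewrite (leq_trans (size_polyMleq _ _)) //.
  apply: leq_trans (leq_pred _) (leq_trans _ hm).
  by apply: leq_add; apply: leq_trans (size_Poly _) _.
elim: f hf => [|s f IH]; first by rewrite !mul0r theta0.
case/andP => hs /IH {}IH; rewrite !evl_cons mulrDl thetaD H // -mulrA thetaX IH.
by rewrite [idp _]/=; ring.
Qed.

Lemma evl_blocks n s :
  evl idp 'X^m (mkseq (fun i => take m (drop (i * m) s)) n) = Poly (take (n * m) s).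
Proof.
elim: n s => [|n IH] s; first by rewrite mul0n take0.
rewrite -(Poly_take_drop m (take _ s)) mulSn take_takel ?leq_addr //.
rewrite addnC -take_drop -IH /mkseq /= mul0n drop0 mulrC (iotaDl 1 0) -map_comp.
congr (_ + _ * _); congr evl; apply: eq_map => i /=.
by rewrite drop_drop add1n mulSn addnC.
Qed.

Lemma spec_recomb h B : all (fun s => size s <= B)%N h -> (B <= m + m)%N ->
  spec (recomb 0 m h) (fun r => Poly r = evl idp 'X^m h /\ (size r <= (size h).+1 * m)%N)
    (size h * B).
Proof.
move=> + hB; elim: h => [|s h IH] /=; first by move=> _; apply: spec_ret.
case/andP => hs /IH {}IH.
apply: (spec_bind (c2 := B) IH) => [r [Pr sr]|]; last by rewrite mulSn addnC.
apply: (spec_weaken (spec_addl _ _)) => [u [Pu su]|]; last first.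
  exact: leq_trans (geq_minl _ _) hs.
split; first by rewrite Pu Poly_shift Pr.
rewrite su size_cat size_nseq geq_max; apply/andP; split; last first.
  by rewrite [leqRHS]mulSn leq_add2l.
by apply: leq_trans hs (leq_trans hB _); rewrite !mulSn addnA leq_addr.
Qed.

End Step.

(* [p ^ k * tau k] bounds the cost of a product modulo [Phi p (p ^ k)]; the
   constant is chosen so that [tau_rec] holds. *)
Definition tau (k : nat) : nat :=
  (2520 * ((k - 2).+1 * (up_log 2 (k - 2).+1).+1))%N.

Lemma up_log2_le n : (2 <= n)%N -> (3 * up_log 2 n <= 2 * n)%N.
Proof.
elim/ltn_ind: n => -[|[|[|[|n]]]] // IH _.
rewrite up_log2S //; have := IH (n.+3./2.+1) ltac:(lia) ltac:(lia); lia.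
Qed.

(** The offset 2 in [tau] makes the recursion exact: [k./2.+1 - 2] is the half of [j = k - 2]. With
    [x] the logarithm at half size, the logarithm at full size is [x + 1], and the resulting gain of
    [2520 * (j - x)] covers [420 * k.+1] by [up_log2_le]. *)
Lemma tau_rec k : (2 < k)%N -> (2 * tau (k./2.+1) + 420 * k.+1 <= tau k)%N.
Proof.
move=> hk; have [j hj] : exists j, k = j.+2 by exists (k - 2)%N; lia.
rewrite /tau; have -> : (k./2.+1 - 2 = j./2)%N by lia.
have -> : (k - 2 = j)%N by lia.
rewrite hj.
have j0 : (0 < j)%N by lia.
rewrite (up_log2S j0).
have := @up_log2_le j.+1 ltac:(lia); rewrite (up_log2S j0).
move: (up_log 2 _) => x hx.
have h1 : (2 * (j./2.+1 * x.+1) <= j.+2 * x.+1)%N.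
  by rewrite mulnA leq_mul2r; apply/orP; right; lia.
nia.
Qed.

Lemma spec_mulPhi_school k s1 s2 : (k <= 2)%N ->
  (size s1 <= p * p ^ k)%N -> (size s2 <= p * p ^ k)%N ->
  spec (mulPhi_school p 0 k s1 s2) (fun r => (size r <= p * p ^ k)%N /\
    exists u, Poly r = Poly s1 * Poly s2 + Phi F p (p ^ k) * u) (p ^ k * tau k).
Proof.
move=> k2 h1 h2; set Q := (p * p ^ k)%N in h1 h2 *.
apply: (spec_bind (c1 := Q * (2 * Q)) (c2 := Q)
   (spec_weaken (spec_mul_school s1 s2) (fun _ h => h) _)).
- by apply: leq_mul => //; apply: leq_mul.
- move=> r [Pr sr].
  have hr : (size r <= 2 * Q)%N.
    by apply: leq_trans sr _; rewrite mul2n -addnn leq_add.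
  apply: (spec_weaken (spec_wrapl hr)) => // r' [sr' [t Pr']]; split => //.
  by exists (- ('X^(p ^ k) - 1) * t); rewrite Pr' Pr PhiXn; ring.
- rewrite /Q /tau (_ : (k - 2 = 0)%N); last by lia.
  rewrite /= up_log1.
  case: peps => -[-> _]; case: k k2 {h1 h2 Q} => [|[|[|]]] //.
Qed.

Lemma spec_mulPhi fuel k s1 s2 : (k <= fuel.+2)%N ->
  (size s1 <= p * p ^ k)%N -> (size s2 <= p * p ^ k)%N ->
  spec (mulPhi p eps 0 pinv fuel k s1 s2) (fun r => (size r <= p * p ^ k)%N /\
    exists u, Poly r = Poly s1 * Poly s2 + Phi F p (p ^ k) * u) (p ^ k * tau k).
Proof.
elim: fuel k s1 s2 => [|fuel IH] k s1 s2 hk h1 h2.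
  exact: spec_mulPhi_school.
rewrite /=; case: leqP => hk2; first exact: spec_mulPhi_school.
set k' := k./2.+1; set a := (k - k' + eps)%N; set m := (p ^ (k' - eps))%N.
have e1 : (eps <= 1)%N by case: peps => -[_ ->].
have k'k : (k' < k)%N by rewrite /k'; lia.
have M0 : (0 < p ^ k')%N by rewrite expn_gt0 p0.
have pe2 : (p.-1 * p ^ eps = 2)%N by case: peps => -[-> ->].
have hm : (m + m = p.-1 * p ^ k')%N.
  rewrite -[in RHS](subnK (leq_trans e1 (ltn0Sn k./2) : (eps <= k')%N)).
  by rewrite expnD mulnCA pe2 muln2 addnn.
have hak : (p ^ a * p ^ k' = p ^ eps * p ^ k)%N.
  by rewrite -!expnD; congr (_ ^ _)%N; rewrite /a; lia.
have hma : (m * p ^ a = p ^ k)%N.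
  by rewrite /m /a -expnD; congr (_ ^ _)%N; lia.
have hMa : (p ^ a %| p ^ k')%N.
  by apply: dvdn_exp2l; rewrite /a /k'; lia.
pose M := (p ^ k')%N; pose Q' := (p * M)%N.
pose A := {poly %/ (Phi F p M)}.
pose psi : {rmorphism {poly F} -> {poly A}} := polyC \o in_qpoly (Phi F p M).
pose idp : {rmorphism {poly F} -> {poly F}} := idfun.
have ph0 : psi (Phi F p M) = 0 := psi_Phi M0.
have IHm t1 t2 : (size t1 <= Q')%N -> (size t2 <= Q')%N ->
   spec (mulPhi p eps 0 pinv fuel k' t1 t2) (fun r => (size r <= Q')%N /\
      exists u, Poly r = Poly t1 * Poly t2 + Phi F p M * u) (M * tau k').
  by apply: IH; rewrite /k'; lia.
have m0 : (0 < m)%N by rewrite expn_gt0 p0.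
have mQ : (m <= Q')%N.
  apply: leq_trans (_ : p.-1 * M <= _)%N; last by rewrite leq_mul2r leq_pred orbT.
  by rewrite -hm leq_addr.
pose bl s := mkseq (fun i => take m (drop (i * m) s)) (p * p ^ a) : seq (seq F).
have blm s : all (fun s => size s <= m)%N (bl s).
  apply/(all_nthP [::]) => i; rewrite size_mkseq => hi.
  by rewrite nth_mkseq // size_take; case: ltnP.
have wbl s : wfv (p * p ^ a) Q' (bl s).
  split; first by rewrite size_mkseq.
  by apply/allP => u /(allP (blm s)) h; apply: leq_trans h mQ.
have ND := @spec_root F {poly A} psi 'X p M pinv p23 pinvP M0 ph0 _ a _
  (bl s1) (bl s2) hMa IHm (wbl s1) (wbl s2).
apply: (spec_bind (c2 := p * p ^ a * (p.-1 * M) + (p * p ^ a * (p.-1 * M) + p * p ^ k)) ND).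
- move=> h [[sh wh] [v hv]].
  set f := evl psi 'X (bl s1) in hv; set g := evl psi 'X (bl s2) in hv.
  set G : {poly A} := \sum_(d < p) 'X^(p ^ a * d) in hv.
  apply: (spec_bind (c1 := p * p ^ a * (p.-1 * M))
    (c2 := p * p ^ a * (p.-1 * M) + p * p ^ k)
    (_ : spec _ (fun hc => [/\ size hc = (p * p ^ a)%N,
      all (fun s => size s <= p.-1 * M)%N hc
      & theta m (evl psi 'X h) = evl idp 'X^m hc]) _)) => //.
    rewrite -sh; elim: {sh hv v} h wh => [|s h IHh] /=.
      by move=> _; apply: spec_ret; split; rewrite ?theta0.
    case/andP => hs /IHh {}IHh.
    apply: (spec_bind (c2 := size h * (p.-1 * M)) (spec_redPhi hs)) => // r [sr [u Pr]].
    apply: (spec_bind (c2 := 0) IHh) => [hc [shc whc ehc]|]; last by rewrite addn0.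
    apply: spec_ret; split; rewrite /= ?shc // ?whc ?sr //.
    rewrite thetaD thetaX ehc; congr (_ + _); apply: theta_psi_mod Pr => //.
    exact: leq_trans (size_Poly _) sr.
  move=> hc [shc whc ehc].
  have hmm : (p.-1 * M <= m + m)%N by rewrite hm.
  have := spec_recomb whc hmm; rewrite shc => hrec.
  apply: (spec_bind (c2 := p * p ^ k) hrec) => // r [Pr sr].
  have hpk : ((p * p ^ a) * m = p * p ^ k)%N by rewrite -mulnA [(p ^ a * m)%N]mulnC hma.
  have hr : (size r <= 2 * (p * p ^ k))%N.
    apply: leq_trans sr _; rewrite mulSn hpk mul2n -addnn leq_add2r.
    by rewrite -hpk leq_pmull // muln_gt0 p0 expn_gt0 p0.
  apply: (spec_weaken (spec_wrapl hr)) => // r' [sr' [t Pr']]; split => //.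
  have hth : theta m (f * g) = Poly s1 * Poly s2.
    rewrite theta_evlM ?hm // !evl_blocks hpk !take_oversize //.
  (* [X^m] to the power [p^a] is [X^(p^k)], so the modulus in [Z] becomes [Phi F p (p ^ k)]. *)
  have hG : theta m (G * v) = Phi F p (p ^ k) * theta m v.
    rewrite /G mulr_suml theta_sum /Phi mulr_suml; apply: eq_bigr => d _.
    by rewrite thetaXn mulnA hma mulnC.
  exists (theta m v - ('X^(p ^ k) - 1) * t).
  by rewrite Pr' Pr -ehc hv thetaD hth hG PhiXn; ring.
(* There are [(p-1) p^a] recursive products of cost [p^k' * tau k'], in total [2 * p^k * tau k'] by
   [hak] and [pe2]. Everything else is at most [420 * k.+1 * p^k]. *)
- apply: leq_trans (leq_mul (leqnn (p ^ k)) (tau_rec hk2)).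
  rewrite /Q' -/M subn1.
  have ak : (a <= k)%N by rewrite /a /k'; lia.
  move: hak; rewrite -/M; move: (p ^ a)%N (p ^ k)%N (tau k') => x y z hxy.
  clearbody M; clear -hxy ak peps.
  case: peps hxy => -[-> ->]; rewrite ?expn1 ?expn0 => hxy; nia.
Qed.

Definition mcost (K : nat) : nat := (2 ^ K * (K.+1 * (up_log 2 K.+1).+1))%N.

(** [(p-1) p^k >= 2^(K+1)] bounds the length of the product, so the residue modulo [Phi] is the
    product itself. As [p^k <= 6 * 2^K], the constant 16000 covers [6 * 2520] from [tau] and 12 for
    the final reduction. *)
Lemma spec_mulp K s1 s2 : (size s1 <= 2 ^ K)%N -> (size s2 <= 2 ^ K)%N ->
  spec (mulp p eps 0 pinv K s1 s2) (fun r => (size r <= size s1 + size s2)%N /\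
    Poly r = Poly s1 * Poly s2) (4 * (4000 * mcost K)).
Proof.
move=> h1 h2; rewrite /mulp; set k := up_log p _.
have p1 : (1 < p)%N by case: peps => -[-> _].
have hk : (2 ^ K.+1 <= p ^ k)%N by apply: up_logP.
have K1 : (1 < 2 ^ K.+1)%N by rewrite expnS; have := expn_gt0 2 K; lia.
have k0 : (0 < k)%N by rewrite up_log_gt0 p1.
have hk' : (p ^ k <= 6 * 2 ^ K)%N.
  have : (p ^ k.-1 < 2 ^ K.+1)%N by apply: up_log_gtn.
  have p3 : (p <= 3)%N by case: peps => -[-> _].
  rewrite -[in X in _ -> X](prednK k0) !expnS => h.
  by apply: leq_trans (leq_mul p3 (ltnW h)) _; rewrite mulnA.
have kK : (k <= K.+1)%N by apply: up_log_min => //; rewrite leq_exp2r.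
have hQ : (2 ^ K.+1 <= p * p ^ k)%N by apply: leq_trans hk _; rewrite leq_pmull.
have hQ1 : (2 ^ K <= p * p ^ k)%N by apply: leq_trans hQ; rewrite leq_exp2l.
have pk0 : (0 < p ^ k)%N by rewrite expn_gt0 p0.
apply: (spec_bind (c2 := p.-1 * p ^ k) (spec_mulPhi (leq_trans (leqnSn k) (leqnSn _))
   (leq_trans h1 hQ1) (leq_trans h2 hQ1))) => [r [sr [u Pr]]|].
  apply: (spec_bind (c2 := 0) (spec_redPhi sr)) => [r' [sr' [u' Pr']]|]; last by rewrite addn0.
  have s12 : (size (Poly s1 * Poly s2)%R <= size s1 + size s2)%N.
    apply: leq_trans (size_polyMleq _ _) (leq_trans (leq_pred _) _).
    by apply: leq_add; apply: size_Poly.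
  have E : Poly r' = Poly s1 * Poly s2.
    apply: (small_mod_Phi (u := u + u') pk0); last by rewrite Pr' Pr; ring.
      exact: leq_trans (size_Poly _) sr'.
    apply: leq_trans s12 (leq_trans (leq_add h1 h2) _).
    rewrite addnn -mul2n -expnS; apply: leq_trans hk _.
    by rewrite leq_pmull //; lia.
  apply: spec_ret; split; first by rewrite size_take; case: ltnP.
  by rewrite Poly_take E take_poly_id.
have ht : (tau k <= 2520 * (K.+1 * (up_log 2 K.+1).+1))%N.
  rewrite /tau leq_mul2l /= leq_mul //; first by lia.
  by rewrite ltnS leq_up_log //; lia.
rewrite /mcost; move: ht hk'.
have : (0 < K.+1 * (up_log 2 K.+1).+1)%N by [].
move: (K.+1 * _)%N => Z Z0 ht hk'.
have p3 : (p.-1 <= 2)%N by case: peps => -[-> _].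
have := leq_mul hk' ht; have := leq_mul p3 hk'; have := leq_pmulr (2 ^ K) Z0.
lia.
Qed.

End FastMul.

(** * Reversal of polynomials *)

Section Reversal.
Variable F : fieldType.
Implicit Types p q : {poly F}.

(** [X^e p(1/X)] for [p] of degree at most [e]: leading terms become constant terms, and cancelling
    them becomes approximation at 0. *)
Definition rv (e : nat) (p : {poly F}) : {poly F} := \poly_(i < e.+1) p`_(e - i).

Lemma coef_rv e p i : (rv e p)`_i = if (i <= e)%N then p`_(e - i) else 0.
Proof. by rewrite coef_poly ltnS. Qed.

Lemma size_rv e p : (size (rv e p) <= e.+1)%N.
Proof. exact: size_poly. Qed.

Lemma rvK e p : (size p <= e.+1)%N -> rv e (rv e p) = p.
Proof.
move=> sp; apply/polyP => i; rewrite !coef_rv.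
case: leqP => hi; first by rewrite leq_subr subKn.
by rewrite nth_default // (leq_trans sp).
Qed.

Lemma rvD e p q : rv e (p + q) = rv e p + rv e q.
Proof. by apply/polyP => i; rewrite coefD !coef_rv coefD; case: leqP; rewrite ?addr0. Qed.

Lemma rv0 e : rv e 0 = 0.
Proof. by apply/polyP => i; rewrite coef_rv !coef0 if_same. Qed.

Lemma rvZ e (c : F) p : rv e (c%:P * p) = c%:P * rv e p.
Proof. by apply/polyP => i; rewrite coefCM !coef_rv coefCM; case: leqP; rewrite ?mulr0. Qed.

Lemma rv_sum (I : Type) (r : seq I) e (f : I -> {poly F}) :
  rv e (\sum_(i <- r) f i) = \sum_(i <- r) rv e (f i).
Proof. exact: (big_morph _ (rvD e) (rv0 e)). Qed.

Lemma rv_MXn e d p : rv (e + d) ('X^d * p) = rv e p.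
Proof.
apply/polyP => i; rewrite !coef_rv coefXnM.
case: (leqP i e) => hi.
  have -> : (i <= e + d)%N by lia.
  by have -> : (e + d - i < d)%N = false; [lia|congr (p`_ _); lia].
by case: (leqP i (e + d)) => // hi'; rewrite ifT //; lia.
Qed.

Lemma rv_addn e d p : (size p <= e.+1)%N -> rv (e + d) p = 'X^d * rv e p.
Proof.
move=> sp; apply/polyP => i; rewrite coefXnM !coef_rv.
case: (ltnP i d) => hi.
  by case: leqP => // h; rewrite nth_default // (leq_trans sp) //; lia.
have -> : (i - d <= e)%N = (i <= e + d)%N by lia.
by case: leqP => // h; congr (p`_ _); lia.
Qed.

(** A factor [X^t] of the reversal means that the top [t] coefficients vanish. For [p = 0] nothing
    would bound [t], and this is how zero entries are told apart later. *)
Lemma rv_divXn e t p r : (size p <= e.+1)%N -> rv e p = 'X^t * r -> p != 0 ->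
  (t <= e)%N /\ p = rv (e - t) r.
Proof.
move=> sp h p0; have sp' : (size p + t <= e.+1)%N.
  rewrite leqNgt; apply/negP => hlt.
  have s0 : (0 < size p)%N by rewrite size_poly_gt0.
  have : (rv e p)`_(e.+1 - size p) = 0.
    by rewrite h coefXnM; have -> : (e.+1 - size p < t)%N by move: hlt sp s0; lia.
  rewrite coef_rv ifT; last by move: s0; lia.
  have -> : (e - (e.+1 - size p) = (size p).-1)%N by move: sp s0; lia.
  by apply/eqP; rewrite -lead_coefE lead_coef_eq0.
have s0 : (0 < size p)%N by rewrite size_poly_gt0.
have te : (t <= e)%N by move: sp' s0; lia.
split => //; by rewrite -[p in LHS](rvK sp) h -{1}(subnK te) rv_MXn.
Qed.

End Reversal.

(** * Minimal approximant bases *)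

Section Chain.
Variable F : fieldType.

(* [lam i] bounds the degree of row [i] before reversal, and [b i] marks the rows
   that stay independent. *)
Definition step (m N : nat) (lam : {ffun 'I_m -> nat}) (L : 'M[F]_(m, N.+1))
    (C : 'M[F]_m) (b : 'I_m -> bool) : Prop :=
  [/\ C \in unitmx,
      forall i j, C i j != 0 -> (lam j <= lam i)%N,
      forall i j, ~~ b i -> (C *m L) i j = 0
    & exists piv : 'I_m -> 'I_N.+1,
        (forall i, b i -> (C *m L) i (piv i) != 0 /\
           forall j : 'I_N.+1, (piv i < j)%N -> (C *m L) i j = 0) /\
        (forall i i', b i -> b i' -> piv i = piv i' -> i = i')].

Definition Emx m (C : 'M[F]_m) (b : 'I_m -> bool) : 'M[{poly F}]_m :=
  \matrix_(i, j) ((C i j)%:P * 'X^(b i)).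

Definition lead m N (r : 'M[{poly F}]_(m, N)) : 'M[F]_(m, N) :=
  map_mx (fun p : {poly F} => p`_0) r.

(** Multiplying the surviving rows by [X] and then dividing the whole matrix by [X] amounts to
    dividing the vanishing rows alone; the labels count these multiplications. Hence [P] stays
    polynomial, the true degree bound after [t] steps is the label minus [t], and labels remain
    natural numbers even for rows that have become zero. *)
Inductive chain m N : nat -> {ffun 'I_m -> nat} -> 'M[{poly F}]_(m, N.+1) ->
    'M[{poly F}]_m -> {ffun 'I_m -> nat} -> 'M[{poly F}]_(m, N.+1) -> Prop :=
| chain0 lam r : chain 0 lam r 1%:M lam r
| chainS t (lam : {ffun 'I_m -> nat}) r C (b : 'I_m -> bool) r1 P lam2 r2 :
    step lam (lead r) C b -> Emx C b *m r = 'X *: r1 ->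
    chain t [ffun i => lam i + b i]%N r1 P lam2 r2 ->
    chain t.+1 lam r (P *m Emx C b) lam2 r2.

Lemma chain_cat m N t1 t2 lam lam1 lam2 (r r1 r2 : 'M_(m, N.+1)) P1 P2 :
  chain t1 lam r P1 lam1 r1 -> chain t2 lam1 r1 P2 lam2 r2 ->
  chain (t1 + t2) lam r (P2 *m P1) lam2 r2.
Proof.
move=> h1; elim: h1 t2 lam2 r2 P2 => {t1 lam r P1 lam1 r1} [lam r|t lam r C b r1 P lam1 r1' st E _ IH] t2 lam2 r2 P2 h2.
  by rewrite add0n mulmx1.
by rewrite addSn mulmxA; apply: chainS st E (IH _ _ _ _ h2).
Qed.

Lemma chain_eq m N t lam lam' (r r' : 'M_(m, N.+1)) P :
  chain t lam r P lam' r' -> P *m r = 'X^t *: r'.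
Proof.
elim => {t lam lam' r r' P} [lam r|t lam r C b r1 P lam1 r1' st E _ IH].
  by rewrite mul1mx expr0 scale1r.
by rewrite -mulmxA E -scalemxAr IH scalerA -exprS.
Qed.

Lemma chain_size m N t lam lam' (r r' : 'M_(m, N.+1)) P :
  chain t lam r P lam' r' -> forall i j, (size (P i j) <= t.+1)%N.
Proof.
elim => {t lam lam' r r' P} [lam r i j|t lam r C b r1 P lam1 r1' st E _ IH i j].
  by rewrite mxE; case: eqP => _; rewrite ?mulr0n ?mulr1n ?size_poly0 ?size_poly1.
rewrite mxE (leq_trans (size_sum _ _ _)) //; apply/bigmax_leqP => k _.
rewrite (leq_trans (size_polyMleq _ _)) //.
have : (size (Emx C b k j) <= 2)%N.
  rewrite mxE mul_polyC (leq_trans (size_scale_leq _ _)) // size_polyXn.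
  by case: (b k).
have := IH i k; move: (size (P i k)) (size (Emx C b k j)) => x y; lia.
Qed.

Lemma chain_label m N t lam lam' (r r' : 'M_(m, N.+1)) P :
  chain t lam r P lam' r' -> forall i, (lam' i <= lam i + t)%N.
Proof.
elim => {t lam lam' r r' P} [lam r i|t lam r C b r1 P lam1 r1' st E _ IH i].
  by rewrite addn0.
by have := IH i; rewrite ffunE; case: (b i); lia.
Qed.

(** With one column, injectivity of the pivots leaves at most one surviving row per step. *)
Lemma chain_pair m t lam lam' (r r' : 'M_(m, 1)) P :
  chain t lam r P lam' r' -> forall i i', i != i' ->
  (lam' i + lam' i' <= lam i + lam i' + t)%N.
Proof.
elim => {t lam lam' r r' P} [lam r i i' _|t lam r C b r1 P lam1 r1' st E _ IH i i' ii'].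
  by rewrite addn0.
have := IH i i' ii'; rewrite !ffunE.
have : ~~ (b i && b i').
  apply/negP => /andP[bi bi']; case: st => _ _ _ [piv [_ inj]].
  by move/eqP: ii'; apply; apply: inj => //; rewrite !ord1.
by case: (b i); case: (b i') => //; lia.
Qed.

(* [U] is the transformation [P] read on the unreversed rows. *)
Definition reads m (lam lam' : {ffun 'I_m -> nat}) (P U : 'M[{poly F}]_m) : Prop :=
  forall i j (a : {poly F}), (size a <= (lam j).+1)%N ->
    (size (U i j * a)%R <= (lam' i).+1)%N /\
    P i j * rv (lam j) a = rv (lam' i) (U i j * a).

(** Before reversal, adding row [j] to row [i] needs the factor [X^(lam i - lam j)], a polynomial by
    the order condition in [step]. Conjugation by the diagonal matrix of the [X^(lam i)] gives [U]
    the constant determinant of [C]; the factor [X^(b i)] merely raises the label. *)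
Lemma step_reads m N lam (L : 'M_(m, N.+1)) C b : step lam L C b ->
  exists2 U : 'M[{poly F}]_m, U \in unitmx &
    reads lam [ffun i => lam i + b i]%N (Emx C b) U.
Proof.
case=> Cu tri _ _; exists (\matrix_(i, j) ((C i j)%:P * 'X^(lam i - lam j))).
  pose D : 'M[{poly F}]_m := diag_mx (\row_i 'X^(lam i)).
  set U := \matrix_(i, j) _.
  have E : D *m map_mx polyC C = U *m D.
    apply/matrixP => i j; rewrite mul_diag_mx mul_mx_diag !mxE.
    have [->|cij] := eqVneq (C i j) 0; first by rewrite polyC0 mulr0 !mul0r.
    by rewrite -mulrA -exprD subnK ?tri // mulrC.
  have D0 : \det D != 0.
    rewrite det_diag; apply/prodf_neq0 => i _; rewrite mxE.
    by rewrite expf_neq0 // polyX_eq0.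
  have := congr1 (fun A => \det A) E; rewrite !det_mulmx mulrC => /(mulIf D0) dU.
  by rewrite unitmxE -dU det_map_mx; apply: rmorph_unit; rewrite -unitmxE.
move=> i j a sa; rewrite !mxE !ffunE.
have [->|cij] := eqVneq (C i j) 0.
  by rewrite polyC0 !mul0r size_poly0 rv0.
have lij := tri _ _ cij; split.
  rewrite -mulrA mul_polyC (leq_trans (size_scale_leq _ _)) //.
  rewrite (leq_trans (size_polyMleq _ _)) // size_polyXn addSn /=.
  by move: sa; move: (size a) => x; lia.
rewrite -!mulrA rvZ; congr (_ * _).
rewrite rv_addn; last first.
  rewrite (leq_trans (size_polyMleq _ _)) // size_polyXn addSn /=.
  by move: sa; move: (size a) => x; lia.
by rewrite -[X in rv X ('X^_ * _)](subnKC lij) rv_MXn.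
Qed.

Lemma reads_comp m lam lam1 lam2 (P1 U1 P2 U2 : 'M_m) :
  reads lam lam1 P1 U1 -> reads lam1 lam2 P2 U2 ->
  reads lam lam2 (P2 *m P1) (U2 *m U1).
Proof.
move=> h1 h2 i j a sa; rewrite !mxE !mulr_suml.
have H k := h1 k j a sa.
have H2 k := h2 i k _ (H k).1.
split.
  rewrite (leq_trans (size_sum _ _ _)) //; apply/bigmax_leqP => k _.
  by rewrite -mulrA; apply: (H2 k).1.
rewrite rv_sum; apply: eq_bigr => k _.
by rewrite -!mulrA (H k).2 (H2 k).2.
Qed.

Lemma chain_reads m N t lam lam' (r r' : 'M_(m, N.+1)) P :
  chain t lam r P lam' r' ->
  exists2 U : 'M[{poly F}]_m, U \in unitmx & reads lam lam' P U.
Proof.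
elim => {t lam lam' r r' P} [lam r|t lam r C b r1 P lam1 r1' st E _ [U2 U2u h2]].
  exists 1%:M; first exact: unitmx1.
  move=> i j a sa; rewrite mxE; have [->|_] := eqVneq i j.
    by rewrite mulr1n !mul1r.
  by rewrite mulr0n !mul0r size_poly0 rv0.
have [U1 U1u h1] := step_reads st.
by exists (U2 *m U1); [rewrite unitmx_mul U2u|apply: reads_comp h1 h2].
Qed.

Definition rvmx m N (lam : {ffun 'I_m -> nat}) (a : 'M[{poly F}]_(m, N)) :
    'M[{poly F}]_(m, N) := \matrix_(i, j) rv (lam i) (a i j).

Lemma reads_mul m N lam lam' (P U : 'M_m) (a : 'M[{poly F}]_(m, N)) :
  reads lam lam' P U -> (forall i j, size (a i j) <= (lam i).+1)%N ->
  P *m rvmx lam a = rvmx lam' (U *m a) /\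
  (forall i j, size ((U *m a) i j) <= (lam' i).+1)%N.
Proof.
move=> h sa; split.
  apply/matrixP => i j; rewrite !mxE rv_sum; apply: eq_bigr => k _.
  by rewrite mxE (h i k _ (sa k j)).2.
move=> i j; rewrite mxE (leq_trans (size_sum _ _ _)) //; apply/bigmax_leqP => k _.
exact: (h i k _ (sa k j)).1.
Qed.

Definition popov_lead n N (A : 'M[F]_(n, N)) : Prop :=
  exists piv : 'I_n -> 'I_N, injective piv /\
    forall i, A i (piv i) != 0 /\ forall j : 'I_N, (piv i < j)%N -> A i j = 0.

(** In a vanishing combination of rows, the row with the rightmost pivot among those involved is
    alone in its pivot column. *)
Lemma popov_lead_det n (A : 'M[F]_n) : popov_lead A -> \det A != 0.
Proof.
move=> [piv [inj pivP]]; apply/negP => /det0P [v v0 vA].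
have [i0 vi0] : exists i, v ord0 i != 0.
  apply/existsP; apply: contraNT v0; rewrite negb_exists => /forallP h.
  by apply/eqP/rowP => i; rewrite mxE; apply/eqP; rewrite -[_ == _]negbK.
case: (@arg_maxnP _ i0 (fun i => v ord0 i != 0) (fun i => piv i : nat) vi0) => i vi imax.
have := congr1 (fun w : 'rV_n => w ord0 (piv i)) vA; rewrite !mxE (bigD1 i) //=.
rewrite big1 => [|k ki]; last first.
  have [->|vk] := eqVneq (v ord0 k) 0; first by rewrite mul0r.
  rewrite (pivP k).2 ?mulr0 // ltn_neqAle (imax _ vk : (_ <= _)%N) andbT.
  by apply: contra ki => /eqP /val_inj /inj /eqP.
move/eqP; rewrite addr0 mulf_eq0 (negPf vi) /=.
by apply/negP; apply: (pivP i).1.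
Qed.

Lemma det_lead n (r : 'M[{poly F}]_n) : \det (lead r) = (\det r)`_0.
Proof.
rewrite -horner_coef0 -[_.[0]]/(horner_eval 0 _) -det_map_mx; congr (\det _).
by apply/matrixP => i j; rewrite !mxE /= horner_evalE horner_coef0.
Qed.

Lemma det_Emx n (C : 'M[F]_n) b :
  \det (Emx C b) = (\det C)%:P * 'X^(\sum_i b i).
Proof.
have -> : Emx C b = diag_mx (\row_i 'X^(b i)) *m map_mx polyC C.
  by apply/matrixP => i j; rewrite mul_diag_mx !mxE mulrC.
rewrite det_mulmx det_diag det_map_mx mulrC; congr (_ * _).
by rewrite expr_sum; apply: eq_bigr => i _; rewrite mxE.
Qed.

(** A step lowers the valuation [nu] of the determinant by the number of vanishing rows. If no row
    vanishes, the constant terms are already in Popov form, so [nu = 0], and no later step can make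
    a row vanish. Since [nu < t], such a step occurs. *)
Lemma chain_popov n t lam lam' (r r' : 'M[{poly F}]_n.+1) P nu g :
  chain t lam r P lam' r' -> \det r = 'X^nu * g -> g`_0 != 0 -> (nu < t)%N ->
  popov_lead (lead r').
Proof.
move=> h; elim: h nu g => {t lam lam' r r' P} // t lam r C b r1 P lam1 r1' st E ch IH nu g dr g0 nut.
have [Cu tri zero [piv [pivP inj]]] := st.
have C0 : \det C != 0 by rewrite -unitfE -unitmxE.
have dE := congr1 (fun A => \det A) E.
rewrite det_mulmx det_Emx dr detZ in dE.
case: (boolP [forall i, b i]) => [/forallP ball|].
  have sb : (\sum_i b i = n.+1)%N.
    by rewrite (eq_bigr (fun=> 1%N)) ?sum1_card ?card_ord // => i _; rewrite ball.
  have r1E : r1 = map_mx polyC C *m r.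
    apply/matrixP => i j; have := congr1 (fun A : 'M_n.+1 => A i j) E; rewrite !mxE => e.
    have X0 : 'X != 0 :> {poly F} by rewrite polyX_eq0.
    apply: (mulfI X0); rewrite -e mulr_sumr; apply: eq_bigr => k _.
    by rewrite !mxE ball expr1; ring.
  have l1 : lead r1 = C *m lead r.
    rewrite r1E; apply/matrixP => i j; rewrite !mxE coef_sum.
    by apply: eq_bigr => k _; rewrite !mxE coefCM.
  have pl : popov_lead (lead r1).
    exists piv; split; first by move=> i i'; apply: inj.
    by move=> i; rewrite l1; apply: pivP.
  have d1 : \det r1 = 'X^nu * ((\det C)%:P * g).
    by rewrite r1E det_mulmx det_map_mx dr mulrCA.
  have nu0 : nu = 0%N.
    have := popov_lead_det pl; rewrite det_lead d1 coefXnM.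
    by case: nu {dr nut dE d1} => //= n'; rewrite eqxx.
  case: t nut ch IH => [|t] nut ch IH.
    by inversion ch; subst.
  by apply: (IH nu _ d1); rewrite ?coefCM ?mulf_neq0 // nu0.
rewrite negb_forall => /existsP [i0 bi0].
have sb : (\sum_i b i <= n)%N.
  rewrite (bigD1 i0) //= (negPf bi0) add0n.
  apply: (@leq_trans (\sum_(i < n.+1 | i != i0) 1)%N).
    by apply: leq_sum => i _; case: (b i).
  by rewrite sum1_card cardC1 card_ord.
set B := (\sum_i b i)%N in dE sb.
have E' : 'X^(B + nu) * ((\det C)%:P * g) = 'X^(n.+1) * \det r1.
  by rewrite -dE exprD; ring.
have gC0 : ((\det C)%:P * g)`_0 != 0 by rewrite coefCM mulf_neq0.
have hB : (n.+1 <= B + nu)%N.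
  rewrite leqNgt; apply/negP => hlt.
  have := congr1 (fun p : {poly F} => p`_(B + nu)) E'.
  by rewrite !coefXnM ltnn subnn hlt => /eqP; apply/negP.
apply: (IH (B + nu - n.+1)%N ((\det C)%:P * g)) => //; last by lia.
have X0 : 'X^(n.+1) != 0 :> {poly F} by rewrite expf_neq0 // polyX_eq0.
by apply: (mulfI X0); rewrite -E' [RHS]mulrA -exprD subnKC.
Qed.

End Chain.

(** * Approximant bases by divide and conquer *)

Definition ent V (A : seq (seq (seq V))) (i j : nat) : seq V :=
  nth [::] (nth [::] A i) j.

Definition argmin (lam : nat -> nat) (c : nat) (cs : seq nat) : nat :=
  foldr (fun i j => if (lam i <= lam j)%N then i else j) c cs.

Section Programs.
Variables (V : Type) (z o : V).
Local Open Scope nat_scope.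

Definition mulM (mul : seq V -> seq V -> prog V (seq V)) (m n N : nat)
    (A B : seq (seq (seq V))) : prog V (seq (seq (seq V))) :=
  tabM (fun i => tabM (fun j =>
    loopM (fun k acc => let* t := mul (ent A i k) (ent B k j) in addl acc t)
      0 n [::]) 0 N) 0 m.

Definition mapE (f : seq V -> seq V) (A : seq (seq (seq V))) :
  seq (seq (seq V)) := map (map f) A.

(** The flag marks rows already used as pivots. Choosing the candidate of least label ensures that a
    row is only ever added to rows of at least its label. *)
Definition gauss_col (m : nat) (lam : seq nat) (q : nat)
    (st : seq (bool * seq V)) : prog V (seq (bool * seq V)) :=
  let rw i := nth (false, [::]) st i in
  let* cand := tabM (fun i => IsZero (nth z (rw i).2 q)
                 (fun b => Ret (~~ b && ~~ (rw i).1))) 0 m in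
  match [seq i <- iota 0 m | nth false cand i] with
  | [::] => Ret st
  | c :: cs =>
    let i0 := argmin (nth 0 lam) c cs in
    tabM (fun i =>
      if nth false cand i && (i != i0) then
        Op FDiv (nth z (rw i).2 q) (nth z (rw i0).2 q) (fun f =>
          let* s := scalel f (rw i0).2 in
          let* r := subl z (rw i).2 s in Ret ((rw i).1, r))
      else Ret ((rw i).1 || (i == i0), (rw i).2)) 0 m
  end.

(** Columns are treated from the right because [LP] takes the largest index of maximal degree. The
    appended identity matrix records the transformation [C]. *)
Definition gauss (m N : nat) (lam : seq nat) (r : seq (seq (seq V))) :
    prog V (seq (seq (seq V)) * seq nat) :=
  let st0 := mkseq (fun i => (false,
    mkseq (fun j => nth z (ent r i j) 0) N
    ++ mkseq (fun j => if i == j then o else z) m)) m in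
  let* st := loopM (fun c st => gauss_col m lam (N - c.+1) st) 0 N st0 in
  let rw i := nth (false, [::]) st i in
  Ret (mkseq (fun i => mkseq (fun j =>
         nseq (rw i).1 z ++ [:: nth z (rw i).2 (N + j)]) m) m,
       mkseq (fun i => nth 0 lam i + (rw i).1) m).

Variables (p eps : nat) (pinv : V).

Fixpoint pm (m N K : nat) (lam : seq nat) (r : seq (seq (seq V))) :
    prog V (seq (seq (seq V)) * seq nat) :=
  if K is K'.+1 then
    let t := 2 ^ K' in
    let* x := pm m N K' lam (mapE (take t) r) in
    let* y := mulM (mulp p eps z pinv K) m m N x.1 r in
    let* x' := pm m N K' x.2 (mapE (fun s => take t (drop t s)) y) in
    let* P := mulM (mulp p eps z pinv K) m m m x'.1 x.1 in
    Ret (mapE (take (2 * t).+1) P, x'.2)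
  else gauss m N lam r.

End Programs.

Section Specs.
Variable F : fieldType.

Definition toM m N (A : seq (seq (seq F))) : 'M[{poly F}]_(m, N) :=
  \matrix_(i < m, j < N) Poly (ent A i j).

Definition bnd m N (S : nat) (A : seq (seq (seq F))) : Prop :=
  forall i j, (i < m)%N -> (j < N)%N -> (size (ent A i j) <= S)%N.

Definition lamf m (lam : seq nat) : {ffun 'I_m -> nat} := [ffun i : 'I_m => nth 0%N lam i].

Lemma spec_mulM mul T m n N S1 S2 A B :
  (forall a b, (size a <= S1)%N -> (size b <= S2)%N ->
    spec (mul a b) (fun r => (size r <= size a + size b)%N /\
      Poly r = Poly a * Poly b) T) ->
  bnd m n S1 A -> bnd n N S2 B ->
  spec (mulM mul m n N A B) (fun R => [/\ size R = m,
     forall i, (i < m)%N -> size (nth [::] R i) = N,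
     bnd m N (S1 + S2) R & toM m N R = toM m n A *m toM n N B])
   (m * (N * (n * (T + (S1 + S2))))).
Proof.
move=> mulP bA bB.
pose Qe i j r := (size r <= S1 + S2)%N /\
   Poly r = \sum_(k < n) Poly (ent A i k) * Poly (ent B k j).
pose Qr i R := size R = N /\ forall j, (j < N)%N -> Qe i j (nth [::] R j).
apply: (spec_weaken (spec_tabM [::] (Q := Qr) (c := N * (n * (T + (S1 + S2)))) _)) => //.
  move=> i hi; apply: spec_tabM => j hj.
  pose I k r := (size r <= S1 + S2)%N /\
     Poly r = \sum_(k < k) Poly (ent A i k) * Poly (ent B k j).
  apply: (spec_loopM (I := I)); first by split; rewrite ?big_ord0.
  move=> k acc hk [sacc Pacc].
  have sa := bA i k hi hk; have sb := bB k j hk hj.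
  apply: (spec_bind (c2 := S1 + S2) (mulP _ _ sa sb)) => // t [st Pt].
  apply: (spec_weaken (spec_addl _ _)) => [r [Pr sr]|].
    split; last by rewrite Pr Pacc Pt big_ord_recr.
    rewrite sr geq_max sacc (leq_trans st) //; exact: leq_add.
  exact: leq_trans (geq_minl _ _) sacc.
move=> R [sR RP]; split => //.
- by move=> i hi; case: (RP i hi).
- by move=> i j hi hj; case: (RP i hi) => _ h; case: (h j hj).
- apply/matrixP => i j; rewrite !mxE.
  case: (RP i (ltn_ord i)) => _ h; case: (h j (ltn_ord j)) => _ E.
  by rewrite /ent E; apply: eq_bigr => k _; rewrite !mxE.
Qed.

Lemma ent_mapE f (A : seq (seq (seq F))) i j : f [::] = [::] ->
  ent (mapE f A) i j = f (ent A i j).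
Proof.
move=> f0; rewrite /ent /mapE.
case: (ltnP i (size A)) => hi; last first.
  by rewrite (nth_default _ hi) [nth [::] (map _ _) i]nth_default ?size_map // !nth_nil f0.
rewrite (nth_map [::]) //.
case: (ltnP j (size (nth [::] A i))) => hj; first by rewrite (nth_map [::]).
by rewrite (nth_default _ hj) f0 nth_default ?size_map.
Qed.

Lemma argminP lam c cs : argmin lam c cs \in c :: cs /\
  forall i, i \in c :: cs -> (lam (argmin lam c cs) <= lam i)%N.
Proof.
elim: cs => [|a cs [IH1 IH2]] /=; first by rewrite inE; split => // i; rewrite inE => /eqP ->.
case: leqP => h; split.
- by rewrite !inE eqxx orbT.
- move=> i; rewrite !inE => /or3P[/eqP ->|/eqP ->//|hi].
    by apply: leq_trans h (IH2 _ _); rewrite inE eqxx.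
  by apply: leq_trans h (IH2 _ _); rewrite inE hi orbT.
- by move: IH1; rewrite !inE => /orP[->|->]; rewrite ?orbT.
- move=> i; rewrite !inE => /or3P[/eqP ->|/eqP ->|hi]; last by apply: IH2; rewrite inE hi orbT.
    by apply: IH2; rewrite inE eqxx.
  exact: ltnW.
Qed.

(** * Gaussian elimination of the constant terms *)

Section Gauss.
Variables (m N : nat) (lam : seq nat) (L : 'M[F]_(m, N.+1)).
Let n := N.+1.

Definition rowof (st : seq (bool * seq F)) (i : nat) : seq F := (nth (false, [::]) st i).2.
Definition used (st : seq (bool * seq F)) (i : nat) : bool := (nth (false, [::]) st i).1.
Definition Lst st : 'M[F]_(m, n) := \matrix_(i, j) nth 0 (rowof st i) j.
Definition Cst st : 'M[F]_m := \matrix_(i, j) nth 0 (rowof st i) (n + j).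

(** The [c] rightmost columns have been treated. The lower bound on old pivots separates them from
    the next one, in column [n - c.+1]. *)
Definition ginv (c : nat) (st : seq (bool * seq F)) : Prop :=
  [/\ forall i, (i < m)%N -> size (rowof st i) = (n + m)%N,
      Lst st = Cst st *m L /\ Cst st \in unitmx,
      forall i j, Cst st i j != 0 -> (nth 0%N lam j <= nth 0%N lam i)%N,
      exists piv : 'I_m -> 'I_n,
        (forall i : 'I_m, used st i -> [/\ (n - c <= piv i)%N, Lst st i (piv i) != 0 &
           forall j : 'I_n, (piv i < j)%N -> Lst st i j = 0]) /\
        (forall i i' : 'I_m, used st i -> used st i' -> piv i = piv i' -> i = i')
    & forall (i : 'I_m) (j : 'I_n), ~~ used st i -> (n - c <= j)%N -> Lst st i j = 0].

Lemma spec_gauss_col c st : (c < n)%N -> ginv c st ->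
  spec (gauss_col 0 m lam (n - c.+1) st) (ginv c.+1) (m + m * (2 * (n + m)).+1).
Proof.
move=> hc [sz [LC Cu] tri [piv [pivP inj]] zero].
have hq : (n - c.+1 < n)%N by lia.
pose q : 'I_n := Ordinal hq.
pose cd (i : nat) := (nth 0 (rowof st i) q != 0) && ~~ used st i.
apply: (spec_bind (c1 := m) (c2 := m * (2 * (n + m)).+1)
  (Q := fun r => size r = m /\ forall i, (i < m)%N -> nth false r i = cd i)
  (spec_weaken (spec_tabM false (Q := fun i b => b = cd i) (c := 1) _)
     (fun _ h => h) _)) => //.
  by rewrite muln1.
move=> cand [sc candP].
have hcs i : (i \in [seq i <- iota 0 m | nth false cand i]) = (i < m)%N && cd i.
  by rewrite mem_filter mem_iota add0n /= andbC; case: ltnP => // /candP ->.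
case: [seq i <- iota 0 m | nth false cand i] hcs => [|a cs] hcs.
  apply: spec_ret; split => //.
    exists piv; split => // i ui; have [h1 h2 h3] := pivP i ui; split => //; lia.
  move=> i j ui hj; have [e|ne] := eqVneq (j : nat) (n - c.+1)%N; last by apply: zero => //; lia.
  have := hcs i; rewrite in_nil ltn_ord /= /cd ui andbT => /esym /negbFE /eqP.
  by rewrite mxE e.
have [i0in i0min] := argminP (nth 0%N lam) a cs.
set i0 := argmin _ a cs in i0in i0min *.
have := i0in; rewrite hcs => /andP[hi0 /andP[pv0 ui0]].
pose I0 : 'I_m := Ordinal hi0.
pose f (i : nat) := if cd i && (i != i0) then nth 0 (rowof st i) q / nth 0 (rowof st i0) q else 0.
pose R i (x : bool * seq F) := [/\ x.1 = used st i || (i == i0),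
   size x.2 = (n + m)%N & forall j, x.2`_j = nth 0 (rowof st i) j - f i * nth 0 (rowof st i0) j].
apply: (spec_weaken (spec_tabM (false, [::]) (Q := R) (c := (2 * (n + m)).+1) _)) => //.
  move=> i hi; rewrite candP //; rewrite /R /f; case: ifP => [/andP[ci ii0]|_]; last first.
    by apply: spec_ret; split => //=; [apply: sz|move=> j; rewrite mul0r subr0].
  apply: spec_op => /=.
  apply: (spec_bind (c1 := n + m) (c2 := n + m) (spec_weaken (spec_scalel _ _) (fun _ h => h) _)).
  - by rewrite -/(rowof st i0) sz.
  - move=> s [Ps ss]; rewrite -/(rowof st i0) sz // in ss.
    apply: (spec_bind (c1 := n + m) (c2 := 0) (spec_weaken (spec_subl _ _) (fun _ h => h) _)).
    + by rewrite ss.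
    + move=> r [Pr sr]; apply: spec_ret; split => /=.
      * by rewrite (negPf ii0) orbF.
      * by rewrite sr ss -/(rowof st i) sz // maxnn.
      * move=> j; have := congr1 (fun p : {poly F} => p`_j) Pr.
        by rewrite Ps coefB coefCM !coef_Poly.
    + by rewrite addn0.
  - by rewrite mul2n addnn.
move=> st' [sst' stP].
have fI0 : f i0 = 0 by rewrite /f eqxx andbF.
pose fv : 'cV[F]_m := \col_i f i.
pose T : 'M[F]_m := 1%:M - fv *m delta_mx (0 : 'I_1) I0.
have TE k (A : 'M[F]_(m, k)) i j : (T *m A) i j = A i j - f i * A I0 j.
  rewrite mulmxBl mul1mx -mulmxA -rowE !mxE big_ord1.
  by rewrite !mxE.
(* [f] vanishes at the pivot row, so the rank-one correction in [T] squares to zero and the inverse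
   only changes its sign. *)
have Tu : T \in unitmx.
  suff : T *m (1%:M + fv *m delta_mx (0 : 'I_1) I0) = 1%:M by move/mulmx1_unit => [].
  apply/matrixP => i j; rewrite TE !mxE !big_ord1 !mxE fI0 !mul0r addr0 !eqxx /=.
  have -> : (I0 == j) = (j == I0) by rewrite eq_sym.
  by rewrite addrK.
have Lst' : Lst st' = T *m Lst st.
  apply/matrixP => i j; rewrite TE !mxE.
  by have [_ _ ->] := stP i (ltn_ord i).
have Cst' : Cst st' = T *m Cst st.
  apply/matrixP => i j; rewrite TE !mxE.
  by have [_ _ ->] := stP i (ltn_ord i).
have u' (i : 'I_m) : used st' i = used st i || (i == I0).
  by have [h _ _] := stP i (ltn_ord i); rewrite -val_eqE; exact: h.
have LI0 : Lst st I0 q != 0 by rewrite mxE.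
have fL (i : 'I_m) : used st i -> f i = 0 by rewrite /f /cd => ->; rewrite andbF.
have rowI0 : forall j : 'I_n, (q < j)%N -> Lst st I0 j = 0.
  move=> j hj; apply: zero => //; move: hj => /=; lia.
split.
- by move=> i hi; have [_ -> _] := stP i hi.
- split; first by rewrite Lst' Cst' LC mulmxA.
  by rewrite Cst' unitmx_mul Tu.
- move=> i j; rewrite Cst' TE.
  have [->|c1] := eqVneq (Cst st i j) 0; last by move=> _; apply: tri.
  rewrite sub0r oppr_eq0 mulf_eq0 negb_or => /andP[fi cj].
  apply: leq_trans (tri _ _ cj) _ => /=; apply: i0min.
  rewrite hcs ltn_ord /=; move: fi; rewrite /f; case: ifP => [/andP[] //|].
  by rewrite eqxx.
- exists (fun i => if i == I0 then q else piv i); split.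
    move=> i; rewrite u'; have [-> _|iI0] := eqVneq i I0.
      rewrite Lst' TE /= fI0 mul0r subr0; split => //.
      by move=> j hj; rewrite TE /= fI0 mul0r subr0 rowI0.
    rewrite orbF => ui; have [h1 h2 h3] := pivP i ui.
    split; first by lia.
      by rewrite Lst' TE fL // mul0r subr0.
    by move=> j hj; rewrite Lst' TE fL // mul0r subr0 h3.
  move=> i i'; rewrite !u'.
  have [->|iI0] := eqVneq i I0; have [->|i'I0] := eqVneq i' I0 => //.
  + by rewrite orbF => _ ui' e; have [] := pivP i' ui'; rewrite -e /=; lia.
  + by rewrite orbF => ui _ e; have [] := pivP i ui; rewrite e /=; lia.
  + by rewrite !orbF; apply: inj.
- move=> i j; rewrite u' negb_or => /andP[ui iI0] hj.
  rewrite Lst' TE; have [e|ne] := eqVneq (j : nat) (n - c.+1)%N; last first.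
    rewrite zero ?rowI0 ?mulr0 ?subr0 //=; lia.
  have -> : j = q by apply: val_inj.
  rewrite /f; have -> : (i != i0 :> nat) by apply: contra iI0 => /eqP h; apply/eqP; apply: val_inj.
  rewrite andbT /cd ui andbT; case: ifP => [h|/negbFE /eqP h].
    by rewrite !mxE /= divfK ?subrr.
  by rewrite !mxE h mul0r subr0.
Qed.

End Gauss.

End Specs.

(** * Correctness and cost of divide and conquer *)

Section DivideConquer.
Variable F : fieldType.

Lemma spec_gauss m N lam (r : seq (seq (seq F))) : spec (gauss 0 1 m N.+1 lam r)
  (fun x => [/\ size x.2 = m, bnd m m 2 x.1
     & forall r0 : 'M[{poly F}]_(m, N.+1),
       (forall i j, take_poly 1 (r0 i j) = take_poly 1 (toM m N.+1 r i j)) ->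
       exists r', chain 1 (lamf m lam) r0 (toM m m x.1) (lamf m x.2) r'])
  (N.+1 * (m + m * (2 * (N.+1 + m)).+1)).
Proof.
rewrite /gauss; set n := N.+1.
pose L := lead (toM m n r).
set st0 := mkseq _ m.
have rst0 i : (i < m)%N -> rowof st0 i = mkseq (fun j => nth 0 (ent r i j) 0) n
    ++ mkseq (fun j => if i == j then 1 else 0) m.
  by move=> hi; rewrite /rowof nth_mkseq.
have g0 : ginv lam L 0 st0.
  have C1 : Cst m N st0 = 1%:M.
    apply/matrixP => i j; rewrite !mxE rst0 // nth_cat size_mkseq ltnNge leq_addr /=.
    rewrite addnC addnK nth_mkseq //; have [->|h] := eqVneq i j; first by rewrite eqxx.
    by case: eqP => // e; case/eqP: h; apply: val_inj.
  have u0 (i : 'I_m) : used st0 i = false by rewrite /used nth_mkseq.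
  split.
  - by move=> i hi; rewrite rst0 // size_cat !size_mkseq.
  - rewrite C1 mul1mx unitmx1; split => //.
    apply/matrixP => i j; rewrite !mxE rst0 // nth_cat size_mkseq ltn_ord nth_mkseq //.
    by rewrite coef_Poly.
  - move=> i j; rewrite C1 mxE; have [->|_] := eqVneq i j => //.
    by rewrite mulr0n eqxx.
  - by exists (fun=> ord0); split => [i|i i']; rewrite u0.
  - by move=> i j _; rewrite subn0 leqNgt ltn_ord.
apply: (spec_bind (c1 := n * (m + m * (2 * (n + m)).+1)) (c2 := 0)
  (spec_loopM (I := ginv lam L) g0 _)); last by rewrite addn0.
  by move=> c st hc; apply: spec_gauss_col.
move=> st [sz [LC Cu] tri [piv [pivP inj]] zero]; apply: spec_ret; split => /=.
- by rewrite size_mkseq.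
- move=> i j hi hj; rewrite /ent !nth_mkseq // size_cat size_nseq /=.
  by case: (nth _ _ _).1.
move=> r0 hr0; pose b (i : 'I_m) := used st i.
have leadE : lead r0 = L.
  apply/matrixP => i j; have := congr1 (fun p : {poly F} => p`_0) (hr0 i j).
  by rewrite !coef_take_poly /= !mxE.
have EE : toM m m (mkseq (fun i => mkseq (fun j =>
         nseq (nth (false, [::]) st i).1 0 ++ [:: nth 0 (nth (false, [::]) st i).2 (n + j)]) m) m)
    = Emx (Cst m N st) b.
  apply/matrixP => i j; rewrite !mxE /ent !nth_mkseq // Poly_shift Poly_cons mul0r add0r.
  by rewrite mulrC.
rewrite EE.
have st_step : step (lamf m lam) (lead r0) (Cst m N st) b.
  rewrite leadE; split => //.
  - by move=> i j /tri; rewrite !ffunE.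
  - by move=> i j bi; rewrite -LC zero // subnn.
  - exists piv; split => // i bi; rewrite -LC; have [_ h2 h3] := pivP i bi; by split.
pose r1 : 'M[{poly F}]_(m, n) := map_mx (drop_poly 1) (Emx (Cst m N st) b *m r0).
have E1 : Emx (Cst m N st) b *m r0 = 'X *: r1.
  apply/matrixP => i j; rewrite [in RHS]mxE [r1 i j]mxE.
  set w := (_ *m _) i j.
  have w0 : w`_0 = 0.
    rewrite /w mxE coef_sum.
    have [bi|bi] := boolP (b i).
      rewrite big1 // => k _; rewrite mxE bi expr1 -mulrA coefCM coefXM eqxx mulr0 //.
    rewrite -[RHS](zero i j bi) ?subnn // LC -leadE mxE; apply: eq_bigr => k _.
    by rewrite mxE (negPf bi) expr0 mulr1 coefCM !mxE.
  rewrite -[LHS](poly_take_drop 1) expr1 mulrC.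
  have -> : take_poly 1 w = 0.
    by apply/polyP => -[|k]; rewrite coef_take_poly coef0.
  by rewrite add0r.
exists r1; rewrite -[Emx _ _]mul1mx; apply: chainS st_step E1 _.
have -> : lamf m (mkseq (fun i => (nth 0 lam i + (nth (false, [::]) st i).1)%N) m)
        = [ffun i => lamf m lam i + b i]%N.
  by apply/ffunP => i; rewrite !ffunE nth_mkseq.
exact: chain0.
Qed.

Section PM.
Variables (p eps : nat) (pinv : F).
Hypothesis peps : (p = 2 /\ eps = 1%N) \/ (p = 3 /\ eps = 0%N).
Hypothesis pinvP : pinv * p%:R = 1.

(** Superlinearity: each level of the recursion in [pm] costs at most as much as the top one, whence
    the factor [K.+1] in [spec_pm]. *)
Lemma mcostS K : (2 * mcost K <= mcost K.+1)%N.
Proof.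
rewrite /mcost expnS -mulnA leq_mul2l /= leq_mul2l /=; apply/orP; right.
by apply: leq_mul => //; rewrite ltnS leq_up_log.
Qed.

Lemma mcost_gt0 K : (2 ^ K <= mcost K)%N.
Proof. by rewrite /mcost leq_pmulr. Qed.

Lemma spec_mulMp K m n N S1 S2 A B : (S1 <= 2 ^ K)%N -> (S2 <= 2 ^ K)%N ->
  bnd m n S1 A -> bnd n N S2 B ->
  spec (mulM (mulp p eps 0 pinv K) m n N A B) (fun R => [/\ size R = m,
     forall i, (i < m)%N -> size (nth [::] R i) = N,
     bnd m N (S1 + S2) R & toM m N R = toM m n A *m toM n N B])
   (m * (N * (n * (5 * (4000 * mcost K))))).
Proof.
move=> h1 h2 bA bB; apply: (spec_weaken (spec_mulM (T := 4 * (4000 * mcost K)) _ bA bB)) => //.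
  move=> a b ha hb; apply: spec_mulp => //; [exact: leq_trans ha h1|exact: leq_trans hb h2].
rewrite !leq_mul2l; apply/orP; right; apply/orP; right; apply/orP; right.
have := mcost_gt0 K; lia.
Qed.

Lemma spec_pm m N K lam (r : seq (seq (seq F))) : (N.+1 <= m)%N -> bnd m N.+1 (2 ^ K) r ->
  spec (pm 0 1 p eps pinv m N.+1 K lam r)
    (fun x => [/\ size x.2 = m, bnd m m (2 ^ K).+1 x.1
     & forall r0 : 'M[{poly F}]_(m, N.+1),
       (forall i j, take_poly (2 ^ K) (r0 i j) = take_poly (2 ^ K) (toM m N.+1 r i j)) ->
       exists r', chain (2 ^ K) (lamf m lam) r0 (toM m m x.1) (lamf m x.2) r'])
    (m ^ 3 * (10 * (4000 * (K.+1 * mcost K)))).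
Proof.
move=> Nm; elim: K lam r => [|K IH] lam r br.
  apply: (spec_weaken (spec_gauss m N lam r)) => //.
  have : (N.+1 * (m + m * (2 * (N.+1 + m)).+1) <= m * (m + m * (2 * (m + m)).+1))%N.
    apply: leq_mul => //; rewrite leq_add2l leq_mul2l; apply/orP; right; lia.
  move=> /leq_trans; apply; rewrite /mcost up_log1 /=; nia.
set t := (2 ^ K)%N.
have t2 : (2 ^ K.+1 = t + t)%N by rewrite expnS mul2n addnn.
have t0 : (0 < t)%N by rewrite expn_gt0.
rewrite t2 in br *.
have brt : bnd m N.+1 t (mapE (take t) r).
  by move=> i j hi hj; rewrite ent_mapE // size_take; case: ltnP.
pose c1 := (m ^ 3 * (10 * (4000 * (K.+1 * mcost K))))%N.
pose c2 := (m ^ 3 * (5 * (4000 * mcost K.+1)))%N.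
have m3 k : (k <= m)%N -> (m * (k * (m * (5 * (4000 * mcost K.+1)))) <= c2)%N.
  move=> km; have -> : c2 = (m * (m * (m * (5 * (4000 * mcost K.+1)))))%N by rewrite /c2; ring.
  by rewrite leq_mul2l leq_mul2r km !orbT.
apply: (spec_bind (c1 := c1) (c2 := c2 + (c1 + c2)) (IH lam _ brt)); last first.
  have := leq_mul (leqnn (m ^ 3)) (mcostS K); rewrite /c1 /c2.
  by move: (m ^ 3)%N (mcost K) (mcost K.+1) => x y w; nia.
move=> [P1 lam1] /= [sl1 bP1 ch1].
apply: (spec_bind (c1 := c2) (c2 := c1 + c2)
  (spec_weaken (spec_mulMp (S1 := t.+1) (S2 := t + t) _ _ bP1 br) (fun _ h => h) (m3 _ Nm))).
- by rewrite t2 -addn1 leq_add2l.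
- by rewrite t2.
move=> Y [_ _ _ EY].
have br1 : bnd m N.+1 t (mapE (fun s => take t (drop t s)) Y).
  by move=> i j hi hj; rewrite ent_mapE // size_take; case: ltnP.
apply: (spec_bind (c1 := c1) (c2 := c2) (IH lam1 _ br1)) => // -[P2 lam2] /= [sl2 bP2 ch2].
apply: (spec_bind (c1 := c2) (c2 := 0)
  (spec_weaken (spec_mulMp (S1 := t.+1) (S2 := t.+1) _ _ bP2 bP1) (fun _ h => h) (m3 _ (leqnn m)))).
- by rewrite t2 -addn1 leq_add2l.
- by rewrite t2 -addn1 leq_add2l.
- move=> P [_ _ _ EP]; apply: spec_ret; split => //=.
    move=> i j hi hj; rewrite ent_mapE // mul2n -addnn size_take.
    by case: ltnP.
  move=> r0 hr0.
  have [r1 c1P] : exists r', chain t (lamf m lam) r0 (toM m m P1) (lamf m lam1) r'.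
    apply: ch1 => i j; rewrite [in RHS]mxE ent_mapE // Poly_take.
    have := congr1 (take_poly t) (hr0 i j); rewrite [in X in _ = X -> _]mxE.
    have TT (q : {poly F}) : take_poly t (take_poly (t + t) q) = take_poly t q.
      apply/polyP => k; rewrite !coef_take_poly; case: ltnP => // hk.
      by rewrite (leq_trans hk) // leq_addr.
    have TT' (q : {poly F}) : take_poly t (take_poly t q) = take_poly t q.
      by rewrite take_poly_id // size_take_poly.
    by rewrite !TT TT'.
  have E1 := chain_eq c1P.
  have [r2 c2P] : exists r', chain t (lamf m lam1) r1 (toM m m P2) (lamf m lam2) r'.
    apply: ch2 => i j; rewrite [in RHS]mxE ent_mapE // Poly_take Poly_drop.
    have -> : Poly (ent Y i j) = (toM m m P1 *m toM m N.+1 r) i j by rewrite -EY mxE.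
    have -> : r1 i j = drop_poly t ((toM m m P1 *m r0) i j).
      by rewrite E1 mxE mulrC drop_polyMXn_id.
    (* Coefficients of [P1 * r0] below [t + t] depend only on those of [r0] below [t + t], where
       [r0] agrees with [r]. *)
    apply/polyP => k; rewrite !coef_take_poly; case: ltnP => // hk.
    rewrite !coef_drop_poly !mxE !coef_sum; apply: eq_bigr => k' _.
    rewrite !coefM; apply: eq_bigr => e _; congr (_ * _).
    have := congr1 (fun q : {poly F} => q`_(k + t - e)) (hr0 k' j).
    rewrite !coef_take_poly.
    by have -> : (k + t - e < t + t)%N by lia.
  have C := chain_cat c1P c2P.
  exists r2; rewrite (_ : toM m m _ = toM m m P2 *m toM m m P1) //.
  apply/matrixP => i j; rewrite [in LHS]mxE ent_mapE // Poly_take -EP [in RHS]mxE.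
  (* By [chain_size] the product has degree at most [2 * t], so the truncation only removes trailing
     zeros of the lists. *)
  apply: take_poly_id.
  have := chain_size C i j; rewrite -EP mxE mul2n -addnn; exact.
- by rewrite addn0.
- exact: leqnn.
Qed.

End PM.
End DivideConquer.

(** * Leading positions *)

Section LeadingPosition.
Variable F : fieldType.

Definition LPspec N (v : 'rV[{poly F}]_N) (d : nat) (q : 'I_N) : Prop :=
  [/\ size (v ord0 q) = d.+1, forall j, (size (v ord0 j) <= d.+1)%N
    & forall j : 'I_N, (q < j)%N -> (size (v ord0 j) <= d)%N].

Lemma LPspecE N (v : 'rV[{poly F}]_N) d q : LPspec v d q -> rdeg v = d.+1 /\ LP v = q.
Proof.
case=> sq le gt; have rE : rdeg v = d.+1.
  apply/eqP; rewrite eqn_leq; apply/andP; split; first by apply/bigmax_leqP => j _.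
  by rewrite -sq /rdeg (leq_bigmax_cond (F := fun j => size (v ord0 j))).
split => //; apply/eqP; rewrite eqn_leq; apply/andP; split; last first.
  by rewrite /LP (leq_bigmax_cond (F := fun j : 'I_N => j : nat)) // rE sq.
apply/bigmax_leqP => j; rewrite rE => /eqP sj; rewrite leqNgt; apply/negP => /gt.
by rewrite sj ltnn.
Qed.

Lemma LPspec_inj N (v : 'rV[{poly F}]_N) d d' q q' :
  LPspec v d q -> LPspec v d' q' -> d = d' /\ q = q'.
Proof.
move=> /LPspecE[e1 e2] /LPspecE[e1' e2'].
by split; [apply: succn_inj; rewrite -e1 e1'|apply: val_inj; rewrite /= -e2 e2'].
Qed.

Lemma LPspec_ex N (v : 'rV[{poly F}]_N) : v != 0 -> exists d q, LPspec v d q.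
Proof.
move=> v0; have [j0 vj0] : exists j, v ord0 j != 0.
  apply/existsP; apply: contraNT v0; rewrite negb_exists => /forallP h.
  by apply/eqP/rowP => i; rewrite mxE; apply/eqP; rewrite -[_ == _]negbK.
case: (@arg_maxnP _ j0 xpredT (fun j => size (v ord0 j)) isT) => i _ imax.
case: (@arg_maxnP _ i (fun j => size (v ord0 j) == size (v ord0 i)) (fun j => j : nat) (eqxx _)) => q /eqP sq qmax.
have s0 : (0 < size (v ord0 i))%N.
  by apply: leq_trans (imax j0 isT); rewrite size_poly_gt0.
exists (size (v ord0 i)).-1, q; rewrite /LPspec prednK //; split => // j; first exact: imax.
move=> qj; rewrite -ltnS prednK // ltn_neqAle (imax j isT : (_ <= _)%N) andbT.
by apply: contraL qj => /qmax h; rewrite -leqNgt.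
Qed.

(** [key] orders the terms of the combination by degree and then by leading position. Distinct
    leading positions make its maximum unique, so the leading term of that row is not cancelled. *)
Lemma predictable_degree m N (B : 'M[{poly F}]_(m, N)) (d : 'I_m -> nat) (q : 'I_m -> 'I_N)
    (c : 'rV_m) :
  (forall i, LPspec (row i B) (d i) (q i)) -> injective q -> c != 0 ->
  exists i, c ord0 i != 0 /\ LPspec (c *m B) ((size (c ord0 i)).-1 + d i) (q i).
Proof.
move=> BP inj c0; have [i0 ci0] : exists i, c ord0 i != 0.
  apply/existsP; apply: contraNT c0; rewrite negb_exists => /forallP h.
  by apply/eqP/rowP => i; rewrite mxE; apply/eqP; rewrite -[_ == _]negbK.
have Bs i j : (size (B i j) <= (d i).+1)%N by have [_ + _] := BP i; move/(_ j); rewrite mxE.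
have Bg i (j : 'I_N) : (q i < j)%N -> (size (B i j) <= d i)%N.
  by have [_ _ +] := BP i; move/(_ j); rewrite mxE.
have Bq i : size (B i (q i)) = (d i).+1 by have [+ _ _] := BP i; rewrite mxE.
pose key i := ((size (c ord0 i) + d i) * N + q i)%N.
case: (@arg_maxnP _ i0 (fun i => c ord0 i != 0) key ci0) => i ci imax.
have imax' k : c ord0 k != 0 -> (key k <= key i)%N := imax k.
exists i; split => //; set D := (size (c ord0 i) + d i)%N.
have si : (0 < size (c ord0 i))%N by rewrite size_poly_gt0.
have -> : ((size (c ord0 i)).-1 + d i = D.-1)%N by rewrite /D -{2}(prednK si) addSn.
have D0 : (0 < D)%N by rewrite addn_gt0 si.
have kD k : c ord0 k != 0 -> (size (c ord0 k) + d k <= D)%N /\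
    ((size (c ord0 k) + d k = D)%N -> (q k <= q i)%N).
  move=> /imax'; rewrite /key -/D; have := ltn_ord (q i); have := ltn_ord (q k).
  by move: (size (c ord0 k) + d k)%N => x h1 h2 h3; split; nia.
have term k j : (size (c ord0 k * B k j)%R <= D)%N.
  have [->|ck] := eqVneq (c ord0 k) 0; first by rewrite mul0r size_poly0.
  have [h _] := kD k ck; apply: leq_trans (size_polyMleq _ _) (leq_trans _ h).
  have := Bs k j; move: (size (B k j)) (size (c ord0 k)) => x y; lia.
have termlt k (j : 'I_N) : c ord0 k != 0 -> ((size (c ord0 k) + d k < D)%N \/ (q k < j)%N) ->
    (size (c ord0 k * B k j)%R < D)%N.
  move=> ck h; have [h1 h2] := kD k ck.
  have [->|Bk] := eqVneq (B k j) 0; first by rewrite mulr0 size_poly0.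
  rewrite size_mul //.
  have : (0 < size (c ord0 k))%N by rewrite size_poly_gt0.
  case: h => h.
    have := Bs k j; move: h; move: (size (B k j)) (size (c ord0 k)) => x y; lia.
  have := Bg k j h; move: h1; move: (size (B k j)) (size (c ord0 k)) => x y; lia.
rewrite /LPspec prednK //; split.
- rewrite mxE (bigD1 i) //= size_polyDl.
    rewrite size_mul -?size_poly_gt0 ?Bq //.
    by rewrite addnS /=.
  rewrite size_mul -?size_poly_gt0 ?Bq // addnS /= -/D.
  apply: leq_ltn_trans (size_sum _ _ _) _.
  rewrite -(prednK D0) ltnS; apply/bigmax_leqP => k ki; rewrite -ltnS prednK //.
  have [->|ck] := eqVneq (c ord0 k) 0; first by rewrite mul0r size_poly0.
  apply: termlt => //; have [h1 h2] := kD k ck.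
  have [e|ne] := eqVneq (size (c ord0 k) + d k)%N D; last by left; rewrite ltn_neqAle ne.
  right; rewrite ltn_neqAle h2 // andbT; apply: contra ki => /eqP /val_inj /inj ->.
  by rewrite eqxx.
- move=> j; rewrite mxE (leq_trans (size_sum _ _ _)) //.
  by apply/bigmax_leqP => k _.
- move=> j hj; rewrite mxE (leq_trans (size_sum _ _ _)) //.
  apply/bigmax_leqP => k _; rewrite -ltnS prednK //.
  have [->|ck] := eqVneq (c ord0 k) 0; first by rewrite mul0r size_poly0.
  apply: termlt => //; have [h1 h2] := kD k ck.
  have [e|ne] := eqVneq (size (c ord0 k) + d k)%N D; last by left; rewrite ltn_neqAle ne.
  by right; apply: leq_ltn_trans (h2 e) hj.
Qed.

Lemma mulW (k N : nat) m (B : 'M[{poly F}]_(m, N.+1)) i j :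
  (B *m Wmat F k N) i j = B i j * 'X^(j * (k - 1)).
Proof. by rewrite /Wmat mul_mx_diag !mxE. Qed.

Lemma mulW_inj (k N : nat) m (B : 'M[{poly F}]_(m, N.+1)) :
  B *m Wmat F k N = 0 -> B = 0.
Proof.
move=> /matrixP h; apply/matrixP => i j; have := h i j; rewrite mulW !mxE.
by move/eqP; rewrite mulf_eq0 expf_eq0 polyX_eq0 andbF orbF => /eqP.
Qed.

End LeadingPosition.

(** * The interpolation module *)

Section Bivariate.
Variables (F : fieldType).
Implicit Types P Q : {poly {poly F}}.

Definition vord (s : nat) P : Prop := forall u v, (u + v < s)%N -> (P`_v)`_u = 0.

Lemma vordD s P Q : vord s P -> vord s Q -> vord s (P + Q).
Proof. by move=> hP hQ u v h; rewrite !coefD hP ?hQ ?addr0. Qed.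

Lemma vord0 s : vord s 0.
Proof. by move=> u v _; rewrite !coef0. Qed.

Lemma vordM s t P Q : vord s P -> vord t Q -> vord (s + t) (P * Q).
Proof.
move=> hP hQ u v h; rewrite coefM coef_sum big1 // => i _; rewrite coefM big1 // => j _.
case: (ltnP (j + i) s) => h1; first by rewrite hP ?mul0r.
rewrite hQ ?mulr0 //; have := ltn_ord i; have := ltn_ord j; lia.
Qed.

Lemma vordMl s P Q : vord s P -> vord s (Q * P).
Proof. by move=> h; rewrite -[s]add0n; apply: vordM. Qed.

Lemma vordX P v : vord 1 P -> vord v (P ^+ v).
Proof.
move=> h; elim: v => [|v IH]; first by move=> ? ?.
by rewrite exprS -add1n; apply: vordM.
Qed.

Lemma vord_le s t P : (s <= t)%N -> vord t P -> vord s P.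
Proof. by move=> st h u v uv; apply: h; apply: leq_trans st. Qed.

(* [P] has [(1, w)]-weighted degree at most [d]. *)
Definition wb (w d : nat) P : Prop := forall j u, (d < u + j * w)%N -> (P`_j)`_u = 0.

Lemma wbD w d P Q : wb w d P -> wb w d Q -> wb w d (P + Q).
Proof. by move=> hP hQ u v h; rewrite !coefD hP ?hQ ?addr0. Qed.

Lemma wb0 w d : wb w d 0.
Proof. by move=> u v _; rewrite !coef0. Qed.

Lemma wb_le w d e P : (d <= e)%N -> wb w d P -> wb w e P.
Proof. by move=> de h j u hu; apply: h; apply: leq_ltn_trans hu. Qed.

Lemma wbM w d e P Q : wb w d P -> wb w e Q -> wb w (d + e) (P * Q).
Proof.
move=> hP hQ j u h; rewrite coefM coef_sum big1 // => i _; rewrite coefM big1 // => a _.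
case: (ltnP d (a + i * w)) => h1; first by rewrite hP ?mul0r.
rewrite hQ ?mulr0 //; have := ltn_ord i; have := ltn_ord a; nia.
Qed.

Lemma wb_sum w d (I : Type) (r : seq I) (p : pred I) (f : I -> {poly {poly F}}) :
  (forall i, p i -> wb w d (f i)) -> wb w d (\sum_(i <- r | p i) f i).
Proof. by move=> h; apply: big_ind; [exact: wb0|exact: wbD|exact: h]. Qed.

Lemma wbX w d P v : wb w d P -> wb w (v * d) (P ^+ v).
Proof.
move=> h; elim: v => [|v IH].
  rewrite mul0n expr0 => -[|j] u; rewrite ?mul0n ?addn0 => hu.
    by rewrite coef1 /= coef1; case: u hu.
  by rewrite coef1 /= coef0.
by rewrite exprS mulSn; apply: wbM.
Qed.

(** The shift as a ring morphism, so that orders of vanishing add under products. *)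
Definition sg (a b : F) : {rmorphism {poly {poly F}} -> {poly {poly F}}} :=
  comp_poly ('X + (b%:P)%:P) \o map_poly (comp_poly ('X + a%:P)).

Lemma sgC a b (c : {poly F}) : sg a b c%:P = (c \Po ('X + a%:P))%:P.
Proof. by rewrite /= map_polyC comp_polyC. Qed.

Lemma sgX a b : sg a b 'X = 'X + (b%:P)%:P.
Proof. by rewrite /= map_polyX comp_polyX. Qed.

Definition poly2 N (Q : 'rV[{poly F}]_N) : {poly {poly F}} :=
  \sum_(t < N) (Q ord0 t)%:P * 'X^t.

Lemma coef_poly2 N (Q : 'rV[{poly F}]_N) (j : 'I_N) : (poly2 Q)`_j = Q ord0 j.
Proof.
rewrite coef_sum (bigD1 j) //= coefCM coefXn eqxx mulr1 big1 ?addr0 // => i ij.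
by rewrite coefCM coefXn eq_sym [_ == _](negPf ij) mulr0.
Qed.

Lemma shiftedXY_sg N a b (Q : 'rV[{poly F}]_N) : shiftedXY a b Q = sg a b (poly2 Q).
Proof.
rewrite /shiftedXY /poly2 rmorph_sum; apply: eq_bigr => t _.
by rewrite rmorphM rmorphXn sgC sgX.
Qed.

Definition vec N P : 'rV[{poly F}]_N := \row_j P`_j.

Lemma vecK N P : (size P <= N)%N -> poly2 (vec N P) = P.
Proof.
move=> sP; rewrite /poly2 [RHS](_ : _ = \poly_(i < N) P`_i); last first.
  apply/polyP => i; rewrite coef_poly; case: ltnP => // h.
  by rewrite nth_default // (leq_trans sP).
by rewrite poly_def; apply: eq_bigr => i _; rewrite mxE mul_polyC.
Qed.

Lemma poly2_lin N (a : {poly F}) (Q Q' : 'rV[{poly F}]_N) :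
  poly2 (a *: Q + Q') = a%:P * poly2 Q + poly2 Q'.
Proof.
rewrite /poly2 mulr_sumr -big_split; apply: eq_bigr => i _.
by rewrite !mxE polyCD polyCM /=; ring.
Qed.

End Bivariate.

(** * Ideal membership and reduction of weighted degrees *)

Section Module.
Variables (F : fieldType) (n : nat) (alpha r' : 'I_n -> F).
Hypothesis alpha_inj : injective alpha.
Hypothesis n_gt0 : (0 < n)%N.

Definition inI (s : nat) (P : {poly {poly F}}) : Prop :=
  forall i, vord s (sg (alpha i) (r' i) P).

Lemma inM_inI s l (Q : 'rV[{poly F}]_l.+1) : inM alpha r' s Q <-> inI s (poly2 Q).
Proof. by split=> h i; have := h i; rewrite /vanishes_to shiftedXY_sg. Qed.

Lemma inID s P Q : inI s P -> inI s Q -> inI s (P + Q).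
Proof. by move=> hP hQ i; rewrite rmorphD; apply: vordD. Qed.

Lemma inI0 s : inI s 0.
Proof. by move=> i; rewrite rmorph0; apply: vord0. Qed.

Lemma inIMl s P Q : inI s P -> inI s (Q * P).
Proof. by move=> hP i; rewrite rmorphM; apply: vordMl. Qed.

Lemma inIM s t P Q : inI s P -> inI t Q -> inI (s + t) (P * Q).
Proof. by move=> hP hQ i; rewrite rmorphM; apply: vordM. Qed.

Lemma inIX P v : inI 1 P -> inI v (P ^+ v).
Proof. by move=> hP i; rewrite rmorphXn; apply: vordX. Qed.

Lemma inI_le s t P : (s <= t)%N -> inI t P -> inI s P.
Proof. by move=> st h i; apply: vord_le st (h i). Qed.

Lemma inM_lin s l (a : {poly F}) (Q Q' : 'rV[{poly F}]_l.+1) :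
  inM alpha r' s Q -> inM alpha r' s Q' -> inM alpha r' s (a *: Q + Q').
Proof.
move=> /inM_inI h /inM_inI h'; apply/inM_inI; rewrite poly2_lin.
exact: inID (inIMl _ h) h'.
Qed.

Lemma inM0 s l : inM alpha r' s (0 : 'rV[{poly F}]_l.+1).
Proof.
apply/inM_inI; rewrite /poly2 big1; first exact: inI0.
by move=> i _; rewrite mxE polyC0 mul0r.
Qed.

Lemma inM_mul s l m (c : 'rV[{poly F}]_m) (B : 'M_(m, l.+1)) :
  (forall i, inM alpha r' s (row i B)) -> inM alpha r' s (c *m B).
Proof.
move=> h; rewrite mulmx_sum_row; elim/big_ind: _ => [|x y hx hy|i _].
- exact: inM0.
- by rewrite -[x]scale1r; apply: inM_lin.
- by rewrite -[_ *: _]addr0; apply: inM_lin => //; apply: inM0.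
Qed.

Lemma inI_sum s (I : Type) (r : seq I) (p : pred I) (f : I -> {poly {poly F}}) :
  (forall i, p i -> inI s (f i)) -> inI s (\sum_(i <- r | p i) f i).
Proof. by move=> h; apply: big_ind; [exact: inI0|exact: inID|exact: h]. Qed.

Lemma interp_ex : exists2 R : {poly F}, (size R <= n)%N & forall i, R.[alpha i] = r' i.
Proof.
pose lag i : {poly F} := \prod_(j < n | j != i) ('X - (alpha j)%:P).
exists (\sum_i (r' i / (lag i).[alpha i]) *: lag i).
  rewrite (leq_trans (size_sum _ _ _)) //; apply/bigmax_leqP => i _.
  rewrite (leq_trans (size_scale_leq _ _)) // /lag.
  by rewrite -big_filter size_prod_XsubC size_filter -sum1_count sum1_card cardC1 card_ord prednK.
move=> i; rewrite horner_sum (bigD1 i) //= hornerZ divfK; last first.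
  rewrite /lag horner_prod; apply/prodf_neq0 => j ji; rewrite hornerXsubC subr_eq0.
  by apply: contra ji => /eqP /alpha_inj ->.
rewrite big1 ?addr0 // => j ji; rewrite hornerZ.
have -> : (lag j).[alpha i] = 0; last by rewrite mulr0.
rewrite /lag horner_prod (bigD1 i) 1?eq_sym //=.
by rewrite hornerXsubC subrr mul0r.
Qed.

Let G : {poly F} := \prod_(i < n) ('X - (alpha i)%:P).

Lemma size_G : size G = n.+1.
Proof. by rewrite size_prod_XsubC -[size _]count_predT -sum1_count sum1_card card_ord. Qed.

Lemma coef0_comp (a : F) (R : {poly F}) : (R \Po ('X + a%:P))`_0 = R.[a].
Proof. by rewrite -horner_coef0 horner_comp !hornerE. Qed.

Lemma inI_G : inI 1 G%:P.
Proof.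
move=> i [|u] [|v] //= _; rewrite -[comp_poly _ _]/(sg _ _ _) sgC coefC /= coef0_comp.
by rewrite /G horner_prod (bigD1 i) //= hornerXsubC subrr mul0r.
Qed.

Lemma inI_YR (R : {poly F}) : (forall i, R.[alpha i] = r' i) -> inI 1 ('X - R%:P).
Proof.
move=> hR i [|u] [|v] // _; rewrite rmorphB sgC sgX.
by rewrite !(coefD, coefN, coefX, coefC, coef0) /= coef0_comp hR add0r subrr.
Qed.

(** In the expansion in powers of [Y - R], terms with [v >= s] are dropped and the others have their
    coefficient reduced modulo [G^(s-v)]. The remainder contributes less than [(s-v) * n] and the
    power at most [v * (n-1)], where [w < n] bounds the weight of the variable [Y]. *)
Lemma weighted_reduce s w P : (0 < s)%N -> (w < n)%N ->
  exists2 Q, inI s (P - Q) & (size Q <= s)%N /\ wb w (s * n).-1 Q.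
Proof.
move=> s0 wn; have [R sR hR] := interp_ex.
set Y := 'X - R%:P; have hY : inI 1 Y by apply: inI_YR.
pose P1 := P \Po ('X + R%:P).
have PE : P = \sum_(v < size P1) (P1`_v)%:P * Y ^+ v.
  have -> : P = P1 \Po Y.
    by rewrite /P1 -comp_polyA comp_polyD comp_polyX comp_polyC /Y subrK comp_polyXr.
  by rewrite comp_polyE; apply: eq_bigr => v _; rewrite mul_polyC.
pose g v := G ^+ (s - v).
exists (\sum_(v < size P1 | (v < s)%N) (P1`_v %% g v)%:P * Y ^+ v).
  rewrite {1}PE (bigID (fun v : 'I__ => (v < s)%N)) /= addrAC -sumrB.
  apply: inID; apply: inI_sum.
    move=> v vs; rewrite -mulrBl -polyCB {1}(divp_eq P1`_v (g v)) addrK polyCM -mulrA.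
    apply: inIMl; rewrite -[s in inI s](subnK (ltnW vs)); apply: inIM; last exact: inIX.
    by rewrite /g polyC_exp; apply: inIX; apply: inI_G.
  move=> v; rewrite -leqNgt => sv; apply: inIMl.
  by apply: inI_le sv _; apply: inIX.
have sY v : (size (Y ^+ v) <= v.+1)%N.
  by rewrite /Y size_exp_XsubC.
split.
  rewrite (leq_trans (size_sum _ _ _)) //; apply/bigmax_leqP => v vs.
  rewrite mul_polyC (leq_trans (size_scale_leq _ _)) // (leq_trans (sY _)) //.
have wY : wb w n.-1 Y.
  move=> [|[|j]] u hu; rewrite /Y coefB coefX coefC /=.
  - by rewrite sub0r coefN nth_default ?oppr0 // (leq_trans sR) //; lia.
  - by rewrite subr0 coef1; case: u hu => //; lia.
  - by rewrite subr0 coef0.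
apply: wb_sum => v vs; have H := wbM (w := w) (d := ((s - v) * n).-1) (e := v * n.-1)
  (P := (P1`_v %% g v)%:P) _ (@wbX F w n.-1 Y v wY).
have sv : (0 < s - v)%N by rewrite subn_gt0.
apply: wb_le (H _).
  have e : (s * n = (s - v) * n + v * n)%N by rewrite -mulnDl subnK // ltnW.
  have : (0 < (s - v) * n)%N by rewrite muln_gt0 sv.
  have : (v * n.-1 <= v * n)%N by rewrite leq_mul2l leq_pred orbT.
  by rewrite e; lia.
move=> [|j] u; rewrite coefC /= ?coef0 // mul0n addn0 => hu.
apply: nth_default; have g0 : g v != 0.
  by rewrite expf_neq0 // -size_poly_gt0 size_G.
have sgv : (size (g v)).-1 = ((s - v) * n)%N by rewrite size_exp size_G mulnC.
have g1 : (0 < size (g v))%N by rewrite size_poly_gt0.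
have h : (size (P1`_v %% g v)%R < size (g v))%N by rewrite ltn_modp.
rewrite -ltnS; apply: leq_trans h _; rewrite -(prednK g1) sgv ltnS.
by move: hu; case: (_ * n)%N.
Qed.

Lemma monic_ex s l : (s <= l)%N ->
  exists2 P, inI s P & (size P <= l.+1)%N /\ P`_l = 1.
Proof.
move=> sl; have [R sR hR] := interp_ex.
exists ('X^(l - s) * ('X - R%:P) ^+ s).
  by apply: inIMl; apply: inIX; apply: inI_YR.
have E : size ('X^(l - s) * ('X - R%:P) ^+ s) = l.+1.
  rewrite size_monicM ?monicXn ?monic_neq0 ?monic_exp ?monicXsubC //.
  by rewrite size_polyXn size_exp_XsubC addnS addSn /= subnK.
rewrite E; split=> //.
have <- : lead_coef ('X^(l - s) * ('X - R%:P) ^+ s) = 1.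
  by apply/eqP; rewrite -monicE monicMl ?monicXn ?monic_exp ?monicXsubC.
by rewrite lead_coefE E.
Qed.

End Module.

(** * Raising the degree in [Y] by one *)

Section Extension.
Variable F : fieldType.

Lemma size_poly2 N (Q : 'rV[{poly F}]_N) : (size (poly2 Q) <= N)%N.
Proof.
rewrite (leq_trans (size_sum _ _ _)) //; apply/bigmax_leqP => i _.
by rewrite mul_polyC (leq_trans (size_scale_leq _ _)) // size_polyXn.
Qed.

Lemma poly2_mul m N (c : 'rV[{poly F}]_m) (B : 'M_(m, N)) :
  poly2 (c *m B) = \sum_i (c ord0 i)%:P * poly2 (row i B).
Proof.
rewrite /poly2; under [RHS]eq_bigr => i _ do rewrite mulr_sumr.
rewrite exchange_big; apply: eq_bigr => t _ /=.
rewrite mxE rmorph_sum mulr_suml; apply: eq_bigr => i _.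
by rewrite mxE rmorphM /= mulrA.
Qed.

Lemma poly2_inj N (Q Q' : 'rV[{poly F}]_N) : poly2 Q = poly2 Q' -> Q = Q'.
Proof. by move=> e; apply/rowP => j; rewrite -!coef_poly2 e. Qed.

Lemma poly20 N : poly2 (0 : 'rV[{poly F}]_N) = 0.
Proof. by rewrite /poly2 big1 // => i _; rewrite mxE polyC0 mul0r. Qed.

Definition extM m l (B : 'M[{poly F}]_(m, l.+1)) : 'M[{poly F}]_(m, l.+2) :=
  \matrix_(i, j) (poly2 (row i B))`_j.

Definition extY m l (B : 'M[{poly F}]_(m, l.+1)) : 'M[{poly F}]_(m, l.+2) :=
  \matrix_(i, j) ('X * poly2 (row i B))`_j.

Lemma row_extM m l (B : 'M[{poly F}]_(m, l.+1)) i :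
  row i (extM B) = vec l.+2 (poly2 (row i B)).
Proof. by apply/rowP => j; rewrite !mxE. Qed.

Lemma row_extY m l (B : 'M[{poly F}]_(m, l.+1)) i :
  row i (extY B) = vec l.+2 ('X * poly2 (row i B)).
Proof. by apply/rowP => j; rewrite !mxE. Qed.

Lemma poly2_extM m l (B : 'M[{poly F}]_(m, l.+1)) i :
  poly2 (row i (extM B)) = poly2 (row i B).
Proof. by rewrite row_extM vecK // (leq_trans (size_poly2 _)). Qed.

Lemma poly2_extY m l (B : 'M[{poly F}]_(m, l.+1)) i :
  poly2 (row i (extY B)) = 'X * poly2 (row i B).
Proof.
rewrite row_extY vecK // (leq_trans (size_polyMleq _ _)) // size_polyX addSn /=.
by rewrite ltnS size_poly2.
Qed.

Lemma poly2_mul_extM m l (c : 'rV[{poly F}]_m) (B : 'M_(m, l.+1)) :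
  poly2 (c *m extM B) = poly2 (c *m B).
Proof.
by rewrite !poly2_mul; apply: eq_bigr => i _; rewrite poly2_extM.
Qed.

Lemma extM_lt m l (B : 'M[{poly F}]_(m, l.+1)) i (j : 'I_l.+2) (j' : 'I_l.+1) :
  j = j' :> nat -> extM B i j = B i j'.
Proof. by move=> e; rewrite mxE e coef_poly2 mxE. Qed.

Lemma extM_max m l (B : 'M[{poly F}]_(m, l.+1)) i : extM B i ord_max = 0.
Proof. by rewrite mxE nth_default // size_poly2. Qed.

Lemma extYS m l (B : 'M[{poly F}]_(m, l.+1)) i (j : 'I_l.+2) (j' : 'I_l.+1) :
  j = j'.+1 :> nat -> extY B i j = B i j'.
Proof. by move=> e; rewrite mxE e coefXM /= coef_poly2 mxE. Qed.

Lemma extY0 m l (B : 'M[{poly F}]_(m, l.+1)) i : extY B i ord0 = 0.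
Proof. by rewrite mxE coefXM. Qed.

Lemma is_basis_unit m N (P : 'rV[{poly F}]_N -> Prop) (A : 'M_(m, N)) (U : 'M_m) :
  (forall c : 'rV_m, P (c *m A)) -> U \in unitmx ->
  is_basis P A -> is_basis P (U *m A).
Proof.
move=> PA Uu [_ span free]; split.
- by move=> i; rewrite row_mul.
- by move=> v /span [c ->]; exists (c *m invmx U); rewrite mulmxA mulmxKV.
- move=> c; rewrite mulmxA => /free h.
  by rewrite -(mulmxK Uu c) h mul0mx.
Qed.

Section Step.
Variables (n : nat) (alpha r' : 'I_n -> F) (s k l : nat).
Hypothesis alpha_inj : injective alpha.
Hypothesis k_gt0 : (0 < k)%N.
Hypothesis kn : (k < n)%N.
Hypothesis s_gt0 : (0 < s)%N.
Hypothesis sl : (s <= l)%N.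
Let w := (k - 1)%N.
Let wn : (w < n)%N. Proof. by rewrite /w; lia. Qed.
Let n0 : (0 < n)%N. Proof. by lia. Qed.
Let M l := @inM F n alpha r' s l.

Section Basis.
Variables (m : nat) (B : 'M[{poly F}]_(m, l.+1)).
Hypothesis Bb : is_basis (M (l := l)) B.

Lemma basis_row_neq0 i : row i B != 0.
Proof.
have [_ _ free] := Bb; apply/negP => /eqP h.
have := free (delta_mx ord0 i); rewrite -rowE h => /(_ erefl) /rowP /(_ i).
by rewrite !mxE !eqxx => /eqP; rewrite oner_eq0.
Qed.

(** For each [j], take [X^a Y^j] of weighted degree [maxn (s * n) (j * w)] and subtract its
    reduction, which has weighted degree below [s * n]. The difference lies in the module and has
    leading position [j]; predictable degrees give a row with that leading position and no larger
    degree. *)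
Lemma popov_structure : weak_popov (B *m Wmat F k l) ->
  exists d q, [/\ forall i, LPspec (row i (B *m Wmat F k l)) (d i) (q i),
    injective q, forall j, exists i, q i = j
    & forall i, (d i <= maxn (s * n) (q i * w))%N].
Proof.
move=> wp; have [_ span free] := Bb.
have [dq dqP] : exists dq : 'I_m -> nat * 'I_l.+1,
    forall i, LPspec (row i (B *m Wmat F k l)) (dq i).1 (dq i).2.
  apply: (@fin_all_exists _ (fun=> (nat * 'I_l.+1)%type)
    (fun i x => LPspec (row i (B *m Wmat F k l)) x.1 x.2)) => i.
  have [|d [q h]] := @LPspec_ex F _ (row i (B *m Wmat F k l)); last by exists (d, q).
  rewrite row_mul; apply: contra (basis_row_neq0 i) => /eqP /mulW_inj ->.
  by rewrite eqxx.
pose q i := (dq i).2; pose d i := (dq i).1.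
have inj : injective q.
  move=> i i' e; apply/eqP; apply: contraT => /wp.
  by rewrite (LPspecE (dqP i)).2 (LPspecE (dqP i')).2 -/(q i) -/(q i') e eqxx.
have key (j : 'I_l.+1) : exists i, q i = j /\ (d i <= maxn (s * n) (j * w))%N.
  set a := (s * n - j * w)%N; set D := maxn (s * n) (j * w).
  have aD : (a + j * w = D)%N by rewrite /a /D; lia.
  have [Q inIQ [sQ wbQ]] := weighted_reduce r' alpha_inj n0 (('X^a)%:P * 'X^j) s_gt0 wn.
  set P := ('X^a)%:P * 'X^j - Q in inIQ.
  have sP : (size P <= l.+1)%N.
    rewrite (leq_trans (size_polyD _ _)) // geq_max size_polyN; apply/andP; split.
      by rewrite mul_polyC (leq_trans (size_scale_leq _ _)) // size_polyXn ltn_ord.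
    by rewrite (leq_trans sQ) // leqW.
  pose v : 'rV_l.+1 := vec l.+1 P.
  have vM : M v by apply/inM_inI; rewrite vecK.
  have sn0 : (0 < s * n)%N by rewrite muln_gt0 s_gt0.
  have sQw (i : 'I_l.+1) : (size (Q`_i * 'X^(i * w))%R <= D)%N.
    apply/leq_sizeP => u hu; rewrite coefMXn; case: ltnP => // hi.
    by apply: wbQ; move: hu; rewrite /D; lia.
  have vW i : (v *m Wmat F k l) ord0 i =
      (if i == j then 'X^D else 0) - Q`_i * 'X^(i * w).
    rewrite mulW mxE /P coefB coefCM coefXn mulrBl; congr (_ - _).
    rewrite val_eqE; case: eqP => [->|_]; last by rewrite mulr0 mul0r.
    by rewrite mulr1 -exprD aD.
  have vLP : LPspec (v *m Wmat F k l) D j.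
    have sne i : i != j -> (size ((v *m Wmat F k l) ord0 i) <= D)%N.
      by move=> /negPf h; rewrite vW h sub0r size_polyN.
    have se : size ((v *m Wmat F k l) ord0 j) = D.+1.
      rewrite vW eqxx size_polyDl size_polyXn // size_polyN ltnS; exact: sQw.
    split => //.
      move=> i; have [->|/sne /leqW //] := eqVneq i j; by rewrite se.
    by move=> i ji; apply: sne; rewrite -val_eqE gtn_eqF.
  have [c cE] := span v vM.
  have c0 : c != 0.
    apply: contraTneq isT => c0; case: vLP; rewrite cE c0 !mul0mx mxE size_poly0 //.
  have [i [ci hLP]] := predictable_degree dqP inj c0.
  rewrite mulmxA -cE in hLP; have [e1 e2] := LPspec_inj hLP vLP.
  by exists i; split => //; rewrite -e1 leq_addl.
exists d, q; split => //.
- by move=> j; have [i [h _]] := key j; exists i.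
- by move=> i; have [i' [/inj -> h]] := key (q i).
Qed.

Lemma inM_extM i : M (row i (extM B)).
Proof.
have [h _ _] := Bb; apply/inM_inI; rewrite poly2_extM; apply/inM_inI; exact: h.
Qed.

Lemma inM_extY i : M (row i (extY B)).
Proof.
have [h _ _] := Bb; apply/inM_inI; rewrite poly2_extY; apply: inIMl.
apply/inM_inI; exact: h.
Qed.

Lemma unimodular_ex : exists p : 'rV[{poly F}]_m, \sum_i p ord0 i * B i ord_max = 1.
Proof.
have [P inIP [sP P1]] := monic_ex r' alpha_inj n0 sl.
have [_ span _] := Bb.
have [|p pE] := span (vec l.+1 P); first by apply/inM_inI; rewrite vecK.
by exists p; have /rowP /(_ ord_max) := pE; rewrite !mxE /= P1 => ->.
Qed.

(** Taking the coefficient of [Y^(l+1)] maps the larger module to the univariate polynomials with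
    kernel the smaller module; a vector sent to a unit splits this map. *)
Lemma basis_stack (u : 'rV[{poly F}]_l.+2) (c : F) : M u -> c != 0 ->
  u ord0 ord_max = c%:P -> is_basis (M (l := l.+1)) (col_mx u (extM B)).
Proof.
move=> uM c0 ue; have [_ span free] := Bb.
have mulE (x : 'rV_(1 + m)) : x *m col_mx u (extM B) =
    x ord0 (lshift m ord0) *: u + rsubmx x *m extM B.
  rewrite -{1}(hsubmxK x) mul_row_col; congr (_ + _).
  by rewrite [lsubmx x]mx11_scalar mul_scalar_mx mxE.
have mulmax (x : 'rV_m) : (x *m extM B) ord0 ord_max = 0.
  by rewrite mxE big1 // => i _; rewrite extM_max mulr0.
split.
- move=> i; rewrite -[i]splitK; case: (split i) => j /=.
    by rewrite rowKu ord1 (_ : row 0 u = u) //; apply/rowP => x; rewrite mxE.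
  by rewrite rowKd; apply: inM_extM.
- move=> v vM; set a := v ord0 ord_max * c^-1%:P.
  have v'M : M (- a *: u + v) by apply: inM_lin.
  set v' := - a *: u + v in v'M.
  have v'max : v' ord0 ord_max = 0.
    rewrite !mxE ue /a mulNr -mulrA -polyCM mulVf // mulr1 addrC subrr //.
  pose v'' : 'rV_l.+1 := vec l.+1 (poly2 v').
  have sv' : (size (poly2 v') <= l.+1)%N.
    apply/leq_sizeP => j hj; have [e|ne] := eqVneq j l.+1.
      by rewrite e -[l.+1]/(nat_of_ord (@ord_max l.+1)) coef_poly2.
    by rewrite nth_default // (leq_trans (size_poly2 _)) // ltn_neqAle eq_sym ne.
  have [|x xE] := span v''; first by apply/inM_inI; rewrite vecK //; apply/inM_inI.
  exists (row_mx (const_mx a) x); rewrite mulE row_mxEl mxE row_mxKr.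
  have -> : x *m extM B = v'.
    by apply: poly2_inj; rewrite poly2_mul_extM -xE vecK.
  by rewrite /v' addrA -scalerDl subrr scale0r add0r.
- move=> x; rewrite mulE => h.
  have x0 : x ord0 (lshift m ord0) = 0.
    have /rowP /(_ ord_max) := h; rewrite mxE mulmax addr0 !mxE ue => /eqP.
    by rewrite mulf_eq0 polyC_eq0 (negPf c0) orbF => /eqP.
  rewrite x0 scale0r add0r in h.
  have xr : rsubmx x = 0.
    by apply: free; apply: poly2_inj; rewrite -poly2_mul_extM h !poly20.
  rewrite -(hsubmxK x) xr; apply/rowP => i; rewrite -[i]splitK.
  case: (split i) => j /=; last by rewrite row_mxEr !mxE.
  by rewrite row_mxEl !mxE ord1 x0.
Qed.

(* Each step of the elimination raises the label of at most one row, so two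
   nonzero rows cannot both survive more than [2 * D] steps. *)
Lemma gcd_phase D t lam' (P : 'M[{poly F}]_m) r1 :
  (forall i j, size ((extY B *m Wmat F k l.+1) i j) <= D.+1)%N ->
  (2 * D < t)%N ->
  chain t [ffun=> D] (rvmx [ffun=> D] (col ord_max (extY B *m Wmat F k l.+1))) P lam' r1 ->
  exists A : 'M[{poly F}]_(m, l.+2),
  [/\ P *m rvmx [ffun=> D] (extY B *m Wmat F k l.+1) = rvmx lam' (A *m Wmat F k l.+1),
      forall i j, (size ((A *m Wmat F k l.+1) i j) <= (lam' i).+1)%N,
      forall i, M (row i A),
      exists i, A i ord_max != 0
    & forall i, A i ord_max != 0 -> exists2 c : F, c != 0 & A i ord_max = c%:P].
Proof.
move=> sD tD ch; set Y := extY B *m Wmat F k l.+1 in sD ch *.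
have [U Uu rd] := chain_reads ch.
have [E sE] := reads_mul (a := Y) rd (fun i j => ltac:(rewrite ffunE; exact: sD)).
exists (U *m extY B); rewrite -mulmxA -/Y.
have UM i : M (row i (U *m extY B)).
  by rewrite row_mul; apply: inM_mul => i'; apply: inM_extY.
have Emax i : rv (lam' i) ((U *m Y) i ord_max) = 'X^t * r1 i ord0.
  have := chain_eq ch; have -> : rvmx [ffun=> D] (col ord_max Y) = col ord_max (rvmx [ffun=> D] Y).
    by apply/matrixP => x y; rewrite !mxE.
  rewrite colE mulmxA -colE E => /matrixP /(_ i ord0) h.
  by rewrite mxE mxE [RHS]mxE in h.
have UY : U *m Y = (U *m extY B) *m Wmat F k l.+1 by rewrite mulmxA.
have lamt i : (U *m extY B) i ord_max != 0 -> (t <= lam' i)%N.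
  move=> h; have hne : (U *m Y) i ord_max != 0.
    by rewrite UY mulW mulf_neq0 // expf_neq0 // polyX_eq0.
  by have [] := rv_divXn (sE i ord_max) (Emax i) hne.
have [p pE] := unimodular_ex.
pose x := p *m invmx U.
have xE : \sum_i x ord0 i * (U *m extY B) i ord_max = 1.
  transitivity ((x *m (U *m extY B)) ord0 ord_max); first by rewrite [RHS]mxE.
  rewrite mulmxA mulmxKV // mxE -[RHS]pE; apply: eq_bigr => i _.
  by rewrite (@extYS _ _ _ i ord_max ord_max).
have uniq i i' : (U *m extY B) i ord_max != 0 -> i' != i -> (U *m extY B) i' ord_max = 0.
  move=> hi ii'; apply/eqP; apply: contraT => hi'.
  have := chain_pair ch ii'; rewrite !ffunE.
  by have := lamt _ hi; have := lamt _ hi'; lia.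
split => //.
  apply/existsP; apply: contraT; rewrite negb_exists => /forallP h.
  move: xE; rewrite big1; first by move/eqP; rewrite eq_sym oner_eq0.
  by move=> i _; have := h i; rewrite negbK => /eqP ->; rewrite mulr0.
(* By [uniq] this entry is the only nonzero one in a column that generates the unit ideal, hence a
   unit. *)
move=> i hi; apply/size_poly1P.
suff : (U *m extY B) i ord_max \is a GRing.unit by rewrite poly_unitE => /andP[].
apply/unitrPr; exists (x ord0 i); rewrite mulrC -[RHS]xE (bigD1 i) //= big1 ?addr0 //.
by move=> i' ii'; rewrite (uniq i i') // mulr0.
Qed.

End Basis.
End Step.

(** * Weak Popov form of the extended basis *)

Section Popov.
Variables (k l : nat).
Let w := (k - 1)%N.

Lemma extM_lift m (B : 'M[{poly F}]_(m, l.+1)) i j : extM B i (lift ord_max j) * 'X^(lift ord_max j * w) =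
  (B *m Wmat F k l) i j.
Proof.
have e : lift ord_max j = j :> nat by rewrite /= /bump leqNgt ltn_ord.
by rewrite mulW e (extM_lt _ _ e).
Qed.

Section PopovPhase.
Variables (B : 'M[{poly F}]_(l.+1, l.+1)) (d : 'I_l.+1 -> nat) (q : 'I_l.+1 -> 'I_l.+1).
Hypothesis Bq : forall i, LPspec (row i (B *m Wmat F k l)) (d i) (q i).
Hypothesis q_inj : injective q.
Variables (u : 'rV[{poly F}]_l.+2) (c : F) (lu : nat).
Hypothesis c0 : c != 0.
Hypothesis ue : u ord0 ord_max = c%:P.
Let A : 'M[{poly F}]_l.+2 := col_mx u (extM B).
Variable lam : {ffun 'I_l.+2 -> nat}.
Hypothesis lam0 : lam ord0 = lu.
Hypothesis lamS : forall i, lam (lift ord0 i) = d i.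
Hypothesis su : forall j, (size ((u *m Wmat F k l.+1) ord0 j) <= lu.+1)%N.

Lemma stack0 j : A ord0 j = u ord0 j.
Proof.
have -> : ord0 = lshift l.+1 (ord0 : 'I_1) :> 'I_(1 + l.+1) by apply: val_inj.
exact: (col_mxEu u (extM B) ord0 j).
Qed.

Lemma stackS i j : A (lift ord0 i) j = extM B i j.
Proof.
have -> : lift ord0 i = rshift 1 i :> 'I_(1 + l.+1) by apply: val_inj.
exact: (col_mxEd u (extM B) i j).
Qed.

Lemma stack_size i j : (size ((A *m Wmat F k l.+1) i j) <= (lam i).+1)%N.
Proof.
rewrite mulW; case: (unliftP ord0 i) => [i'|] ->.
  rewrite stackS lamS; case: (unliftP ord_max j) => [j'|] ->.
    by rewrite extM_lift; have [_ + _] := Bq i' => /(_ j'); rewrite mxE.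
  by rewrite extM_max mul0r size_poly0.
by rewrite stack0 lam0; have := su j; rewrite mulW.
Qed.

(** Only [u] meets the last column, where its reversed entry is [c X^(lu - (l+1) w)]. The
    complementary minor is the reversed given basis; its constant terms are leading coefficients of
    a weak Popov form, so it does not vanish at 0. *)
Lemma det_stack : exists2 g, \det (rvmx lam (A *m Wmat F k l.+1)) =
    'X^(lu - l.+1 * w) * g & g`_0 != 0.
Proof.
set r0 := rvmx lam _.
pose mn := row' ord0 (col' ord_max r0).
have mnE i j : mn i j = rv (d i) ((B *m Wmat F k l) i j).
  have -> : mn i j = r0 (lift ord0 i) (lift ord_max j) by rewrite /mn mxE mxE.
  by rewrite /r0 [rvmx _ _ _ _]mxE [(A *m _) _ _]mulW stackS lamS extM_lift.
have pl : popov_lead (lead mn).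
  exists q; split => // i; have [h1 h2 h3] := Bq i; split.
    rewrite mxE mnE coef_rv subn0.
    have -> : d i = (size ((B *m Wmat F k l) i (q i))).-1 by move: h1; rewrite mxE => ->.
    rewrite -lead_coefE lead_coef_eq0 -size_poly_gt0.
    by move: h1; rewrite mxE => ->.
  move=> j hj; rewrite mxE mnE coef_rv subn0 nth_default //.
  by have := h3 j hj; rewrite mxE.
exists (c%:P * cofactor r0 ord0 ord_max).
  rewrite (expand_det_col _ ord_max) (bigD1 ord0) //= big1 => [|i i0]; last first.
    case: (unliftP ord0 i) i0 => [i'|] -> // _.
    by rewrite mxE mulW stackS extM_max mul0r rv0 mul0r.
  have r00 : r0 ord0 ord_max = c%:P * 'X^(lu - l.+1 * w).
    rewrite /r0 [rvmx _ _ _ _]mxE [(A *m _) _ _]mulW stack0 lam0 ue rvZ; congr (_ * _).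
    have hl : (l.+1 * w <= lu)%N.
      by have := su ord_max; rewrite mulW ue mul_polyC size_scale // size_polyXn ltnS.
    rewrite -{1}(subnK hl) -['X^(_ * _)]mulr1 rv_MXn -[X in rv X](add0n _).
    rewrite rv_addn ?size_poly1 // (_ : rv 0 1 = 1) ?mulr1 //.
    by apply/polyP => -[|i]; rewrite coef_rv //= coef1.
  by rewrite r00 addr0; move: (cofactor _ _ _) => K; ring.
rewrite coefCM mulf_neq0 // /cofactor -signr_odd coef0M mulf_neq0 //.
  by case: odd; rewrite ?expr0 ?expr1 ?coefN coef1 ?oppr_eq0 oner_eq0.
by rewrite -det_lead; apply: popov_lead_det.
Qed.

(** More than [lu] steps exhaust the valuation from [det_stack]. The coefficients at degree
    [lam' i - t] in row [i] are then the constant terms of [r1], whose pivots become the leading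
    positions. *)
Lemma popov_phase t lam' (P : 'M[{poly F}]_l.+2) r1 : (lu < t)%N ->
  chain t lam (rvmx lam (A *m Wmat F k l.+1)) P lam' r1 ->
  exists2 U : 'M[{poly F}]_l.+2, U \in unitmx &
  [/\ P *m rvmx lam (A *m Wmat F k l.+1) = rvmx lam' (U *m A *m Wmat F k l.+1),
      forall i j, (size ((U *m A *m Wmat F k l.+1) i j) <= (lam' i).+1)%N
    & weak_popov (U *m A *m Wmat F k l.+1)].
Proof.
move=> lt ch; have [g dg g0] := det_stack.
have lt' : (lu - l.+1 * w < t)%N by apply: leq_ltn_trans lt; apply: leq_subr.
have [piv [inj pivP]] := chain_popov ch dg g0 lt'.
have [U Uu rd] := chain_reads ch.
have [E sE] := reads_mul rd stack_size.
exists U => //; rewrite -mulmxA; split => //.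
set Z := U *m _ in E sE *.
have ZE i j : rv (lam' i) (Z i j) = 'X^t * r1 i j.
  have := chain_eq ch; rewrite E => /matrixP /(_ i j) h.
  by rewrite mxE [RHS]mxE in h.
have Zc i j : Z i j != 0 -> [/\ (t <= lam' i)%N,
    (size (Z i j) <= (lam' i - t).+1)%N & (Z i j)`_(lam' i - t) = (r1 i j)`_0].
  move=> h; have [h1 h2] := rv_divXn (sE i j) (ZE i j) h.
  split => //; first by rewrite h2 size_rv.
  by rewrite {1}h2 coef_rv leqnn subnn.
have ZLP i : LPspec (row i Z) (lam' i - t) (piv i).
  have [p1 p2] := pivP i; rewrite !mxE in p1.
  have Zp : Z i (piv i) != 0.
    apply: contraNneq p1 => e; have := ZE i (piv i); rewrite e rv0 => /esym /eqP.
    by rewrite mulf_eq0 expf_eq0 polyX_eq0 andbF /= => /eqP ->; rewrite coef0.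
  have [t1 s1 e1] := Zc _ _ Zp.
  have s2 j : (size (Z i j) <= (lam' i - t).+1)%N.
    by have [->|/Zc[]] := eqVneq (Z i j) 0; rewrite ?size_poly0.
  split.
  - rewrite mxE; apply/eqP; rewrite eqn_leq s1 /= ltnNge; apply/negP => h.
    by move: p1; rewrite -e1 nth_default ?eqxx.
  - by move=> j; rewrite mxE.
  - move=> j hj; rewrite mxE; have [->|Zj] := eqVneq (Z i j) 0; first by rewrite size_poly0.
    have [_ s3 e3] := Zc _ _ Zj; have := p2 j hj; rewrite mxE -e3 => z0.
    apply/leq_sizeP => x; rewrite leq_eqVlt => /orP[/eqP <- //|hx].
    by rewrite nth_default // (leq_trans s3).
move=> i i' ii'; rewrite (LPspecE (ZLP i)).2 (LPspecE (ZLP i')).2.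
by apply: contra ii' => /eqP /val_inj /inj ->.
Qed.

End PopovPhase.

(** The two size hypotheses say that row [i0] has leading position [l] and weighted degree [l * w].
    Multiplication by [Y] moves the leading position to [l + 1], which no row of [extM B] has. *)
Lemma trivial_popov m (B : 'M[{poly F}]_(m, l.+1)) (d : 'I_m -> nat) (q : 'I_m -> 'I_l.+1) i0 :
  (forall i, LPspec (row i (B *m Wmat F k l)) (d i) (q i)) -> injective q ->
  size (B i0 ord_max) = 1%N ->
  (forall j, B i0 j != 0 -> (size (B i0 j) + j * w <= 1 + l * w)%N) ->
  weak_popov (col_mx (row i0 (extY B)) (extM B) *m Wmat F k l.+1).
Proof.
move=> Bq inj s1 sB; set A := col_mx _ _.
pose q' (i : 'I_(1 + m)) : 'I_l.+2 :=
  match split i with inl _ => ord_max | inr i' => widen_ord (leqnSn _) (q i') end.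
pose d' (i : 'I_(1 + m)) :=
  match split i with inl _ => (l.+1 * w)%N | inr i' => d i' end.
have ALP i : LPspec (row i (A *m Wmat F k l.+1)) (d' i) (q' i).
  rewrite /d' /q'; case: (split_ordP i) => i' ->.
    have rE j : row (lshift m i') (A *m Wmat F k l.+1) ord0 j = extY B i0 j * 'X^(j * w).
      by rewrite mxE mulW /A col_mxEu mxE.
    have Yle j : (size (extY B i0 j * 'X^(j * w))%R <= (l.+1 * w).+1)%N.
      case: (unliftP ord0 j) => [j'|] ->; last by rewrite extY0 mul0r size_poly0.
      rewrite (@extYS _ _ B i0 (lift ord0 j') j') //.
      have [->|Bj] := eqVneq (B i0 j') 0; first by rewrite mul0r size_poly0.
      rewrite size_mulXn // lift0 mulSn; have := sB j' Bj.
      by rewrite mulSn; move: (size _) => x; lia.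
    split.
    - rewrite rE (@extYS _ _ B i0 ord_max ord_max) // size_mulXn ?s1 ?addn1 //.
      by rewrite -size_poly_gt0 s1.
    - by move=> j; rewrite rE.
    - by move=> j /=; rewrite ltnNge -ltnS ltn_ord.
  have rE j : row (rshift 1 i') (A *m Wmat F k l.+1) ord0 j = extM B i' j * 'X^(j * w).
    by rewrite mxE mulW /A col_mxEd.
  have [h1 h2 h3] := Bq i'; split.
  - rewrite rE (@extM_lt _ _ B i' _ (q i')) //=.
    by move: h1; rewrite mxE mulW.
  - move=> j; rewrite rE; case: (unliftP ord_max j) => [j'|] ->; last first.
      by rewrite extM_max mul0r size_poly0.
    by rewrite extM_lift; have := h2 j'; rewrite mxE.
  - move=> j; rewrite rE; case: (unliftP ord_max j) => [j'|] ->; last first.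
      by rewrite extM_max mul0r size_poly0.
    rewrite extM_lift; have := h3 j'; rewrite mxE.
    by have -> : lift ord_max j' = j' :> nat by rewrite /= /bump leqNgt ltn_ord.
move=> i i' ii'; rewrite (LPspecE (ALP i)).2 (LPspecE (ALP i')).2.
apply: contra ii'; rewrite /q'.
case: (split_ordP i) => x ->; case: (split_ordP i') => y -> /=.
- by rewrite !ord1.
- by move=> /eqP h; have := ltn_ord (q y); rewrite -h ltnn.
- by move=> /eqP h; have := ltn_ord (q x); rewrite h ltnn.
- by move=> /eqP /val_inj /inj ->.
Qed.

End Popov.
End Extension.

(** * The algorithm *)

Fixpoint testnz V (s : seq V) : prog V bool :=
  if s is x :: s' then IsZero x (fun b => if b then testnz s' else Ret true)
  else Ret false.

Section Programs.
Variables (V : Type).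
Local Open Scope nat_scope.

(* Coefficients of [X^e f(1/X)] for [f = X^a s]. *)
Definition revl (z : V) (e a : nat) (s : seq V) : seq V :=
  mkseq (fun d => if e - d < a then z else nth z s (e - d - a)) e.+1.

Definition rowdeg (w N : nat) (row : seq (seq V)) : nat :=
  (\max_(j < N) (if nth [::] row j is [::] then 0
                 else size (nth [::] row j) + j * w)).-1.

(** Decided on list lengths alone, hence without field operations: encoded polynomials are
    normalised, so length 1 means a nonzero constant. The second test says that position [l]
    leads. *)
Definition const_top (w l : nat) (row : seq (seq V)) : bool :=
  (size (nth [::] row l) == 1) &&
  all (fun j => nilp (nth [::] row j) || (size (nth [::] row j) + j * w <= 1 + l * w))
    (iota 0 l.+1).

(** [D] bounds the weighted degrees of [Y*B], which are at most [s * n + (k - 1)]. [gcd_phase] needs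
    more than [2 * D] steps; these raise labels to at most [D + 2^K1], and the second precision must
    exceed that. The products use one level more because approximant entries may have [2^K + 1]
    coefficients. *)
Definition reduceM (z o pinv : V) (p eps n k s l : nat) (Bl : seq (seq (seq V))) :
    prog V (seq (seq (seq V))) :=
  let m := size Bl in
  let w := k - 1 in
  let D := s * n + k in
  let K1 := up_log 2 (2 * D).+1 in
  let Yl := mkseq (fun i => mkseq (fun j =>
              revl z D (j * w) (nth [::] ([::] :: nth [::] Bl i) j)) l.+2) m in
  let cl := mkseq (fun i => [:: ent Yl i l.+1]) m in
  let* x := pm z o p eps pinv m 1 K1 (nseq m D) cl in
  let* Q1 := mulM (mulp p eps z pinv K1.+1) m m l.+2 x.1 Yl in
  let* fl := tabM (fun i => testnz (ent Q1 i l.+1)) 0 m in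
  let i0 := find id fl in
  let lu := nth 0 x.2 i0 in
  let K2 := up_log 2 (D + 2 ^ K1).+1 in
  let dg i := rowdeg w l.+1 (nth [::] Bl i) in
  let Al := nth [::] Q1 i0 :: mkseq (fun i => mkseq (fun j =>
              revl z (dg i) (j * w) (nth [::] (nth [::] Bl i) j)) l.+2) m in
  let* y := pm z o p eps pinv m.+1 l.+2 K2 (lu :: mkseq dg m)
              (mapE (take (2 ^ K2)) Al) in
  let* Q2 := mulM (mulp p eps z pinv K2.+1) m.+1 m.+1 l.+2 y.1 Al in
  Ret (mkseq (fun i => mkseq (fun j => drop (j * w)
         (revl z (nth 0 y.2 i) 0 (ent Q2 i j))) l.+2) m.+1).

Definition step_alg (n k s l : nat) (alpha w r : seq V) (Bl : seq (seq (seq V))) :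
    prog V (seq (seq (seq V))) :=
  match [seq i <- iota 0 (size Bl) | const_top (k - 1) l (nth [::] Bl i)] with
  | i :: _ => Ret (([::] :: nth [::] Bl i) :: [seq rcons row [::] | row <- Bl])
  | [::] =>
    Zero (fun z => One (fun o => Op FAdd o o (fun two => IsZero two (fun b =>
      if b then Op FAdd two o (fun three => Op FDiv o three (fun pinv =>
        reduceM z o pinv 3 0 n k s l Bl))
      else Op FDiv o two (fun pinv => reduceM z o pinv 2 1 n k s l Bl)))))
  end.

End Programs.

Section Specs.
Variable F : fieldType.

Lemma spec_testnz (s : seq F) : spec (testnz s) (fun b => b = (Poly s != 0)) (size s).
Proof.
elim: s => [|x s IH] /=; first by apply: spec_ret; rewrite eqxx.
apply: spec_iszero; case: eqVneq => [->|x0].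
  apply: (spec_weaken IH) => // b ->; rewrite cons_poly_def addr0.
  by rewrite mulf_eq0 polyX_eq0 orbF.
apply: spec_ret; apply/esym/eqP => /(congr1 (fun p : {poly F} => p`_0)).
by rewrite cons_poly_def coefD coefMX coefC coef0 add0r; apply/eqP.
Qed.

Lemma Poly_revl e a (s : seq F) : Poly (revl 0 e a s) = rv e (Poly s * 'X^a).
Proof.
apply/polyP => i; rewrite coef_Poly coef_rv.
case: leqP => hi; last by rewrite nth_default // size_mkseq.
by rewrite nth_mkseq // coefMXn; case: ltnP => // h; rewrite coef_Poly.
Qed.

Lemma size_revl e a (s : seq F) : size (revl 0 e a s) = e.+1.
Proof. by rewrite size_mkseq. Qed.

Section Enc.
Variables (m N : nat) (B : 'M[{poly F}]_(m, N)).

Lemma size_enc : size (enc_mx B) = m.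
Proof. by rewrite size_map size_enum_ord. Qed.

Lemma nth_enc (i : 'I_m) : nth [::] (enc_mx B) i = [seq polyseq (B i j) | j <- enum 'I_N].
Proof. by rewrite (nth_map i) ?size_enum_ord // nth_ord_enum. Qed.

Lemma size_nth_enc (i : 'I_m) : size (nth [::] (enc_mx B) i) = N.
Proof. by rewrite nth_enc size_map size_enum_ord. Qed.

Lemma ent_enc (i : 'I_m) (j : 'I_N) : nth [::] (nth [::] (enc_mx B) i) j = B i j.
Proof. by rewrite nth_enc (nth_map j) ?size_enum_ord // nth_ord_enum. Qed.

End Enc.

Lemma good_outputP n k s l (alpha r' : 'I_n -> F) N (out : seq (seq (seq F)))
    (A : 'M[{poly F}]_(N, l.+2)) :
  size out = N -> all (fun row => size row == l.+2) out -> toM N l.+2 out = A ->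
  is_basis (@inM F n alpha r' s l.+1) A -> weak_popov (A *m Wmat F k l.+1) ->
  good_output k s l alpha r' out.
Proof.
move=> sz al E bA wA.
(* The row dimension of [dec_mx] is [size out]; it has to be generalised before it can be replaced
   by [N]. *)
have H S : S = N -> is_basis (@inM F n alpha r' s l.+1) (toM S l.+2 out) /\
    weak_popov (toM S l.+2 out *m Wmat F k l.+1) by move=> ->; rewrite E.
by have [h1 h2] := H _ sz; split.
Qed.

Section Correct.
Variables (n k s l : nat) (alpha r' : 'I_n -> F).
Hypothesis alpha_inj : injective alpha.
Hypothesis k_gt0 : (0 < k)%N.
Hypothesis kn : (k < n)%N.
Hypothesis s_gt0 : (0 < s)%N.
Hypothesis sl : (s <= l)%N.
Let w := (k - 1)%N.

Lemma trivial_good m (B : 'M[{poly F}]_(m, l.+1)) (i0 : 'I_m) :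
  is_basis (@inM F n alpha r' s l) B -> weak_popov (B *m Wmat F k l) ->
  const_top w l (nth [::] (enc_mx B) i0) ->
  good_output k s l alpha r' (([::] :: nth [::] (enc_mx B) i0)
     :: [seq rcons row [::] | row <- enc_mx B]).
Proof.
move=> Bb wp /andP[+ /allP aB].
rewrite -[l in nth _ _ l]/(nat_of_ord (@ord_max l)) ent_enc => s1.
have sB (j : 'I_l.+1) : B i0 j != 0 -> (size (B i0 j) + j * w <= 1 + l * w)%N.
  have := aB j; rewrite mem_iota /= add0n ltn_ord => /(_ isT).
  by rewrite ent_enc /nilp size_poly_eq0 => /orP[->|].
have [d [q [Bq inj _ _]]] := popov_structure alpha_inj k_gt0 kn s_gt0 sl Bb wp.
apply: (@good_outputP n k s l alpha r' (1 + m) _ (col_mx (row i0 (extY B)) (extM B))).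
- by rewrite /= size_map size_enc.
- rewrite /= size_nth_enc eqxx /=; apply/allP => row /mapP[rw + ->].
  move=> /(nthP [::])[i]; rewrite size_enc => hi <-.
  by rewrite size_rcons -[i]/(nat_of_ord (Ordinal hi)) size_nth_enc.
- apply/matrixP => i j; rewrite mxE; case: (split_ordP i) => i' ->.
    rewrite col_mxEu [RHS]mxE ord1 /ent /=.
    case: (unliftP ord0 j) => [j'|] ->; last by rewrite extY0.
    by rewrite (@extYS _ _ _ B i0 _ j') // lift0 /= ent_enc polyseqK.
  rewrite col_mxEd /ent /=.
  have -> : nth [::] [seq rcons row [::] | row <- enc_mx B] i'
      = rcons (nth [::] (enc_mx B) i') [::] by rewrite (nth_map [::]) ?size_enc.
  rewrite nth_rcons size_nth_enc.
  case: (unliftP ord_max j) => [j'|] ->.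
    have e : lift ord_max j' = j' :> nat by rewrite /= /bump leqNgt ltn_ord.
    by rewrite e ltn_ord ent_enc polyseqK (extM_lt _ _ e).
  by rewrite /= ltnn eqxx extM_max.
- have /size_poly1P[c c0 cE] := s1.
  apply: (basis_stack Bb (c := c)) => //.
    exact: inM_extY.
  by rewrite mxE (@extYS _ _ _ B i0 _ ord_max).
- exact: (trivial_popov Bq inj (eqP s1) sB).
Qed.

Section Reduce.
Variables (p eps : nat) (pinv : F).
Hypothesis peps : (p = 2 /\ eps = 1%N) \/ (p = 3 /\ eps = 0%N).
Hypothesis pinvP : pinv * p%:R = 1.
Variables (B : 'M[{poly F}]_(l.+1, l.+1)) (d : 'I_l.+1 -> nat) (q : 'I_l.+1 -> 'I_l.+1).
Hypothesis Bb : is_basis (@inM F n alpha r' s l) B.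
Hypothesis Bq : forall i, LPspec (row i (B *m Wmat F k l)) (d i) (q i).
Hypothesis q_inj : injective q.
Hypothesis dn : forall i, (d i <= s * n)%N.

Let D := (s * n + k)%N.
Let K1 := up_log 2 (2 * D).+1.
Let K2 := up_log 2 (D + 2 ^ K1).+1.

Lemma rowdeg_enc (i : 'I_l.+1) : rowdeg w l.+1 (nth [::] (enc_mx B) i) = d i.
Proof.
have [rE _] := LPspecE (Bq i); apply: succn_inj.
rewrite -rE /rowdeg /rdeg (eq_bigr (fun j => size (row i (B *m Wmat F k l) ord0 j))).
  by rewrite -/(rdeg (row i (B *m Wmat F k l))) rE.
move=> j _; rewrite ent_enc mxE mulW.
have [->|Bj] := eqVneq (B i j) 0; first by rewrite mul0r !polyseq0.
rewrite size_mulXn //; move: Bj; rewrite -size_poly_gt0.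
by case: (polyseq (B i j)) => //= x y _; rewrite addnC.
Qed.

Lemma extY_size i j : (size ((extY B *m Wmat F k l.+1) i j) <= D.+1)%N.
Proof.
rewrite mulW; case: (unliftP ord0 j) => [j'|] ->; last by rewrite extY0 mul0r size_poly0.
rewrite (@extYS _ _ _ B i _ j') // lift0.
have [->|Bj] := eqVneq (B i j') 0; first by rewrite mul0r size_poly0.
rewrite size_mulXn // mulSn; have [_ + _] := Bq i => /(_ j'); rewrite mxE mulW size_mulXn //.
have := dn i; rewrite /D; move: (size _) => x; lia.
Qed.

Lemma spec_reduceM :
  spec (reduceM 0 1 pinv p eps n k s l (enc_mx B)) (good_output k s l alpha r')
    (40 * (4000 * (l.+2 ^ 3 * (K2.+2 * mcost K2.+1)))).
Proof.
rewrite /reduceM size_enc -/w -/D -/K1 -/K2.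
pose Yl : seq (seq (seq F)) := mkseq (fun i => mkseq (fun j =>
  revl 0 D (j * w) (nth [::] ([::] :: nth [::] (enc_mx B) i) j)) l.+2) l.+1.
pose cl : seq (seq (seq F)) := mkseq (fun i => [:: ent Yl i l.+1]) l.+1.
rewrite -/Yl -/cl.
(* Common unit of cost: the two reductions take [10 * X] each, the two products [5 * X] each and the
   zero tests [X]. *)
pose X := (4000 * (l.+2 ^ 3 * (K2.+2 * mcost K2.+1)))%N.
have t1 : (2 * D < 2 ^ K1)%N by apply: up_logP.
have t2 : (D + 2 ^ K1 < 2 ^ K2)%N by apply: up_logP.
have K12 : (K1 <= K2)%N.
  by apply: leq_up_log; rewrite ltnS (leq_trans (ltnW t1)) // leq_addl.
have mcle a b : (a <= b)%N -> (mcost a <= mcost b)%N.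
  move=> ab; rewrite /mcost !leq_mul ?leq_exp2l //.
  by rewrite ltnS leq_up_log.
pose N3 := (l.+2 ^ 3)%N; pose Z := (K2.+2 * mcost K2.+1)%N.
have XE : X = (4000 * (N3 * Z))%N by [].
have leX a x z : (a <= N3)%N -> (z <= Z)%N -> (a * (x * (4000 * z)) <= x * X)%N.
  move=> ha hz; have := leq_mul (leqnn x) (leq_mul (leqnn 4000) (leq_mul ha hz)).
  by rewrite -XE; apply: leq_trans; apply/eq_leq; ring.
have Z1 : (mcost K2.+1 <= Z)%N by rewrite leq_pmull.
have N1 : (l.+1 * (l.+2 * l.+1) <= N3)%N by rewrite /N3 !expnS expn0 muln1 !leq_mul.
have N2 : (l.+1 ^ 3 <= N3)%N by rewrite leq_exp2r.
have EY (i : 'I_l.+1) (j : 'I_l.+2) : Poly (ent Yl i j) =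
    rv D ((extY B *m Wmat F k l.+1) i j).
  rewrite /ent /Yl !nth_mkseq // Poly_revl mulW; congr (rv _ (_ * _)).
  case: (unliftP ord0 j) => [j'|] ->; last by rewrite extY0.
  by rewrite (@extYS _ _ _ B i _ j') // lift0 /= ent_enc polyseqK.
have bY : bnd l.+1 l.+2 D.+1 Yl.
  by move=> i j hi hj; rewrite /ent /Yl !nth_mkseq // size_revl.
have ecl i j : (i < l.+1)%N -> (j < 1)%N -> ent cl i j = ent Yl i l.+1.
  by move=> hi; case: j => // _; rewrite {1}/ent /cl nth_mkseq.
have bcl : bnd l.+1 1 (2 ^ K1) cl.
  by move=> i j hi hj; rewrite ecl // (leq_trans (bY i l.+1 hi _)) //; lia.
apply: (spec_bind (c1 := 10 * X) (c2 := 30 * X)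
  (spec_weaken (spec_pm peps pinvP (nseq l.+1 D) (ltn0Sn _) bcl) (fun _ h => h) _));
  last by rewrite -mulnDl.
  apply: leX => //; apply: leq_mul; first by lia.
  by apply: mcle; lia.
move=> x; set P1 := x.1; set lam1 := x.2 => -[sl1 bP1 ch1].
have lam0E : lamf l.+1 (nseq l.+1 D) = [ffun=> D].
  by apply/ffunP => i; rewrite !ffunE nth_nseq ltn_ord.
have [r1 ch] : exists r1, chain (2 ^ K1) [ffun=> D]
    (rvmx [ffun=> D] (col ord_max (extY B *m Wmat F k l.+1)))
    (toM l.+1 l.+1 P1) (lamf l.+1 lam1) r1.
  rewrite -lam0E; apply: ch1 => i j; congr take_poly.
  rewrite mxE [RHS]mxE ecl // (EY i ord_max : Poly (ent Yl i l.+1) = _).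
  by rewrite lam0E ffunE [col _ _ _ _]mxE.
have [A [AE As AM [i1 Ai1] Ac]] :=
  gcd_phase alpha_inj k_gt0 kn s_gt0 sl Bb extY_size t1 ch.
have K1S : ((2 ^ K1).+1 <= 2 ^ K1.+1)%N.
  by rewrite expnS mul2n -addnn -addn1 leq_add2l expn_gt0.
apply: (spec_bind (c1 := 5 * X) (c2 := 25 * X)
  (spec_weaken (spec_mulMp peps pinvP K1S (leq_trans _ K1S) bP1 bY) (fun _ h => h) _));
  last by rewrite -mulnDl.
- by lia.
- apply: leq_trans (leX _ 5%N _ N1 (leq_trans (mcle K1.+1 K2.+1 _) Z1)); last by rewrite ltnS.
  by apply/eq_leq; ring.
move=> Q1 [sQ1 sQ1r bQ1 EQ1].
have EQ (i : 'I_l.+1) (j : 'I_l.+2) : Poly (ent Q1 i j) =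
    rv (nth 0%N lam1 i) ((A *m Wmat F k l.+1) i j).
  have E : toM l.+1 l.+2 Yl = rvmx [ffun=> D] (extY B *m Wmat F k l.+1).
    by apply/matrixP => a b; rewrite mxE EY [RHS]mxE ffunE.
  by have /matrixP /(_ i j) := EQ1; rewrite E AE mxE => ->; rewrite mxE ffunE.
have sQ : ((2 ^ K1).+1 + D.+1 <= (2 ^ K2).+1)%N by lia.
pose flP i b := (b : bool) = (Poly (ent Q1 i l.+1) != 0).
apply: (spec_bind (c1 := X) (c2 := 20 * X)
  (Q := fun r => size r = l.+1 /\ forall i, (i < l.+1)%N -> flP i (nth false r i))
  (spec_weaken (spec_tabM false (c := (2 ^ K1).+1 + D.+1) _) (fun _ h => h) _)).
- move=> i hi; apply: (spec_weaken (spec_testnz _)) => //.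
  exact: bQ1.
- have h1 : (l.+1 <= N3)%N.
    by apply: leq_trans N1; rewrite leq_pmulr.
  have h2 : ((2 ^ K1).+1 + D.+1 <= Z)%N.
    apply: leq_trans Z1; apply: leq_trans (mcost_gt0 _); apply: leq_trans sQ _.
    by rewrite expnS mul2n -addnn -addn1 leq_add2l expn_gt0.
  apply: leq_trans (leq_mul h1 h2) _; rewrite XE; exact: leq_pmull.
- move=> fl [sfl flE].
  have flA (i : 'I_l.+1) : nth false fl i = (A i ord_max != 0).
    rewrite flE // (EQ i ord_max : Poly (ent Q1 i l.+1) = _) mulW.
    congr negb; apply/eqP/eqP => [h|->]; last by rewrite mul0r rv0.
    have := As i ord_max; rewrite ffunE mulW => /rvK; rewrite h rv0 => /esym /eqP.
    by rewrite mulf_eq0 expf_eq0 polyX_eq0 andbF orbF => /eqP.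
  have hfl : has id fl.
    by apply/(has_nthP false); exists i1; rewrite ?sfl ?ltn_ord // flA.
  set i0 := find id fl; set lu := nth 0%N lam1 i0.
  have hi0 : (i0 < l.+1)%N by rewrite -sfl -has_find.
  pose I0 : 'I_l.+1 := Ordinal hi0.
  have [c c0 cE] : exists2 c : F, c != 0 & A I0 ord_max = c%:P.
    by apply: Ac; rewrite -flA; apply: (nth_find false hfl).
  pose u := row I0 A.
  have ue : u ord0 ord_max = c%:P by rewrite mxE.
  have luD : (lu <= D + 2 ^ K1)%N.
    by have := chain_label ch I0; rewrite !ffunE.
  pose dg i := rowdeg w l.+1 (nth [::] (enc_mx B) i).
  pose Al : seq (seq (seq F)) := nth [::] Q1 i0 :: mkseq (fun i => mkseq (fun j =>
    revl 0 (dg i) (j * w) (nth [::] (nth [::] (enc_mx B) i) j)) l.+2) l.+1.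
  pose AA : 'M[{poly F}]_l.+2 := col_mx u (extM B).
  pose lamL := lu :: mkseq dg l.+1; pose lam := lamf l.+2 lamL.
  rewrite -/dg -/Al -/lamL.
  have lam0 : lam ord0 = lu by rewrite ffunE.
  have lamS i : lam (lift ord0 i) = d i.
    by rewrite ffunE lift0 /= nth_mkseq // /dg rowdeg_enc.
  have su j : (size ((u *m Wmat F k l.+1) ord0 j) <= lu.+1)%N.
    by have := As I0 j; rewrite ffunE !mulW mxE.
  have EA (i j : 'I_l.+2) : Poly (ent Al i j) = rvmx lam (AA *m Wmat F k l.+1) i j.
    rewrite [RHS]mxE mulW; case: (unliftP ord0 i) => [i'|] ->.
      rewrite (stackS B u) lamS lift0 /ent /= !nth_mkseq // Poly_revl /dg rowdeg_enc.
      congr (rv _ (_ * _)).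
      case: (unliftP ord_max j) => [j'|] ->.
        have e : lift ord_max j' = j' :> nat by rewrite /= /bump leqNgt ltn_ord.
        by rewrite e ent_enc polyseqK (extM_lt _ _ e).
      by rewrite extM_max nth_default // size_nth_enc.
    rewrite (stack0 B u) lam0 -[ent Al _ _]/(ent Q1 I0 j) EQ mulW.
    by rewrite mxE.
  have bA : bnd l.+2 l.+2 (2 ^ K2).+1 Al.
    move=> [|i] j hi hj; first by apply: leq_trans (bQ1 i0 j hi0 hj) sQ.
    rewrite /ent /= !nth_mkseq // size_revl ltnS.
    rewrite -[i]/(nat_of_ord (Ordinal (hi : (i < l.+1)%N))) /dg rowdeg_enc.
    by apply: leq_trans (dn _) _; rewrite /D in t2; lia.
  have bAt : bnd l.+2 l.+2 (2 ^ K2) (mapE (take (2 ^ K2)) Al).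
    by move=> i j hi hj; rewrite ent_mapE // size_take; case: ltnP.
  apply: (spec_bind (c1 := 10 * X) (c2 := 5 * X)
    (spec_weaken (spec_pm peps pinvP lamL (leqnn _) bAt) (fun _ h => h) _));
    last by rewrite -mulnDl leq_mul2r orbT.
    apply: leX => //; apply: leq_mul => //; apply: mcle => //.
  move=> y; set P2 := y.1; set lam2 := y.2 => -[sl2 bP2 ch2].
  have [r2 ch'] : exists r2, chain (2 ^ K2) lam (rvmx lam (AA *m Wmat F k l.+1))
      (toM l.+2 l.+2 P2) (lamf l.+2 lam2) r2.
    apply: ch2 => i j; rewrite [in RHS]mxE ent_mapE // Poly_take EA.
    by rewrite [RHS]take_poly_id // size_take_poly.
  have lt : (lu < 2 ^ K2)%N by apply: leq_ltn_trans luD t2.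
  have [U Uu [UE Us Uwp]] := popov_phase Bq q_inj c0 ue lam0 lamS su lt ch'.
  have K2S : ((2 ^ K2).+1 <= 2 ^ K2.+1)%N.
    by rewrite expnS mul2n -addnn -addn1 leq_add2l expn_gt0.
  apply: (spec_bind (c1 := 5 * X) (c2 := 0)
    (spec_weaken (spec_mulMp peps pinvP K2S K2S bP2 bA) (fun _ h => h) _));
    last by rewrite addn0.
    by apply: leq_trans (leX _ 5%N _ (leqnn N3) Z1); apply/eq_leq; rewrite /N3; ring.
  move=> Q2 [sQ2 _ _ EQ2]; apply: spec_ret.
  apply: (@good_outputP n k s l alpha r' l.+2 _ (U *m AA)).
  + by rewrite size_mkseq.
  + by apply/(all_nthP [::]) => i; rewrite size_mkseq => hi; rewrite nth_mkseq // size_mkseq.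
  + apply/matrixP => i j; rewrite mxE /ent !nth_mkseq // Poly_drop Poly_revl expr0 mulr1.
    have -> : Poly (ent Q2 i j) = rv (nth 0%N lam2 i) ((U *m AA *m Wmat F k l.+1) i j).
      have E : toM l.+2 l.+2 Al = rvmx lam (AA *m Wmat F k l.+1).
        by apply/matrixP => a b; rewrite mxE EA.
      by have /matrixP /(_ i j) := EQ2; rewrite E UE mxE => ->; rewrite mxE ffunE.
    rewrite rvK; first by rewrite mulW drop_polyMXn_id.
    by have := Us i j; rewrite ffunE.
  + apply: is_basis_unit => //.
      move=> v; apply: inM_mul => i.
      by have [+ _ _] := basis_stack Bb (AM I0) c0 ue; apply.
    exact: (basis_stack Bb (AM I0) c0 ue).
  + exact: Uwp.
- by lia.
Qed.

End Reduce.
End Correct.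
End Specs.

(** * Estimate of the total cost *)

Section Cost.
Local Open Scope nat_scope.

Definition prec1 (n k s : nat) : nat := up_log 2 (2 * (s * n + k)).+1.

Definition prec2 (n k s : nat) : nat := up_log 2 (s * n + k + 2 ^ prec1 n k s).+1.

Lemma exp_up_log x : 0 < x -> 2 ^ up_log 2 x.+1 <= 2 * x.
Proof.
move=> x0; have h : 0 < up_log 2 x.+1 by rewrite up_log_gt0.
have := @up_log_gtn 2 x.+1 isT x0; rewrite ltnS => hx.
by rewrite -(prednK h) expnS leq_mul2l.
Qed.

Lemma up_logM a b : up_log 2 (a * b) <= up_log 2 a + up_log 2 b.
Proof. by apply: up_log_min => //; rewrite expnD leq_mul // up_logP. Qed.

(** [s * n <= c * n^3] makes both precisions logarithmic in [n]. The constant 20 comes from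
    [2^K2 <= 2 * (D + 4 * D)] and [D <= 2 * (s * n)]. For [n >= 4] both logarithms are positive, so
    the additive constants are absorbed into the factors [E] and [H]. *)
Lemma reduce_cost c : exists C, forall n k s l : nat,
  1 <= k -> k < n -> 1 <= s -> s <= l -> s <= c * n ^ 2 -> 4 <= n ->
  46 * (4000 * (l.+2 ^ 3 * ((prec2 n k s).+2 * mcost (prec2 n k s).+1)))
    <= C * cost_bound n s l.
Proof.
pose E := up_log 2 (20 * c) + 5; pose H := (up_log 2 E).+2.
exists (46 * (4000 * (27 * (40 * (E * (E * H)))))).
move=> n k s l k1 kn s1 sl sc n4; pose D := s * n + k.
pose K1 := prec1 n k s; set K2 := prec2 n k s.
set L := up_log 2 n; set LL := up_log 2 L.
have L2 : 2 <= L by apply: (leq_trans _ (leq_up_log 2 n4)).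
have LL1 : 1 <= LL by apply: (leq_trans _ (leq_up_log 2 L2)).
have D0 : 0 < D by rewrite /D; lia.
have DD : D <= 2 * (s * n).
  by rewrite /D mul2n -addnn leq_add2l (leq_trans (ltnW kn)) // leq_pmull.
have e1 : 2 ^ K1 <= 2 * (2 * D) by apply: exp_up_log; rewrite muln_gt0.
have e2 : 2 ^ K2 <= 2 * (D + 2 ^ K1) by apply: exp_up_log; rewrite addn_gt0 D0.
have e3 : 2 ^ K2 <= 20 * (s * n) by lia.
have K2le : K2 <= up_log 2 (20 * c) + 3 * L.
  rewrite -(leq_exp2l (m := 2)) //; apply: leq_trans e3 _.
  rewrite expnD mulnC [3 * L]mulnC expnM.
  apply: (@leq_trans (n ^ 3 * (20 * c))).
    rewrite (_ : n ^ 3 * (20 * c) = 20 * (c * n ^ 2 * n)); last by ring.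
    by rewrite mulnC leq_mul2l /= leq_mul2r sc orbT.
  by rewrite mulnC; apply: leq_mul; rewrite ?up_logP // leq_exp2r // up_logP.
have KE : K2.+2 <= E * L by rewrite /E; nia.
have KH : (up_log 2 K2.+2).+1 <= H * LL.
  have := leq_trans (leq_up_log 2 KE) (up_logM E L); rewrite -/LL /H.
  by move: (up_log 2 E) (up_log 2 K2.+2) => x y h; nia.
have e4 : 2 ^ K2.+1 <= 40 * (s * n) by rewrite expnS; lia.
have l3 : l.+2 ^ 3 <= 27 * l ^ 3.
  by rewrite -[27]/(3 ^ 3) -expnMn leq_exp2r //; lia.
rewrite /cost_bound -/L -/LL /mcost.
apply: (@leq_trans (46 * (4000 * ((27 * l ^ 3) * (E * L * ((40 * (s * n)) * (E * L * (H * LL)))))))).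
  exact: (leq_mul (leqnn _) (leq_mul (leqnn _) (leq_mul l3 (leq_mul KE (leq_mul e4 (leq_mul KE KH)))))).
by apply/eq_leq; move: (46) (4000) => x y; ring.
Qed.

End Cost.

Lemma spec_zero (F : fieldType) A k (R : A -> Prop) c :
  spec (k (0 : F)) R c -> spec (Zero k) R c.+1.
Proof. by case. Qed.

Lemma spec_one (F : fieldType) A k (R : A -> Prop) c :
  spec (k (1 : F)) R c -> spec (One k) R c.+1.
Proof. by case. Qed.

Lemma spec_step_alg (F : fieldType) (n k s l m : nat) (alpha r' : 'I_n -> F)
    (la lw lr : seq F) (B : 'M[{poly F}]_(m, l.+1)) :
  injective alpha -> (0 < k)%N -> (k < n)%N -> (0 < s)%N -> (s <= l)%N ->
  is_basis (@inM F n alpha r' s l) B -> weak_popov (B *m Wmat F k l) ->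
  spec (step_alg n k s l la lw lr (enc_mx B)) (good_output k s l alpha r')
    (46 * (4000 * (l.+2 ^ 3 * ((prec2 n k s).+2 * mcost (prec2 n k s).+1)))).
Proof.
move=> alpha_inj k0 kn s0 sl Bb wp; set K2 := prec2 n k s; set w := (k - 1)%N.
have [d [q [Bq q_inj q_surj dmax]]] := popov_structure alpha_inj k0 kn s0 sl Bb wp.
(* The number of rows is not prescribed; leading positions put them in bijection with the
   columns. *)
have ml : m = l.+1.
  apply/eqP; rewrite eqn_leq; apply/andP; split.
    by have := leq_card q q_inj; rewrite !card_ord.
  have [g gP] : exists g : 'I_l.+1 -> 'I_m, forall j, q (g j) = j.
    exact: (@fin_all_exists _ (fun=> 'I_m) (fun j i => q i = j)).
  have gi : injective g by move=> j j' e; rewrite -(gP j) e gP.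
  by have := leq_card g gi; rewrite !card_ord.
rewrite /step_alg.
case E : [seq i <- _ | _] => [|i tl]; last first.
  have : i \in i :: tl by rewrite mem_head.
  rewrite -E mem_filter mem_iota add0n size_enc => /andP[ct hi].
  by apply: spec_ret; apply: (@trivial_good _ _ _ _ _ _ _ _ _ _ _ _ _ B (Ordinal hi)).
have dn i : (d i <= s * n)%N.
  have [i0 qi0] := q_surj ord_max.
  have Bw j : B i0 j != 0 -> (size (B i0 j) + j * w <= (d i0).+1)%N.
    move=> Bj; have [_ + _] := Bq i0 => /(_ j); rewrite mxE mulW size_mulXn //.
    by rewrite addnC.
  have [+ _ _] := Bq i0; rewrite qi0 mxE mulW => h1.
  have B0 : B i0 ord_max != 0.
    by apply: contraPneq h1 => ->; rewrite mul0r size_poly0.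
  rewrite size_mulXn //= -/w in h1.
  (* With a constant last coefficient this row would pass [const_top], but the list of such rows is
     empty. *)
  have s2 : (1 < size (B i0 ord_max))%N.
    rewrite ltn_neqAle size_poly_gt0 B0 andbT; apply/negP => /eqP s1.
    have : (i0 : nat) \in [seq i <- iota 0 (size (enc_mx B)) | const_top w l (nth [::] (enc_mx B) i)].
      rewrite mem_filter mem_iota leq0n add0n size_enc ltn_ord !andbT /const_top; apply/andP; split.
        by rewrite (ent_enc B i0 ord_max : nth [::] (nth [::] (enc_mx B) i0) l = _) -s1.
      apply/allP => j; rewrite mem_iota add0n => hj.
      rewrite (ent_enc B i0 (Ordinal (hj : (j < l.+1)%N)) : nth [::] (nth [::] (enc_mx B) i0) j = _).
      rewrite /nilp size_poly_eq0; have [//|Bj] := eqVneq (B i0 (Ordinal (hj : (j < l.+1)%N))) 0.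
      by apply: leq_trans (Bw _ Bj) _; rewrite -h1 -s1 addnC.
    by rewrite E.
  have lwd : (l * w < d i0)%N by move: h1 s2; move: (size _) => x; lia.
  have := dmax i0; rewrite qi0 /= => h2.
  have lsn : (l * w < s * n)%N by move: h2 lwd; rewrite /w; lia.
  apply: leq_trans (dmax i) _; rewrite geq_max leqnn /=.
  apply: leq_trans (ltnW lsn); rewrite leq_mul2r -ltnS ltn_ord orbT //.
pose X := (4000 * (l.+2 ^ 3 * (K2.+2 * mcost K2.+1)))%N.
have X0 : (0 < X)%N.
  have mc : (0 < mcost K2.+1)%N by apply: leq_trans (mcost_gt0 _); rewrite expn_gt0.
  by move: mc; rewrite /X; move: (mcost _) => y y0; rewrite !muln_gt0 y0.
(* At most six operations produce the constants, test the characteristic and invert [p]; they are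
   charged to the remaining [6 * X]. *)
have c6 : ((40 * X).+1.+1.+1.+1.+1.+1 <= 46 * X)%N by lia.
have c5 : ((40 * X).+1.+1.+1.+1.+1 <= 46 * X)%N by lia.
subst m; case: (eqVneq (1 + 1 : F) 0) => [two0|two0].
  apply: (spec_weaken _ (fun _ h => h) c6).
  apply: spec_zero; apply: spec_one; apply: spec_op; apply: spec_iszero.
  rewrite /= two0 eqxx; apply: spec_op; apply: spec_op => /=.
  apply: (spec_reduceM alpha_inj k0 kn s0 sl _ _ Bb Bq q_inj dn); first by right.
  have three : 3%:R = 1 :> F by rewrite !mulrS mulr0n addr0 two0 addr0.
  by rewrite three add0r divr1 mulr1.
apply: (spec_weaken _ (fun _ h => h) c5).
apply: spec_zero; apply: spec_one; apply: spec_op; apply: spec_iszero.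
rewrite /= (negPf two0); apply: spec_op => /=.
apply: (spec_reduceM alpha_inj k0 kn s0 sl _ _ Bb Bq q_inj dn); first by left.
by rewrite mul1r mulVf.
Qed.

Theorem corollary2 :
  exists alg : algo,
  forall c : nat, exists C n0 : nat,
  forall (F : finFieldType) (n k s l m : nat) (alpha w r : 'I_n -> F)
         (B : 'M[{poly F}]_(m, l.+1)),
    (1 <= k)%N -> (k < n)%N -> (n < #|F|)%N ->
    injective alpha -> (forall i, alpha i != 0) -> (forall i, w i != 0) ->
    (1 <= s)%N -> (s <= l)%N ->
    let r' := fun i => r i / w i in
    is_basis (@inM F n alpha r' s l) B ->
    weak_popov (B *m Wmat F k l) ->
    let res := run (alg F n k s l (enc_vec alpha) (enc_vec w) (enc_vec r)
                        (enc_mx B)) in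
    good_output k s l alpha r' res.1 /\
    ((s <= c * n ^ 2)%N -> (l <= c * n ^ 2)%N -> (n0 <= n)%N ->
     (res.2 <= C * cost_bound n s l)%N).
Proof.
(* The threshold 4 excludes [n = 2], where the iterated logarithm and with it the bound is 0. *)
exists (@step_alg) => c; have [C CP] := reduce_cost c; exists C, 4.
move=> F n k s l m alpha w r B k1 kn nF alpha_inj _ _ s1 sl r' Bb wp res.
have [h1 h2] := spec_step_alg (enc_vec alpha) (enc_vec w) (enc_vec r)
  alpha_inj k1 kn s1 sl Bb wp.
split=> [//|sc lc n4]; apply: leq_trans h2 _; exact: CP.
Qed.
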